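(* Let $E$ be an entire function satisfying (K1)$\sim$(K5), and define $A(z)=\frac{1}{2}(E(z)+E^\sharp(z))$ and $B(z)=\frac{i}{2}(E(z)-E^\sharp(z))$. Let $H(t)=\mathrm{diag}(1/\gamma(t),\gamma(t))$, $\gamma(t)=m(t)^2$, be the Hamiltonian on $[0,\tau)$, where $m(t)=\exp\big(\int_0^t\mu(s)\,ds\big)=\det(1+\mathsf{K}[t])/\det(1-\mathsf{K}[t])$. Let $A(t,z)=m(t)\,\mathfrak{A}(t,z)$ and $B(t,z)=m(t)^{-1}\mathfrak{B}(t,z)$. Then, \begin{enumerate} \item $A(t,z)$ and $B(t,z)$ are real entire functions of $z$ for every fixed $t \in [0,\tau)$, \item $A(t,z)$ and $B(t,z)$ are continuous and piecewise continuously differentiable function of $t$ for every $z \in \mathbb{C}$, \item $A(t,-z)=A(t,z)$ and $B(t,-z)=-B(t,z)$ for every fixed $t \in [0,\tau)$, \item ${}^t(A(t,z), B(t,z))$ solves the canonical system \[ -\frac{d}{dt}\begin{bmatrix} A(t,z) \\ B(t,z)\end{bmatrix} = z \begin{bmatrix} 0 & -1 \\ 1 & 0\end{bmatrix} H(t)\begin{bmatrix} A(t,z) \\ B(t,z)\end{bmatrix} \] on $[0,\tau)$ associated with $H$, \item $A(z)=A(0,z)$, $B(z)=B(0,z)$ and $E(z)=A(0,z) - i B(0,z)$. \end{enumerate}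
   Context: $F^\sharp(z)=\overline{F(\bar z)}$, $(\mathsf{F}f)(z)=\int_{-\infty}^\infty f(x)e^{ixz}dx$, $\Theta=E^\sharp/E$. Conditions: (K1) there is a real-valued $C^1$ function $\varrho$ on $\mathbb{R}$ with $|\varrho(x)|\ll e^{-n|x|}$ for every $n>0$ and $E=\mathsf{F}\varrho$ on $\mathbb{C}$; (K2) there is a real-valued continuous $K$ on $\mathbb{R}$ with $|K(x)|\ll e^{c|x|}$ for some $c\ge0$ and $\Theta(z)=(\mathsf{F}K)(z)$ for $\Im z>c$; (K3) $K=0$ on $(-\infty,0)$; (K4) $K$ is $C^1$ outside a discrete set $\Lambda\subset\mathbb{R}$ and $|K'|$ is locally integrable; (K5) there is $0<\tau\le\infty$ such that $\pm1$ are not eigenvalues of $\mathsf{K}[t]$ for every $t<\tau$, where $\mathsf{K}[t]f(x)=\mathbf{1}_{(-\infty,t]}(x)\int_{-\infty}^tK(x+y)f(y)\,dy$ on $L^2(-\infty,t)$. For $t\in[0,\tau)$, $\varepsilon\in\{\pm1\}$, let $\varphi_t^\varepsilon\in L^2(-\infty,t)$ be the unique solution of $X(x)+\varepsilon\mathbf{1}_{(-\infty,t]}(x)\int_{-\infty}^tK(x+y)X(y)dy=\mathbf{1}_{(-\infty,t]}(x)K(x+t)$, extended by $\phi^\varepsilon(t,x)=K(x+t)-\varepsilon\int_{-\infty}^tK(x+y)\varphi_t^\varepsilon(y)dy$ (with $\phi^\varepsilon(0,x)=K(x)$); $\mu(t)=\phi^+(t,t)+\phi^-(t,t)$. Define $\mathfrak{A}(t,z)=\frac12E(z)\big(e^{izt}+\int_t^\infty\phi^+(t,x)e^{izx}dx\big)$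 and $-i\mathfrak{B}(t,z)=\frac12E(z)\big(e^{izt}-\int_t^\infty\phi^-(t,x)e^{izx}dx\big)$ for $\Im z>c$; these extend to entire functions of $z$. *)

(* Defs.v *)
From HB Require Import structures.
From mathcomp Require Import all_boot all_order all_algebra.
From mathcomp Require Import complex.
From mathcomp Require Import all_classical all_reals all_analysis.

Set Implicit Arguments.
Unset Strict Implicit.
Unset Printing Implicit Defensive.

Import Order.TTheory GRing.Theory Num.Theory.
Import numFieldNormedType.Exports.

Local Open Scope classical_set_scope.
Local Open Scope ring_scope.
Local Open Scope complex_scope.

(* R[i] carries its topology and its normed-module structure over itself only
   through the alias R[i]^o, whence the casts below. *)

Definition expC {R : realType} (z : R[i]) : R[i] :=
  expR (complex.Re z) * cos (complex.Im z) +i*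
  (expR (complex.Re z) * sin (complex.Im z)).

Definition entire {R : realType} (F : R[i] -> R[i]) : Prop :=
  forall z : R[i]^o, derivable (F : R[i]^o -> R[i]^o) z 1.

Definition sharp {R : realType} (F : R[i] -> R[i]) : R[i] -> R[i] :=
  fun z => (F (z^*))^*.

Definition real_entire {R : realType} (F : R[i] -> R[i]) : Prop :=
  entire F /\ sharp F =1 F.

Definition Cintegral {R : realType} (D : set R) (g : R -> R[i]) : R[i] :=
  (\int[lebesgue_measure]_(x in D) complex.Re (g x)) +i*
  (\int[lebesgue_measure]_(x in D) complex.Im (g x)).

Definition eiz {R : realType} (z : R[i]) (x : R) : R[i] := expC ('i%C * z * x%:C).

Definition fourier {R : realType} (f : R -> R) (z : R[i]) : R[i] :=
  Cintegral setT (fun x => (f x)%:C * eiz z x).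

Definition Theta {R : realType} (E : R[i] -> R[i]) (z : R[i]) : R[i] :=
  sharp E z / E z.

(* L^2(-oo, t), as functions on the line whose values off ]-oo, t[ are ignored *)
Definition in_L2 {R : realType} (t : R) (f : R -> R[i]) : Prop :=
  (fun x => complex.Re (f x)) \_ `]-oo, t[ \in Lfun lebesgue_measure 2%:E /\
  (fun x => complex.Im (f x)) \_ `]-oo, t[ \in Lfun lebesgue_measure 2%:E.

Definition ae_on {R : realType} (t : R) (P : R -> Prop) : Prop :=
  {ae (lebesgue_measure : set R -> \bar R), forall x, `]-oo, t[%classic x -> P x}.

Definition Kop {R : realType} (K : R -> R) (t : R) (f : R -> R[i]) : R -> R[i] :=
  fun x => (\1_(`]-oo, t]) x)%:C *
           Cintegral `]-oo, t[ (fun y => (K (x + y))%:C * f y).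

Definition Kop_eigenvalue {R : realType} (K : R -> R) (t : R) (lam : R[i]) : Prop :=
  exists f : R -> R[i],
    [/\ in_L2 t f, ~ ae_on t (fun x => f x = 0) &
        ae_on t (fun x => Kop K t f x = lam * f x)].

Definition K1 {R : realType} (E : R[i] -> R[i]) (rho : R -> R) : Prop :=
  [/\ (forall x, derivable rho x 1), continuous (derive1 rho),
      (forall n : nat, (0 < n)%N ->
         exists M, forall x, `|rho x| <= M * expR (- (n%:R * `|x|))) &
      forall z, E z = fourier rho z].

(* Theta is the meromorphic function E^sharp / E, so E is not identically 0,
   and the identity is only required where E z != 0: at a zero of E the quotient
   below is the junk value 0. *)
Definition K2 {R : realType} (E : R[i] -> R[i]) (K : R -> R) (c : R) : Prop :=
  [/\ continuous K, 0 <= c,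
      (exists M, forall x, `|K x| <= M * expR (c * `|x|)),
      (exists z, E z != 0) &
      forall z, c < complex.Im z -> E z != 0 -> Theta E z = fourier K z].

Definition K3 {R : realType} (K : R -> R) : Prop := forall x, x < 0 -> K x = 0.

(* a discrete set here is one without limit points in the line (so it is closed) *)
Definition K4 {R : realType} (K : R -> R) : Prop :=
  exists Lam : set R,
    [/\ limit_point Lam = set0,
        (forall x, ~ Lam x -> derivable K x 1 /\ {for x, continuous (derive1 K)}) &
        locally_integrable setT (fun x => `|derive1 K x|)].

Definition K5 {R : realType} (K : R -> R) (tau : \bar R) : Prop :=
  (0 < tau)%E /\
  forall t : R, (t%:E < tau)%E ->
    ~ Kop_eigenvalue K t 1 /\ ~ Kop_eigenvalue K t (-1).

Definition is_phi_sol {R : realType} (K : R -> R) (eps t : R) (X : R -> R) : Prop :=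
  in_L2 t (fun x => (X x)%:C) /\
  ae_on t (fun x => (X x)%:C + eps%:C * Kop K t (fun y => (X y)%:C) x =
                    (\1_(`]-oo, t]) x * K (x + t))%:C).

(* A representative of the unique class of solutions (real-valued because K is);
   everything below depends only on its class. *)
Definition phi_sol {R : realType} (K : R -> R) (eps t : R) : R -> R :=
  xget (fun=> 0) [set X | is_phi_sol K eps t X].

Definition phi {R : realType} (K : R -> R) (eps t x : R) : R :=
  K (x + t) -
  eps * \int[lebesgue_measure]_(y in `]-oo, t[) (K (x + y) * phi_sol K eps t y).

Definition mufun {R : realType} (K : R -> R) (t : R) : R :=
  phi K 1 t t + phi K (-1) t t.

Definition mfun_of {R : realType} (K : R -> R) (t : R) : R :=
  expR (\int[lebesgue_measure]_(s in `[0, t]) mufun K s).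

(* fredholm_int k D n [::] = \int_{D^n} det (k (x_i, x_j))_{i, j < n} dx *)
Fixpoint fredholm_int {R : realType} (k : R -> R -> R) (D : set R)
    (n : nat) (s : seq R) : R :=
  if n is n'.+1 then
    \int[lebesgue_measure]_(x in D) fredholm_int k D n' (x :: s)
  else \det (\matrix_(i < size s, j < size s) k s`_i s`_j).

(* Fredholm determinant det(1 + lam k) of the integral operator with continuous
   kernel k on L^2(D), by Fredholm's series *)
Definition fredholm_det {R : realType} (k : R -> R -> R) (D : set R) (lam : R) : R :=
  limn (series (fun n : nat => lam ^+ n / n`!%:R * fredholm_int k D n [::])).

Definition detK {R : realType} (K : R -> R) (t lam : R) : R :=
  fredholm_det (fun x y => K (x + y)) `]-oo, t[ lam.

(* the entire function agreeing with F on Im z > c (unique if it exists) *)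
Definition entire_extension {R : realType} (c : R) (F : R[i] -> R[i]) :
    R[i] -> R[i] :=
  xget (fun=> 0)
    [set G : R[i] -> R[i] | entire G /\ forall z, c < complex.Im z -> G z = F z].

Definition frakA {R : realType} (E : R[i] -> R[i]) (K : R -> R) (c t : R) :
    R[i] -> R[i] :=
  entire_extension c (fun z => 2^-1 * E z *
    (eiz z t + Cintegral `]t, +oo[ (fun x => (phi K 1 t x)%:C * eiz z x))).

(* the factor 'i solves - i B(t, z) = E(z) (...) / 2 for B(t, z) *)
Definition frakB {R : realType} (E : R[i] -> R[i]) (K : R -> R) (c t : R) :
    R[i] -> R[i] :=
  entire_extension c (fun z => 'i%C * (2^-1 * E z *
    (eiz z t - Cintegral `]t, +oo[ (fun x => (phi K (-1) t x)%:C * eiz z x)))).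

Definition Afun {R : realType} (E : R[i] -> R[i]) (z : R[i]) : R[i] :=
  2^-1 * (E z + sharp E z).

Definition Bfun {R : realType} (E : R[i] -> R[i]) (z : R[i]) : R[i] :=
  'i%C / 2 * (E z - sharp E z).

Definition At {R : realType} (E : R[i] -> R[i]) (K : R -> R) (c t : R) (z : R[i]) :
    R[i] :=
  (mfun_of K t)%:C * frakA E K c t z.

Definition Bt {R : realType} (E : R[i] -> R[i]) (K : R -> R) (c t : R) (z : R[i]) :
    R[i] :=
  (mfun_of K t)^-1%:C * frakB E K c t z.

Definition gamma {R : realType} (K : R -> R) (t : R) : R := mfun_of K t ^+ 2.

Definition Hamiltonian {R : realType} (K : R -> R) (t : R) : 'M[R]_2 :=
  diag_mx (\row_(j < 2) (if j == 0 then (gamma K t)^-1 else gamma K t)).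

Definition symplJ {R : realType} : 'M[R]_2 :=
  \matrix_(i < 2, j < 2) (if i == j then 0 else if i == 0 then -1 else 1).

Definition dom {R : realType} (tau : \bar R) : set R :=
  [set t | 0 <= t /\ (t%:E < tau)%E].

(* derivative of a function of a real variable along I, hence one-sided at an
   endpoint of I *)
Definition has_derivative_in {R : realType} {V : normedModType R[i]} (I : set R)
    (f : R -> V) (t : R) (d : V) : Prop :=
  ((s - t)^-1)%:C *: (f s - f t) @[s --> within I t^'] --> d.

(* C^1 along I except at break points accumulating nowhere in I, where the
   derivative still has one-sided limits *)
Definition piecewise_C1 {R : realType} (I : set R) (f : R -> R[i]) : Prop :=
  exists (S : set R) (f' : R -> R[i]^o),
    [/\ limit_point S `&` I = set0,
        (forall t, I t -> ~ S t ->
           has_derivative_in I (f : R -> R[i]^o) t (f' t) /\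
           f' s @[s --> within I (nbhs t)] --> f' t) &
        forall t, I t ->
          (exists l : R[i]^o, f' s @[s --> within I t^'-] --> l) /\
          (exists l : R[i]^o, f' s @[s --> within I t^'+] --> l)].

Definition col2 {T : Type} (a b : T) : 'cV[T]_2 :=
  \col_(i < 2) (if i == 0 then a else b).

Definition solves_canonical_system {R : realType} (I : set R) (H : R -> 'M[R]_2)
    (z : R[i]) (Y : R -> 'cV[R[i]]_2) : Prop :=
  forall t, I t -> exists2 Y' : 'cV[R[i]]_2,
    has_derivative_in I Y t Y' &
    - Y' = z *: (map_mx (real_complex R) (symplJ *m H t) *m Y t).

(* Main.v *)
(* As K vanishes on ]-oo, 0], the operator K_t lives on [-t, t]; on a fixed box
   [-T, T] with T < tau the Fredholm determinants D^eps(t) = det(1 + eps K_t) do not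
   vanish, since a zero would produce an eigenvalue, and the Fredholm series give
   resolvents bounded uniformly in t.  Writing phi^eps(t, .) as the resolvent
   applied to K(. + t), differentiating the integral equation in t, and integrating
   it by parts in x, one finds that
     a(t, z) = e^{izt} - int_{-T}^t phi^+(t, x) e^{izx} dx,
     b(t, z) = e^{izt} + int_{-T}^t phi^-(t, x) e^{izx} dx
   satisfy a' = iz b - mu a and b' = iz a + mu b.  As rho is real,
   E^#(z) = E(- z), so E(z) times the Fourier transform of K is E(- z), and the
   transform of the equation for phi^eps gives
     2 frakA(t, z) = E(z) a(t, z) + E(- z) a(t, - z),
     - 2 i frakB(t, z) = E(z) b(t, z) - E(- z) b(t, - z),
   first for Im z > c and then everywhere by the identity theorem.  The system,
   the parities and the values at t = 0 follow.  Finally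
   D^eps(t) = exp(eps int_0^t phi^eps(s, s) ds), read off from the Fredholm series,
   identifies m with the quotient of the determinants. *)
Require Import Defs.
From HB Require Import structures.
From mathcomp Require Import all_boot all_order all_algebra.
From mathcomp Require Import fingroup perm.
From mathcomp Require Import complex.
From mathcomp Require Import all_classical all_reals all_analysis.
From mathcomp Require Import measurable_realfun.
From mathcomp Require Import ring lra.

Set Implicit Arguments.
Unset Strict Implicit.
Unset Printing Implicit Defensive.

Import Order.TTheory GRing.Theory Num.Theory.
Import numFieldNormedType.Exports.

Local Open Scope classical_set_scope.
Local Open Scope ring_scope.
Local Open Scope complex_scope.

(** * Calculus on a compact interval *)

(** The hypothesis on eigenvalues concerns classes in L^2, whereas the differential equations live
    on the diagonal [x = t] and ask for values at points. The analysis is therefore done for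
    continuous functions on [[-T, T]], and a separate argument shows that an L^2 solution has a
    continuous representative. Hadamard's inequality makes the Fredholm series converge uniformly in
    [t]. Nonvanishing of the determinant at [lam = 1] and [lam = -1] uses the parameter: the
    equation for the bordered series, expanded about [lam], turns a zero of the determinant into the
    vanishing of all its Taylor coefficients there, against the value 1 at the parameter 0. The
    integration by parts in [x] exchanges [eps] and [- eps] and leaves an unknown boundary value at
    [t]; solving for it requires that [eps] times the integral of [phi^eps(t, .)] differ from 1,
    which is injectivity at [- eps]. By symmetry of the kernel, [a] and [b] are values at [x = t] of
    resolvents applied to [e^{izx}], so that their system is the chain rule along the diagonal. *)

Section uniform_continuity.
Context {R : realType}.
Notation mu := (@lebesgue_measure R).
Implicit Types (a b c d e x y : R) (h f g : R -> R).

(** Continuity on a compact interval is carried in this uniform form, equivalent by [uc_within] and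
    [within_uc]: closure properties, parameter integrals and uniform limits then reduce to
    inequalities between reals. *)
Definition uc a b h := forall e, 0 < e -> exists2 d, 0 < d &
  forall x y, a <= x <= b -> a <= y <= b -> `|x - y| < d -> `|h x - h y| < e.

(** There is no orientation: for [b < a] the interval is empty and the value is 0, whence the
    hypotheses [a <= b] below. *)
Definition itg a b h : R := \int[mu]_(x in `[a, b]) h x.

Lemma uc_within a b h : uc a b h -> {within `[a, b], continuous h}.
Proof.
move=> H; apply/subspace_continuousP => x /=; rewrite in_itv /= => xab.
apply/cvgrPdist_lt => e e0; have [d d0 hd] := H e e0.
rewrite /prop_near1/= nbhs_filterE /within /=; near=> y => yab.
by apply: hd => //; near: y; exact: (@cvgr_dist_lt _ R^o).
Unshelve. all: by end_near. Qed.

(** Heine-Cantor. The predicate [P d] holds near each point for all small [d]; compactness of the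
    segment, in its near-covering form, yields one [d] for all points. *)
Lemma within_uc a b h : {within `[a, b], continuous h} -> uc a b h.
Proof.
move=> /subspace_continuousP H e e0.
pose P d x := a <= x <= b ->
  forall y, a <= y <= b -> `|x - y| < d -> `|h x - h y| < e.
have /compact_near_coveringP /(_ R (0^'+) P _) := @segment_compact R a b.
case.
- move=> x /= xab; have /cvgrPdist_lt := H _ xab.
  have e20 : 0 < e / 2 by rewrite divr_gt0.
  move=> /(_ _ e20) /nbhs_ballP [d /= d0 hd].
  have d20 : 0 < d / 2 by rewrite divr_gt0.
  exists (ball x (d / 2), [set r | r < d / 2]) => /=.
    split; first exact: nbhsx_ballx.
    by apply: nbhs_right_lt.
  move=> [x' d'] /= [xx' dd'] x'ab y yab x'y.
  have h1 : `|h x - h x'| < e / 2.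
    apply: hd; last by rewrite /= in_itv.
    by rewrite /ball/= (lt_trans xx')// ltr_pdivrMr// ltr_pMr// ltr1n.
  have h2 : `|h x - h y| < e / 2.
    apply: hd; last by rewrite /= in_itv.
    rewrite /ball/= (_ : x - y = (x - x') + (x' - y)); last by ring.
    rewrite (le_lt_trans (ler_normD _ _))// [X in _ < X](splitr d).
    by rewrite ltrD// (lt_trans x'y).
  rewrite (_ : h x' - h y = (h x - h y) - (h x - h x')); last by ring.
  by rewrite (le_lt_trans (ler_normB _ _))// (splitr e) ltrD.
- move=> d /= d0 hd; exists (d / 2); first by rewrite divr_gt0.
  move=> x y xab yab xy; apply: (hd (d / 2)) => //=.
  + by rewrite /ball_/= sub0r normrN gtr0_norm ?divr_gt0// ltr_pdivrMr// ltr_pMr// ltr1n.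
  + by rewrite divr_gt0.
Qed.

Lemma uc_cont a b h : continuous h -> uc a b h.
Proof. by move=> H; apply/within_uc/continuous_subspaceT. Qed.

Lemma uc_sub a b a' b' h : a' <= a -> b <= b' -> uc a' b' h -> uc a b h.
Proof.
move=> aa bb H e /H[d d0 hd]; exists d => // x y /andP[? ?] /andP[? ?]; apply: hd; lra.
Qed.

Lemma uc_eq a b g h : (forall x, a <= x <= b -> g x = h x) -> uc a b g -> uc a b h.
Proof.
by move=> E H e /H[d d0 hd]; exists d => // x y xab yab; rewrite -!E//; apply: hd.
Qed.

Lemma uc_cst a b k : uc a b (fun=> k).
Proof. by move=> e e0; exists 1 => // *; rewrite subrr normr0. Qed.

Lemma uc_id a b : uc a b id.
Proof. by move=> e e0; exists e. Qed.

Lemma ucD a b g h : uc a b g -> uc a b h -> uc a b (fun x => g x + h x).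
Proof.
move=> G H e e0; have e20 : 0 < e / 2 by rewrite divr_gt0.
have [d1 d10 h1] := G _ e20; have [d2 d20 h2] := H _ e20.
exists (Num.min d1 d2); first by rewrite lt_min d10.
move=> x y xab yab; rewrite lt_min => /andP[xy1 xy2].
rewrite (_ : _ - _ = (g x - g y) + (h x - h y)); last by ring.
by rewrite (le_lt_trans (ler_normD _ _))// (splitr e) ltrD// ?h1 ?h2.
Qed.

Lemma uc_bounded a b h : uc a b h ->
  exists2 M, 0 < M & forall x, a <= x <= b -> `|h x| <= M.
Proof.
have [ab|ba] := leP a b; last first.
  by exists 1 => // x /andP[ax xb]; move: ba; rewrite ltNge (le_trans ax xb).
move=> /uc_within H.
have H' : {within `[a, b], continuous (fun x => `|h x|)}.
  by move=> x; apply: (cvg_comp _ _ (H x)); apply: norm_continuous.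
have [m mab hm] := EVT_max ab H'.
exists (`|h m| + 1); first by rewrite ltr_wpDl.
by move=> x xab; rewrite (le_trans (hm x _)) ?in_itv// lerDl.
Qed.

Lemma ucM a b g h : uc a b g -> uc a b h -> uc a b (fun x => g x * h x).
Proof.
move=> G H e e0.
have [M M0 hM] := uc_bounded G; have [N N0 hN] := uc_bounded H.
have e1 : 0 < e / (2 * N) by rewrite divr_gt0// mulr_gt0.
have e2 : 0 < e / (2 * M) by rewrite divr_gt0// mulr_gt0.
have [d1 d10 h1] := G _ e1; have [d2 d20 h2] := H _ e2.
exists (Num.min d1 d2); first by rewrite lt_min d10.
move=> x y xab yab; rewrite lt_min => /andP[xy1 xy2].
rewrite (_ : _ - _ = (g x - g y) * h x + g y * (h x - h y)); last by ring.
rewrite (le_lt_trans (ler_normD _ _))// !normrM.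
rewrite (_ : e = e / (2 * N) * N + M * (e / (2 * M))); last first.
  by field; rewrite !gt_eqF.
apply: ltr_leD.
  rewrite (@le_lt_trans _ _ (`|g x - g y| * N)) ?ler_wpM2l ?hN//.
  by rewrite ltr_pM2r// h1.
by rewrite ler_pM ?hM// ltW// h2.
Qed.

Lemma ucZ a b k h : uc a b h -> uc a b (fun x => k * h x).
Proof. by move=> H; apply: ucM => //; apply: uc_cst. Qed.

Lemma ucB a b g h : uc a b g -> uc a b h -> uc a b (fun x => g x - h x).
Proof.
move=> G H; apply: ucD => //; apply: (@uc_eq _ _ (fun x => -1 * h x)); last exact: ucZ.
by move=> *; rewrite mulN1r.
Qed.

Lemma uc_lim a b h (hn : nat -> R -> R) : (forall n, uc a b (hn n)) ->
  (forall e, 0 < e -> exists n, forall x, a <= x <= b -> `|h x - hn n x| <= e) ->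
  uc a b h.
Proof.
move=> H L e e0; have e3 : 0 < e / 3 by rewrite divr_gt0.
have [n hn'] := L _ e3; have [d d0 hd] := H n _ e3.
exists d => // x y xab yab xy.
have h1 := hn' x xab; have h2 := hn' y yab; have h3 := hd x y xab yab xy.
rewrite (_ : _ - _ = (h x - hn n x) + (hn n x - hn n y) - (h y - hn n y)); last by ring.
rewrite (le_lt_trans (ler_normB _ _))// (le_lt_trans (lerD (ler_normD _ _) (lexx _)))//.
lra.
Qed.

Lemma uc_int a b h : uc a b h -> mu.-integrable `[a, b] (EFin \o h).
Proof.
by move=> /uc_within H; apply: continuous_compact_integrable => //; exact: segment_compact.
Qed.

Lemma itg_eq a b g h : (forall x, a <= x <= b -> g x = h x) -> itg a b g = itg a b h.
Proof.
by move=> E; apply: eq_Rintegral => x; rewrite inE/= in_itv/=; exact: E.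
Qed.

Lemma itgD a b g h : uc a b g -> uc a b h ->
  itg a b (fun x => g x + h x) = itg a b g + itg a b h.
Proof. by move=> /uc_int G /uc_int H; apply: RintegralD. Qed.

Lemma itgB a b g h : uc a b g -> uc a b h ->
  itg a b (fun x => g x - h x) = itg a b g - itg a b h.
Proof. by move=> /uc_int G /uc_int H; apply: RintegralB. Qed.

Lemma itgZ a b k h : uc a b h -> itg a b (fun x => k * h x) = k * itg a b h.
Proof. by move=> /uc_int H; apply: RintegralZl. Qed.

Lemma itg_cst a b k : a <= b -> itg a b (fun=> k) = (b - a) * k.
Proof.
move=> ab; rewrite /itg Rintegral_cst//.
have E := lebesgue_measure_itv (R := R) `[a, b].
transitivity (k * fine (if (a%:E < b%:E)%E then b%:E - a%:E else 0)%E); first by congr (_ * fine _).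
rewrite lte_fin; have [_|ba] := ltP a b; first by rewrite -EFinB/= mulrC.
have -> : a = b by apply/le_anti; rewrite ab ba.
by rewrite subrr/= mul0r mulr0.
Qed.

Lemma itg0 a b : itg a b (fun=> 0) = 0.
Proof. by rewrite /itg Rintegral_cst// mul0r. Qed.

Lemma itg_pt a h : itg a a h = 0.
Proof. by rewrite /itg set_itv1 Rintegral_set1. Qed.

Lemma itg_le a b g h : uc a b g -> uc a b h ->
  (forall x, a <= x <= b -> g x <= h x) -> itg a b g <= itg a b h.
Proof.
move=> /uc_int G /uc_int H gh; apply: le_Rintegral => // x; rewrite /= in_itv/=; exact: gh.
Qed.

Lemma itg_bound a b M h : a <= b -> uc a b h ->
  (forall x, a <= x <= b -> `|h x| <= M) -> `|itg a b h| <= (b - a) * M.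
Proof.
move=> ab H hM; rewrite ler_norml -mulrN -!itg_cst//.
apply/andP; split; apply: itg_le => //; try exact: uc_cst.
  by move=> x /hM; rewrite ler_norml => /andP[].
by move=> x /hM; rewrite ler_norml => /andP[].
Qed.

Lemma itg_cat a b c h : a <= b -> b <= c -> uc a c h ->
  itg a c h = itg a b h + itg b c h.
Proof.
move=> ab bc /[dup] /(uc_sub ab (lexx _))/uc_int Hb /uc_int H.
have := Rintegral_itvB (x := b) H; rewrite !bnd_simp => /(_ ab bc).
rewrite Rintegral_itv_obnd_cbnd; last first.
  by apply: integrableS Hb => //; apply: subset_itvr; rewrite bnd_simp.
by rewrite /itg => <-; rewrite addrC subrK.
Qed.

(** The sample point [z] may be either end of [[x, y]], so that the left and right derivatives of
    the primitive come out of one estimate, with [d] independent of the base point. *)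
Lemma itg_ftc a b h : uc a b h -> forall e, 0 < e -> exists2 d, 0 < d &
  forall x y, a <= x <= y -> y <= b -> `|x - y| < d -> forall z, x <= z <= y ->
  `|itg a y h - itg a x h - (y - x) * h z| <= e * `|y - x|.
Proof.
move=> H e e0; have [d d0 hd] := H e e0; exists d => // x y /andP[ax xy] yb xyd z /andP[xz zy].
rewrite (@itg_cat a x y)//; last exact: uc_sub H.
have H' : uc x y h by apply: uc_sub H.
rewrite (addrC (itg a x h)) addrK -itg_cst// -itgB ?(uc_cst _ _ _)//; last exact: uc_cst.
rewrite (ger0_norm (x := y - x)) ?subr_ge0// mulrC; apply: itg_bound => //.
  by apply: ucB (uc_cst _ _ _); apply: uc_sub H.
move=> w /andP[xw wy]; apply/ltW/hd; [lra|lra|].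
rewrite (le_lt_trans _ xyd)//.
rewrite (ler0_norm (x := x - y)) ?subr_le0// ler_norml; lra.
Qed.

(** The derivative [l] at [x] along [[a, b]], one-sided when [x] is an endpoint; as an error bound
    it involves no quotient. *)
Definition dw a b f x (l : R) := forall e, 0 < e -> exists2 d, 0 < d &
  forall y, a <= y <= b -> `|y - x| < d -> `|f y - f x - (y - x) * l| <= e * `|y - x|.

Lemma dwB a b f g x l k : dw a b f x l -> dw a b g x k ->
  dw a b (fun y => f y - g y) x (l - k).
Proof.
move=> F G e e0; have e20 : 0 < e / 2 by rewrite divr_gt0.
have [d1 d10 h1] := F _ e20; have [d2 d20 h2] := G _ e20.
exists (Num.min d1 d2); first by rewrite lt_min d10.
move=> y yab; rewrite lt_min => /andP[xy1 xy2].
rewrite (_ : _ - _ = (f y - f x - (y - x) * l) - (g y - g x - (y - x) * k)); last by ring.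
by rewrite (le_trans (ler_normB _ _))// (_ : e * _ = e / 2 * `|y - x| + e / 2 * `|y - x|) ?lerD ?h1 ?h2//; field.
Qed.

Lemma dw_itg a b h x : uc a b h -> a <= x <= b -> dw a b (fun y => itg a y h) x (h x).
Proof.
move=> H /andP[ax xb] e e0; have [d d0 hd] := itg_ftc H e0; exists d => // y /andP[ay yb] yx.
have [xy|/ltW yx'] := leP x y.
  by apply: hd => //; rewrite ?ax ?lexx// distrC.
rewrite distrC (_ : _ - _ = itg a x h - itg a y h - (x - y) * h x); last by ring.
by rewrite (distrC y x); apply: hd; rewrite ?ay ?yx' ?lexx.
Qed.

Lemma dw_within a b f (df : R -> R) : (forall x, a <= x <= b -> dw a b f x (df x)) ->
  {within `[a, b], continuous f}.
Proof.
move=> H; apply/subspace_continuousP => x /=; rewrite in_itv /= => xab.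
apply/cvgrPdist_lt => e e0; have [d d0 hd] := H x xab 1 ltr01.
rewrite /prop_near1/= nbhs_filterE /within /=; near=> y => yab.
rewrite in_itv/= in yab.
have xy : `|y - x| < d.
  by rewrite distrC; near: y; exact: (@cvgr_dist_lt _ R^o).
have := hd y yab xy; rewrite mul1r => {}hd.
have : `|f x - f y| <= (1 + `|df x|) * `|y - x|.
  rewrite (_ : _ - _ = - ((f y - f x - (y - x) * df x) + (y - x) * df x)); last by ring.
  by rewrite normrN (le_trans (ler_normD _ _))// [X in _ <= X]mulrDl mul1r lerD// normrM mulrC.
move=> /le_lt_trans; apply.
rewrite mulrC -ltr_pdivlMr; last by rewrite ltr_wpDr.
rewrite distrC; near: y; apply: (@cvgr_dist_lt _ R^o) => //.
by rewrite divr_gt0// ltr_wpDr.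
Unshelve. all: by end_near. Qed.

Lemma dw_is_derive a b f x l : a < x < b -> dw a b f x l -> is_derive x 1 f l.
Proof.
move=> /andP[ax xb] H.
have L : h^-1 *: ((f \o shift x) (h *: 1) - f x) @[h --> (0:R)^'] --> l.
  apply/cvgrPdist_le => e e0; have [d d0 hd] := H e e0.
  near=> h.
  have h0 : h != 0 by near: h; exact: nbhs_dnbhs_neq.
  have hb : `|h| < Num.min d (Num.min (x - a) (b - x)).
    near: h; apply: dnbhs0_lt.
    by rewrite !lt_min d0 !subr_gt0 ax.
  move: hb; rewrite !lt_min => /andP[hd1 /andP[hxa hbx]].
  rewrite /= scaler1 /GRing.scale/=.
  have hh : 0 < `|h| by rewrite normr_gt0.
  rewrite -(ler_pM2r hh) -normrM.
  have := hd (h + x); rewrite addrK => /(_ _ hd1) H1.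
  rewrite -normrN (_ : - ((l - h^-1 * (f (h + x) - f x)) * h) = f (h + x) - f x - h * l);
    last by field.
  apply: H1; move: hxa hbx; rewrite !ltr_norml; lra.
split; first by apply/cvg_ex; exists l.
by apply: cvg_lim.
Unshelve. all: by end_near. Qed.

Lemma dw0_cst a b f : a <= b -> (forall x, a <= x <= b -> dw a b f x 0) -> f b = f a.
Proof.
move=> ab H.
have [||c _] := @MVT_segment R f (fun=> 0) a b ab.
- move=> x; rewrite in_itv/= => xab; apply: (dw_is_derive xab); apply: H.
  by case/andP: xab => ? ?; rewrite !ltW.
- exact: (@dw_within a b f (fun=> 0)).
by rewrite mul0r => /eqP; rewrite subr_eq0 => /eqP.
Qed.

Lemma dw_sub a b a' b' f x l : a' <= a -> b <= b' -> dw a' b' f x l -> dw a b f x l.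
Proof.
move=> aa bb H e /H[d d0 hd]; exists d => // y /andP[? ?]; apply: hd; lra.
Qed.

(** The difference with the primitive of [h] has derivative 0 along [[a, b]], hence is constant. *)
Lemma ftc2 a b f h : a <= b -> uc a b h -> (forall x, a <= x <= b -> dw a b f x (h x)) ->
  f b - f a = itg a b h.
Proof.
move=> ab H D.
have := @dw0_cst a b (fun y => f y - itg a y h) ab.
rewrite itg_pt subr0 => E; rewrite -E ?subKr ?opprB ?addrC ?subrK//.
move=> x xab; rewrite -[0](subrr (h x)); apply: dwB; first exact: D.
exact: dw_itg.
Qed.

Lemma dw_uc a b f (df : R -> R) : (forall x, a <= x <= b -> dw a b f x (df x)) -> uc a b f.
Proof. by move=> /dw_within/within_uc. Qed.

Definition uc2 a b c d (h : R -> R -> R) := forall e, 0 < e -> exists2 r, 0 < r &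
  forall x x' y y', a <= x <= b -> a <= x' <= b -> c <= y <= d -> c <= y' <= d ->
  `|x - x'| < r -> `|y - y'| < r -> `|h x y - h x' y'| < e.

Lemma uc2_sym a b c d (h : R -> R -> R) : uc2 a b c d h -> uc2 c d a b (fun x y => h y x).
Proof. by move=> H e /H[r r0 hr]; exists r => // *; apply: hr. Qed.

Lemma uc2_l a b c d (h : R -> R -> R) y : uc2 a b c d h -> c <= y <= d -> uc a b (h^~ y).
Proof.
by move=> H yc e /H[r r0 hr]; exists r => // *; apply: hr => //; rewrite subrr normr0.
Qed.

Lemma uc2_r a b c d (h : R -> R -> R) x : uc2 a b c d h -> a <= x <= b -> uc c d (h x).
Proof. by move=> /uc2_sym; apply: uc2_l. Qed.

Lemma uc2_sub a b c d a' b' c' d' (h : R -> R -> R) : a' <= a -> b <= b' -> c' <= c -> d <= d' ->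
  uc2 a' b' c' d' h -> uc2 a b c d h.
Proof.
move=> aa bb cc dd H e /H[r r0 hr]; exists r => // x x' y y' /andP[? ?] /andP[? ?] /andP[? ?] /andP[? ?].
by apply: hr; lra.
Qed.

Lemma uc2Mr a b c d (k : R -> R -> R) (u : R -> R) (M : R) : uc2 a b c d k ->
  (forall x y, a <= x <= b -> c <= y <= d -> `|k x y| <= M) -> uc c d u ->
  uc2 a b c d (fun x y => k x y * u y).
Proof.
move=> kc kM uu e e0; have [N N0 uN] := uc_bounded uu.
have M1 : 0 < `|M| + 1 by rewrite ltr_wpDl.
have [d1 d10 h1] := kc _ (divr_gt0 e0 (mulr_gt0 (ltr0n _ 2) N0)).
have [d2 d20 h2] := uu _ (divr_gt0 e0 (mulr_gt0 (ltr0n _ 2) M1)).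
exists (Num.min d1 d2); first by rewrite lt_min d10.
move=> x x' y y' xP x'P yP y'P; rewrite !lt_min => /andP[xd _] /andP[yd1 yd2].
rewrite (_ : _ - _ = (k x y - k x' y') * u y + k x' y' * (u y - u y')); last by ring.
rewrite (le_lt_trans (ler_normD _ _))// !normrM.
rewrite (_ : e = e / (2 * N) * N + (`|M| + 1) * (e / (2 * (`|M| + 1)))); last first.
  by field; rewrite !gt_eqF.
apply: ltr_leD.
  apply: (@le_lt_trans _ _ (`|k x y - k x' y'| * N)); first by rewrite ler_wpM2l ?uN.
  by rewrite ltr_pM2r// h1.
apply: ler_pM => //; last by rewrite ltW// h2.
by rewrite (le_trans (kM _ _ _ _))// (le_trans (ler_norm _))// lerDl.
Qed.

Lemma uc2Ml a b c d (k : R -> R -> R) (u : R -> R) (M : R) : uc2 a b c d k ->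
  (forall x y, a <= x <= b -> c <= y <= d -> `|k x y| <= M) -> uc a b u ->
  uc2 a b c d (fun x y => k x y * u x).
Proof.
move=> kc kM uu; apply: uc2_sym.
apply: (@uc2Mr c d a b (fun y x => k x y) u M _ _ uu); first exact: uc2_sym.
by move=> y x yP xP; exact: kM.
Qed.

Lemma uc2_itg a b c d (h : R -> R -> R) : c <= d -> uc2 a b c d h -> uc a b (fun x => itg c d (h x)).
Proof.
move=> cd H e e0.
have e1 : 0 < e / (d - c + 1) by rewrite divr_gt0// ltr_wpDl// subr_ge0.
have [r r0 hr] := H _ e1; exists r => // x x' xab x'ab xx'.
rewrite -itgB; [|exact: (uc2_r H)..].
apply: le_lt_trans (itg_bound (M := e / (d - c + 1)) cd _ _) _.
- by apply: ucB; exact: (uc2_r H).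
- by move=> y ycd; rewrite ltW// hr// subrr normr0.
rewrite mulrCA gtr_pMr// ltr_pdivrMr ?mul1r ?ltrDl ?ltr01//.
by rewrite ltr_wpDl// subr_ge0.
Qed.

(* Both iterated integrals over [a, t] x [c, d] vanish at t = a and have the
   same derivative in t. *)
Lemma itg_fubini a b c d (h : R -> R -> R) : a <= b -> c <= d -> uc2 a b c d h ->
  itg a b (fun x => itg c d (h x)) = itg c d (fun y => itg a b (h^~ y)).
Proof.
move=> ab cd H.
have H1 : uc a b (fun x => itg c d (h x)) by exact: uc2_itg H.
have H2 x : a <= x <= b -> uc c d (fun y => itg a x (h^~ y)).
  move=> /andP[ax xb]; apply: (@uc2_itg c d a x (fun y x => h x y)) => //.
  by apply: uc2_sym; apply: uc2_sub H.
have := @dw0_cst a b (fun t => itg a t (fun x => itg c d (h x)) -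
                                 itg c d (fun y => itg a t (h^~ y))) ab.
rewrite itg_pt (_ : itg c d (fun y => itg a a (h^~ y)) = 0); last first.
  by rewrite -(itg0 c d); apply: itg_eq => y _; rewrite itg_pt.
rewrite subr0 => E; apply/eqP; rewrite -subr_eq0; apply/eqP; apply: E.
move=> x xab; rewrite -[0](subrr (itg c d (h x))); apply: dwB; first exact: (dw_itg H1).
move=> e e0.
have e1 : 0 < e / (d - c + 1) by rewrite divr_gt0// ltr_wpDl// subr_ge0.
have [r r0 hr] := H _ e1; exists r => // z zab zx.
have Hx := uc2_r H xab.
rewrite -itgZ// -itgB; [|exact: H2..]; rewrite -itgB; last 2 first.
- by apply: ucB; exact: H2.
- exact: ucZ.
apply: (@le_trans _ _ ((d - c) * (e / (d - c + 1) * `|z - x|))).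
  apply: itg_bound => //.
    by apply: ucB; [apply: ucB; exact: H2|exact: ucZ].
  move=> y ycd.
  have Hy := uc2_l H ycd.
  wlog: x z xab zab zx Hx / x <= z => [hw|xz].
    have [xz|/ltW zx'] := leP x z; first exact: hw.
    rewrite -normrN.
    move: xab zab => /andP[ax xb] /andP[az zb].
    rewrite (@itg_cat a z x)//; last exact: uc_sub Hy.
    rewrite (_ : - (_ - _ - _) = itg z x (h^~ y) - (x - z) * h x y); last by ring.
    rewrite -itg_cst// -itgB; [|by apply: uc_sub Hy|exact: uc_cst].
    rewrite distrC (ger0_norm (x := x - z)) ?subr_ge0// mulrC; apply: itg_bound => //.
      by apply: ucB (uc_cst _ _ _); apply: uc_sub Hy.
    move=> w /andP[zw wx]; rewrite ltW// hr ?subrr ?normr0//; [lra|lra|].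
    by move: zx; rewrite !ltr_norml; lra.
  move: xab zab => /andP[ax xb] /andP[az zb].
  rewrite (@itg_cat a x z)//; last exact: uc_sub Hy.
  rewrite (addrC (itg a x _)) addrK -itg_cst// -itgB; [|by apply: uc_sub Hy|exact: uc_cst].
  rewrite (ger0_norm (x := z - x)) ?subr_ge0// mulrC; apply: itg_bound => //.
    by apply: ucB (uc_cst _ _ _); apply: uc_sub Hy.
  move=> w /andP[zw wx]; rewrite ltW// hr ?subrr ?normr0//; [lra|lra|].
  by move: zx; rewrite !ltr_norml; lra.
rewrite mulrA ler_wpM2r// mulrCA ger_pMr// ler_pdivrMr ?mul1r ?lerDl ?ler01//.
by rewrite ltr_wpDl// subr_ge0.
Qed.

End uniform_continuity.

(** * Complex exponentials and the identity theorem *)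

Section goursat.
Context {R : realType}.
Implicit Types (x y w h e : R) (p q : R -> R -> R).

(** The line integral of [p dx + q dy] counterclockwise along the boundary of the rectangle. *)
Definition circulation p q x0 x1 y0 y1 : R :=
  itg x0 x1 (p^~ y0) - itg x0 x1 (p^~ y1) + itg y0 y1 (q x1) - itg y0 y1 (q x0).

(* differentiable at the point, with the mixed partials d_y p and d_x q equal *)
Definition curl_free_at p q x0 y0 := exists l m n : R,
  forall e, 0 < e -> exists2 d, 0 < d & forall x y, `|x - x0| < d -> `|y - y0| < d ->
  `|p x y - p x0 y0 - (l * (x - x0) + m * (y - y0))| <= e * (`|x - x0| + `|y - y0|) /\
  `|q x y - q x0 y0 - (m * (x - x0) + n * (y - y0))| <= e * (`|x - x0| + `|y - y0|).

Section green.
Variables p q : R -> R -> R.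
Hypothesis pq : forall x y, curl_free_at p q x y.

Lemma curl_free_ucp a b y : uc a b (p^~ y).
Proof.
pose D x := projT1 (cid (pq x y)).
apply: (@dw_uc _ _ _ _ D) => x _; rewrite /D; case: cid => /= l [m [n H]] e /H[d d0 hd].
exists d => // z zab zx.
have := (hd z y zx); rewrite !subrr normr0 mulr0 !addr0 (mulrC l) => /(_ d0)[].
by [].
Qed.

Lemma curl_free_ucq a b x : uc a b (q x).
Proof.
pose D y : R := projT1 (cid (projT2 (cid (projT2 (cid (pq x y)))))).
apply: (@dw_uc _ _ _ _ D) => y _; rewrite /D; case: cid => /= l Hl.
case: cid => /= m Hm; case: cid => /= n H e /H[d d0 hd].
exists d => // z zab zx.
have := (hd x z); rewrite !subrr normr0 mulr0 !add0r => /(_ d0 zx)[_].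
by rewrite mulr0 add0r (mulrC n).
Qed.

Lemma circulation_catx x0 x1 x2 y0 y1 : x0 <= x1 -> x1 <= x2 ->
  circulation p q x0 x2 y0 y1 = circulation p q x0 x1 y0 y1 + circulation p q x1 x2 y0 y1.
Proof.
move=> x01 x12; rewrite /circulation !(@itg_cat _ x0 x1 x2)//; try exact: curl_free_ucp.
ring.
Qed.

Lemma circulation_caty x0 x1 y0 y1 y2 : y0 <= y1 -> y1 <= y2 ->
  circulation p q x0 x1 y0 y2 = circulation p q x0 x1 y0 y1 + circulation p q x0 x1 y1 y2.
Proof.
move=> x01 x12; rewrite /circulation !(@itg_cat _ y0 y1 y2)//; try exact: curl_free_ucq.
ring.
Qed.

(** The affine approximation of [(p, q)] has equal mixed partials [m], so its circulation is 0 and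
    only its error is integrated. *)
Lemma circulation_small x0 y0 w h e (l m n : R) X Y : 0 <= w -> 0 <= h -> 0 <= e ->
  x0 <= X <= x0 + w -> y0 <= Y <= y0 + h ->
  (forall x y, x0 <= x <= x0 + w -> y0 <= y <= y0 + h ->
  `|p x y - p X Y - (l * (x - X) + m * (y - Y))| <= e * (w + h) /\
  `|q x y - q X Y - (m * (x - X) + n * (y - Y))| <= e * (w + h)) ->
  `|circulation p q x0 (x0 + w) y0 (y0 + h)| <= 2 * e * (w + h) ^+ 2.
Proof.
move=> w0 h0 e0 XP YP H.
have xw : x0 <= x0 + w by lra.
have yh : y0 <= y0 + h by lra.
(* [m * h] and [m * w] may be inserted since their integrals, over lengths [w] and [h], cancel; each
   integrand is then a difference of two approximation errors. *)
have -> : circulation p q x0 (x0 + w) y0 (y0 + h) =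
  itg x0 (x0 + w) (fun x => p x y0 - p x (y0 + h) + m * h) +
  itg y0 (y0 + h) (fun y => q (x0 + w) y - q x0 y - m * w).
  rewrite /circulation itgD ?itgB ?itg_cst//; try exact: curl_free_ucp; try exact: curl_free_ucq;
   try exact: uc_cst; try (by apply: ucB; exact: curl_free_ucp);
   try (by apply: ucB; exact: curl_free_ucq).
  ring.
rewrite (le_trans (ler_normD _ _))//.
rewrite (_ : 2 * e * _ = (x0 + w - x0) * (2 * e * (w + h)) +
   (y0 + h - y0) * (2 * e * (w + h))); last by ring.
apply: lerD; apply: itg_bound => //.
- by apply: ucD (uc_cst _ _ _); apply: ucB; exact: curl_free_ucp.
- move=> x xP.
  have [|H1 _] := H x y0 xP; first by lra.
  have [|H2 _] := H x (y0 + h) xP; first by lra.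
  have -> : p x y0 - p x (y0 + h) + m * h =
    (p x y0 - p X Y - (l * (x - X) + m * (y0 - Y))) -
    (p x (y0 + h) - p X Y - (l * (x - X) + m * (y0 + h - Y))) by ring.
  rewrite (le_trans (ler_normB _ _))//.
  move: H1 H2; set A := `|_|; set B := `|_|; lra.
- by apply: ucB (uc_cst _ _ _); apply: ucB; exact: curl_free_ucq.
- move=> y yP.
  have [|_ H1] := H x0 y _ yP; first by lra.
  have [|_ H2] := H (x0 + w) y _ yP; first by lra.
  have -> : q (x0 + w) y - q x0 y - m * w =
    (q (x0 + w) y - q X Y - (m * (x0 + w - X) + n * (y - Y))) -
    (q x0 y - q X Y - (m * (x0 - X) + n * (y - Y))) by ring.
  rewrite (le_trans (ler_normB _ _))//.
  move: H1 H2; set A := `|_|; set B := `|_|; lra.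
Qed.

Let C w h (v : R * R) := circulation p q v.1 (v.1 + w) v.2 (v.2 + h).

(** The circulations of the four quarters add up to the whole; were each smaller than a quarter of
    it, the triangle inequality would fail. *)
Lemma circulation_quarter w h v : 0 <= w -> 0 <= h -> exists v' : R * R,
  [/\ v.1 <= v'.1, v'.1 + w <= v.1 + (w + w), v.2 <= v'.2, v'.2 + h <= v.2 + (h + h) &
  `|C (w + w) (h + h) v| <= 4 * `|C w h v'|].
Proof.
case: v => x y w0 h0.
have E : C (w + w) (h + h) (x, y) =
  C w h (x, y) + C w h (x + w, y) + C w h (x, y + h) + C w h (x + w, y + h).
  rewrite /C /= (addrA x) (addrA y) (@circulation_catx x (x + w) (x + w + w)) ?lerDl//.
  rewrite (@circulation_caty x (x + w) y (y + h) (y + h + h)) ?lerDl//.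
  rewrite (@circulation_caty (x + w) (x + w + w) y (y + h) (y + h + h)) ?lerDl//.
  by rewrite addrACA addrA.
have [v' []] : exists v', [/\ v' \in [:: (x, y); (x + w, y); (x, y + h); (x + w, y + h)]
     & `|C (w + w) (h + h) (x, y)| <= 4 * `|C w h v'|].
  apply: contrapT => /forallNP H.
  have H' v' : v' \in [:: (x, y); (x + w, y); (x, y + h); (x + w, y + h)] ->
     4 * `|C w h v'| < `|C (w + w) (h + h) (x, y)|.
    by move=> hv; rewrite ltNge; apply/negP => ?; apply: (H v').
  have := H' (x, y); have := H' (x + w, y); have := H' (x, y + h); have := H' (x + w, y + h).
  rewrite !inE !eqxx ?orbT ?orTb => /(_ isT) + /(_ isT) + /(_ isT) + /(_ isT).
  have := ler_normD (C w h (x, y) + C w h (x + w, y) + C w h (x, y + h)) (C w h (x + w, y + h)).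
  have := ler_normD (C w h (x, y) + C w h (x + w, y)) (C w h (x, y + h)).
  have := ler_normD (C w h (x, y)) (C w h (x + w, y)).
  rewrite E; lra.
by rewrite !inE => /or4P[] /eqP-> Hv; eexists; split; try exact: Hv => /=; rewrite /=; lra.
Qed.

(** Goursat's bisection: nested rectangles scaled by [2^-n] keep at least [4^-n] of the circulation,
    while near their common point the circulation is [o(4^-n)] by the affine approximation. *)
Theorem circulation_eq0 x0 x1 y0 y1 : x0 <= x1 -> y0 <= y1 -> circulation p q x0 x1 y0 y1 = 0.
Proof.
move=> x01 y01.
set W := x1 - x0; set H := y1 - y0.
have W0 : 0 <= W by rewrite subr_ge0.
have H0 : 0 <= H by rewrite subr_ge0.
pose c n : R := 2^-1 ^+ n.
have c0 n : 0 <= c n by rewrite exprn_ge0// invr_ge0.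
have cS n : c n = c n.+1 + c n.+1 by rewrite /c exprS; field.
have WS n : c n * W = c n.+1 * W + c n.+1 * W by rewrite cS mulrDl.
have HS n : c n * H = c n.+1 * H + c n.+1 * H by rewrite cS mulrDl.
pose step n v := projT1 (cid (@circulation_quarter (c n.+1 * W) (c n.+1 * H) v
   (mulr_ge0 (c0 _) W0) (mulr_ge0 (c0 _) H0))).
(* [v n] is the lower left corner of the [n]-th rectangle, of sides [c n * W] and [c n * H]. *)
pose v := fix v n := if n is n'.+1 then step n' (v n') else (x0, y0).
have vS n : [/\ (v n).1 <= (v n.+1).1, (v n.+1).1 + c n.+1 * W <= (v n).1 + c n * W,
  (v n).2 <= (v n.+1).2, (v n.+1).2 + c n.+1 * H <= (v n).2 + c n * H &
  `|C (c n * W) (c n * H) (v n)| <= 4 * `|C (c n.+1 * W) (c n.+1 * H) (v n.+1)|].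
  by rewrite [v n.+1]/= /step; case: cid => /= v'; rewrite (WS n) (HS n).
have mono (f : nat -> R) : (forall n, f n <= f n.+1) -> forall m n, (m <= n)%N -> f m <= f n.
  move=> hf; exact: (homo_leq lexx le_trans hf).
have mono1 := mono (fun n => (v n).1) (fun n => let: And5 a _ _ _ _ := vS n in a).
have mono2 := mono (fun n => (v n).2) (fun n => let: And5 _ _ a _ _ := vS n in a).
have anti1 m n : (m <= n)%N -> (v n).1 + c n * W <= (v m).1 + c m * W.
  move=> mn; rewrite -lerN2; apply: (mono (fun n => - ((v n).1 + c n * W))) mn => k.
  by rewrite lerN2; case: (vS k).
have anti2 m n : (m <= n)%N -> (v n).2 + c n * H <= (v m).2 + c m * H.
  move=> mn; rewrite -lerN2; apply: (mono (fun n => - ((v n).2 + c n * H))) mn => k.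
  by rewrite lerN2; case: (vS k).
(* Nested intervals: the supremum of the left ends lies in all of them. *)
have nest (f g : nat -> R) : (forall m n, (m <= n)%N -> f m <= f n) ->
   (forall m n, (m <= n)%N -> g n <= g m) -> (forall n, f n <= g n) ->
   exists X, forall n, f n <= X <= g n.
  move=> fm gm fg.
  have fgmn m n : f m <= g n.
    have [mn|/ltnW nm] := leqP m n; first exact: le_trans (fm _ _ mn) (fg _).
    exact: le_trans (fg _) (gm _ _ nm).
  exists (sup (range f)) => n.
  have hs : has_sup (range f).
    by split; [exists (f 0%N), 0%N|exists (g 0%N) => _ [m _ <-]].
  rewrite sup_upper_bound//=; last by exists n.
  by apply: ge_sup => [|_ [m _ <-]//]; exists (f 0%N), 0%N.
have [X hX] : exists X, forall n, (v n).1 <= X <= (v n).1 + c n * W.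
  apply: (nest (fun n => (v n).1)) => // n.
  by rewrite lerDl mulr_ge0.
have [Y hY] : exists Y, forall n, (v n).2 <= Y <= (v n).2 + c n * H.
  apply: (nest (fun n => (v n).2)) => // n.
  by rewrite lerDl mulr_ge0.
have hC n : `|C W H (x0, y0)| * c n ^+ 2 <= `|C (c n * W) (c n * H) (v n)|.
  elim: n => [|n IH]; first by rewrite /c expr0 expr1n mulr1 !mul1r.
  have [_ _ _ _] := vS n; move: IH.
  rewrite (cS n); move: `|C W H _| `|C _ _ (v n)| `|C _ _ (v n.+1)| => A B D h1 h2.
  nra.
have -> : circulation p q x0 x1 y0 y1 = C W H (x0, y0).
  by rewrite /C /= /W /H !subrKC.
apply/eqP; rewrite -normr_le0; apply/ler_addgt0Pl => e e0; rewrite addr0.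
have [l [m [n HXY]]] := pq X Y.
have [e1 e10 he1] : exists2 e1 : R, 0 < e1 & 2 * e1 * (W + H) ^+ 2 <= e.
  exists (e / (2 * ((W + H) ^+ 2 + 1))).
    by rewrite divr_gt0// mulr_gt0// ltr_wpDl// sqr_ge0.
  rewrite (_ : 2 * _ * _ = e * ((W + H) ^+ 2 / ((W + H) ^+ 2 + 1))); last first.
    by field; rewrite gt_eqF// ltr_wpDl// sqr_ge0.
  by rewrite ger_pMr// ler_pdivrMr ?mul1r ?lerDl// ltr_wpDl// sqr_ge0.
have [d d0 hd] := HXY _ e10.
have WH : 0 < W + H + 1 by rewrite ltr_wpDl// addr_ge0.
(* The [N]-th rectangle lies in the [d]-neighbourhood of [(X, Y)]; the factor [c N ^+ 2] then
   cancels on both sides. *)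
have [N hN] : exists N, c N * (W + H) < d.
  have := @cvg_expr R 2^-1.
  rewrite ger0_norm ?invr_ge0// invf_lt1// ltr1n => /(_ isT).
  move=> /cvgrPdist_lt/(_ _ (divr_gt0 d0 WH))[N _ /(_ N (leqnn _))] /=.
  rewrite sub0r normrN ger0_norm ?c0// ltr_pdivlMr// => cN; exists N.
  by rewrite (le_lt_trans _ cN)// ler_wpM2l// lerDl.
have cN0 : 0 < c N by rewrite exprn_gt0// invr_gt0.
rewrite -(ler_pM2r (exprn_gt0 2 cN0)) (le_trans (hC N))//.
have [h1 h2] := (hX N, hY N).
have cW : c N * W <= c N * (W + H) by rewrite ler_wpM2l// lerDl.
have cH : c N * H <= c N * (W + H) by rewrite ler_wpM2l// lerDr.
apply: (@le_trans _ _ (2 * e1 * (c N * W + c N * H) ^+ 2)).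
  apply: (circulation_small (l := l) (m := m) (n := n) _ _ _ h1 h2); rewrite ?mulr_ge0// 1?ltW//.
  move=> x y xP yP.
  have xX : `|x - X| <= c N * W by rewrite ler_norml; lra.
  have yY : `|y - Y| <= c N * H by rewrite ler_norml; lra.
  have [] := hd x y; [by rewrite (le_lt_trans xX)// (le_lt_trans cW)|
                      by rewrite (le_lt_trans yY)// (le_lt_trans cH)|].
  have le1 : e1 * (`|x - X| + `|y - Y|) <= e1 * (c N * W + c N * H) by rewrite ler_pM2l// lerD.
  by move=> /le_trans-/(_ _ le1) ? /le_trans-/(_ _ le1) ?.
by rewrite -mulrDr exprMn mulrCA mulrC ler_wpM2r// exprn_ge0.
Qed.

End green.
End goursat.

Section modulus.
Context {R : realType}.
Implicit Types (z w h : R[i]) (x y : R).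

(** The modulus as a real number; the norm of [R[i]] takes its values in [R[i]], whose order is only
    partial. *)
Definition cn z : R := complex.Re `|z|.

Lemma cnE z : `|z| = (cn z)%:C.
Proof. by rewrite /cn RRe_real// normr_real. Qed.

Lemma cnM z w : cn (z * w) = cn z * cn w.
Proof. by apply: complexI; rewrite rmorphM/= -!cnE normrM. Qed.

Lemma cnX z n : cn (z ^+ n) = cn z ^+ n.
Proof. by apply: complexI; rewrite rmorphXn/= -!cnE normrX. Qed.

Lemma cnD z w : cn (z + w) <= cn z + cn w.
Proof. by rewrite -lecR rmorphD/= -!cnE ler_normD. Qed.

Lemma cnN z : cn (- z) = cn z.
Proof. by rewrite /cn normrN. Qed.

Lemma cnB z w : cn (z - w) <= cn z + cn w.
Proof. by rewrite -(cnN w) cnD. Qed.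

Lemma cn_dist z w : cn (z - w) = cn (w - z).
Proof. by rewrite -cnN opprB. Qed.

Lemma cn_ge0 z : 0 <= cn z.
Proof. by rewrite -lecR -cnE normr_ge0. Qed.

Lemma cn0 : cn 0 = 0.
Proof. by rewrite /cn normr0. Qed.

Lemma cn_eq0 z : (cn z == 0) = (z == 0).
Proof. by rewrite -(inj_eq (@complexI R)) -cnE normr_eq0. Qed.

Lemma cn_gt0 z : (0 < cn z) = (z != 0).
Proof. by rewrite lt_def cn_ge0 andbT cn_eq0. Qed.

Lemma cnV z : cn z^-1 = (cn z)^-1.
Proof. by apply: complexI; rewrite fmorphV/= -!cnE normfV. Qed.

Lemma cn_sqr z : cn z ^+ 2 = complex.Re z ^+ 2 + complex.Im z ^+ 2.
Proof. by rewrite /cn normc_def /= sqr_sqrtr// addr_ge0// sqr_ge0. Qed.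

Lemma cnR x : cn x%:C = `|x|.
Proof.
by apply/eqP; rewrite -(@eqrXn2 _ 2)//= ?cn_ge0// cn_sqr/= expr0n addr0 real_normK// num_real.
Qed.

Lemma cni : cn 'i%C = 1.
Proof.
by apply/eqP; rewrite -(@eqrXn2 _ 2)//= ?cn_ge0// cn_sqr/= expr0n add0r !expr1n.
Qed.

Lemma cn_Re z : `|complex.Re z| <= cn z.
Proof. by rewrite -(@ler_pXn2r _ 2)// ?nnegrE ?cn_ge0// cn_sqr real_normK ?num_real// lerDl sqr_ge0. Qed.

Lemma cn_Im z : `|complex.Im z| <= cn z.
Proof. by rewrite -(@ler_pXn2r _ 2)// ?nnegrE ?cn_ge0// cn_sqr real_normK ?num_real// lerDr sqr_ge0. Qed.

Lemma complexRI z : z = (complex.Re z)%:C + 'i%C * (complex.Im z)%:C.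
Proof. exact: complexE. Qed.

Lemma cn_ReIm z : cn z <= `|complex.Re z| + `|complex.Im z|.
Proof. by rewrite {1}(complexRI z) (le_trans (cnD _ _))// cnM cni mul1r !cnR. Qed.

Lemma ReD z w : complex.Re (z + w) = complex.Re z + complex.Re w.
Proof. by case: z w => [? ?] []. Qed.
Lemma ImD z w : complex.Im (z + w) = complex.Im z + complex.Im w.
Proof. by case: z w => [? ?] []. Qed.
Lemma ReN z : complex.Re (- z) = - complex.Re z.
Proof. by case: z. Qed.
Lemma ImN z : complex.Im (- z) = - complex.Im z.
Proof. by case: z. Qed.
Lemma ReM z w : complex.Re (z * w) =
  complex.Re z * complex.Re w - complex.Im z * complex.Im w.
Proof. by case: z w => [? ?] []. Qed.
Lemma ImM z w : complex.Im (z * w) =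
  complex.Re z * complex.Im w + complex.Im z * complex.Re w.
Proof. by case: z w => [? ?] []. Qed.

Lemma complex_ext z w : complex.Re z = complex.Re w -> complex.Im z = complex.Im w -> z = w.
Proof. by case: z w => [? ?] [? ?] /= -> ->. Qed.

End modulus.

Section exponential.
Context {R : realType}.
Implicit Types (z w h : R[i]) (x y : R).

Lemma expCD z w : expC (z + w) = expC z * expC w.
Proof.
by apply: complex_ext; rewrite /expC ?ReM ?ImM /= ReD ImD expRD ?cosD ?sinD; ring.
Qed.

Lemma expC0 : expC (0 : R[i]) = 1.
Proof. by rewrite /expC /= expR0 cos0 sin0 mul1r mulr0. Qed.

Lemma cn_expC z : cn (expC z) = expR (complex.Re z).
Proof.
apply/eqP; rewrite -(@eqrXn2 _ 2)//= ?cn_ge0 ?expR_ge0// cn_sqr/= !exprMn -mulrDr.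
by rewrite cos2Dsin2 mulr1.
Qed.

Lemma expC_neq0 z : expC z != 0.
Proof. by rewrite -cn_gt0 cn_expC expR_gt0. Qed.

(** [1 + x <= e^x] gives the lower bound, and the same at [- x], that is [(1 - x) e^x <= 1], the
    upper one. *)
Lemma expR_taylor x : `|x| <= 2^-1 -> `|expR x - 1 - x| <= 2 * x ^+ 2.
Proof.
move=> x2; have /andP[x2l x2r] : - 2^-1 <= x <= 2^-1 by rewrite -ler_norml.
rewrite ger0_norm; last by have := expR_ge1Dx x; lra.
have := expR_ge1Dx (- x); rewrite expRN => h.
have e0 := expR_gt0 x.
have : (1 - x) * expR x <= 1 by rewrite -[X in _ <= X](@mulVf _ (expR x)) ?gt_eqF// ler_pM2r.
nra.
Qed.

(** The mean value theorem bounds the sine, [cos u - 1 = - 2 sin(u/2)^2] the cosine; the cubic bound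
    is the mean value theorem for [sin x - x], whose derivative is [cos x - 1]. *)
Lemma cos_taylor y : `|cos y - 1| <= 2 * y ^+ 2 /\ `|sin y - y| <= 2 * `|y| ^+ 3.
Proof.
have sinle (u : R) : `|sin u| <= `|u|.
  wlog u0 : u / 0 <= u => [hw|].
    have [|/ltW u0] := leP 0 u; first exact: hw.
    by rewrite -normrN -sinN -(normrN u) hw// oppr_ge0.
  have [c _] := @MVT_segment R sin cos 0 u u0 (fun x _ => is_derive_sin x)
    (continuous_subspaceT (@continuous_sin R)).
  rewrite sin0 !subr0 => ->; rewrite normrM -[X in _ <= X]mul1r ler_wpM2r//.
  by rewrite ler_norml cos_geN1 cos_le1.
have cosle (u : R) : `|cos u - 1| <= 2 * u ^+ 2.
  have -> : cos u - 1 = - (2 * sin (u / 2) ^+ 2).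
    rewrite [in LHS](_ : u = u / 2 + u / 2); last by field.
    by rewrite cosD -!expr2; have := cos2Dsin2 (u / 2); lra.
  rewrite normrN normrM ger0_norm// ler_pM2l// normrX.
  have h := sinle (u / 2).
  rewrite -[X in _ <= X]real_normK ?num_real// ler_pXn2r ?nnegrE//.
  by rewrite (le_trans h)// normrM ler_piMr// ger0_norm ?invr_ge0// invf_le1// ler1n.
split=> //.
wlog u0 : y / 0 <= y => [hw|].
  have [|/ltW u0] := leP 0 y; first exact: hw.
  by rewrite -normrN opprD opprK -sinN -(normrN y) -[y in _ + y]opprK hw// oppr_ge0.
have Hd (x : R) : is_derive x 1 (fun x : R => sin x - x) (cos x - 1).
  exact: is_deriveB.
have Hc : {within `[0, y], continuous (fun x : R => sin x - x)}.
  apply: continuous_subspaceT => x; apply: cvgB; last exact: cvg_id.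
  exact: continuous_sin.
have [c] := @MVT_segment R (fun x => sin x - x) (fun x => cos x - 1) 0 y u0 (fun x _ => Hd x) Hc.
rewrite in_itv/= sin0 !subr0 => /andP[c0 cy] ->.
rewrite normrM exprSr mulrA ler_wpM2r// (le_trans (cosle c))// ler_pM2l//.
by rewrite ler_pXn2r ?nnegrE// (ger0_norm u0).
Qed.

(** Real and imaginary parts are each at most [5 (cn h)^2]; the constant 16 is a convenient
    overestimate. *)
Lemma expC_taylor h : cn h <= 2^-1 -> cn (expC h - 1 - h) <= 16 * cn h ^+ 2.
Proof.
move=> hs; rewrite (le_trans (cn_ReIm _))// !(ReD, ImD, ReN, ImN)/= oppr0 addr0.
have := cn_Re h; have := cn_Im h.
move: (complex.Re h) (complex.Im h) (cn h) hs => x y c hs yc xc.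
have [h1 h2] := cos_taylor y.
have h3 := expR_taylor (le_trans xc hs).
have x2 : x ^+ 2 <= c ^+ 2.
  by rewrite -[x ^+ 2]real_normK ?num_real// ler_pXn2r ?nnegrE//; apply: le_trans xc.
have y2 : y ^+ 2 <= c ^+ 2.
  by rewrite -[y ^+ 2]real_normK ?num_real// ler_pXn2r ?nnegrE//; apply: le_trans xc.
have c0 : 0 <= c by apply: le_trans xc.
have xx : x ^+ 2 = `|x| ^+ 2 by rewrite real_normK ?num_real.
have yy : y ^+ 2 = `|y| ^+ 2 by rewrite real_normK ?num_real.
have hRe : `|expR x * cos y - 1 - x| <= 5 * c ^+ 2.
  rewrite (_ : _ - _ - _ = (expR x - 1 - x) * cos y + (1 + x) * (cos y - 1)); last by ring.
  rewrite (le_trans (ler_normD _ _))// !normrM.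
  have e1 : `|expR x - 1 - x| * `|cos y| <= 2 * c ^+ 2.
    rewrite -[X in _ <= X]mulr1 ler_pM ?cos_max//.
    by rewrite (le_trans h3)// ler_pM2l.
  have e2 : `|1 + x| * `|cos y - 1| <= (3 / 2) * (2 * c ^+ 2).
    rewrite ler_pM//; last by rewrite (le_trans h1)// ler_pM2l.
    by rewrite (le_trans (ler_normD _ _))// normr1; lra.
  lra.
have hIm : `|expR x * sin y - y| <= 5 * c ^+ 2.
  rewrite (_ : _ - _ = (expR x - 1) * sin y + (sin y - y)); last by ring.
  rewrite (le_trans (ler_normD _ _))// !normrM.
  have e1 : `|expR x - 1| <= 2 * `|x|.
    rewrite (_ : _ - _ = (expR x - 1 - x) + x); last by ring.
    rewrite (le_trans (ler_normD _ _))//.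
    move: h3 (normr_ge0 x) xx; set A := `|_ - x|; set X := `|x| in xc *; nra.
  have ys : `|y| ^+ 3 <= 2^-1 * c ^+ 2.
    rewrite exprS ler_pM ?exprn_ge0//; first exact: le_trans hs.
    by rewrite -yy.
  have e2 : `|sin y| <= 3 / 2 * `|y|.
    rewrite (_ : sin y = (sin y - y) + y); last by ring.
    rewrite (le_trans (ler_normD _ _))//.
    move: h2; rewrite exprS => h2; move: yy h2 yc (normr_ge0 y).
    set A := `|_ - y|; set Y := `|y|; nra.
  have e3 : `|expR x - 1| * `|sin y| <= (2 * c) * (3 / 2 * c).
    by apply: ler_pM => //; [rewrite (le_trans e1)// ler_pM2l|rewrite (le_trans e2)// ler_pM2l].
  have c2 : c ^+ 2 = c * c by rewrite expr2.
  move: h2 e3 ys c2 (sqr_ge0 c); set A := `|_ - y|; set Y := _ * `|sin y|; set c3 := c ^+ 2; lra.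
move: hRe hIm; rewrite -/(expR x * cos y) ; set c3 := c ^+ 2.
have : 0 <= c3 by rewrite /c3 sqr_ge0.
set A := `|_|; set B := `|_|; lra.
Qed.

End exponential.

(** * Complex differentiability with explicit error bounds *)

Section complex_derivative.
Context {R : realType}.
Implicit Types (z w h l k : R[i]) (F G : R[i] -> R[i]) (x y d e : R).

Definition cdiff F z l := forall e, 0 < e -> exists2 d, 0 < d &
  forall h, cn h < d -> cn (F (z + h) - F z - l * h) <= e * cn h.

(** A positive element of [R[i]] is real; the complex epsilons of the topology of [R[i]] are thus
    traded for real ones. *)
Lemma pos_complex (e : R[i]) : 0 < e -> e = (cn e)%:C /\ 0 < cn e.
Proof.
move=> e0; have E : e = (cn e)%:C by rewrite -cnE ger0_norm// ltW.
by split=> //; rewrite -ltcR -E.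
Qed.

(** The scalars of [R[i]^o] are complex, so the increments [h *: 1] run through all complex [h], and
    derivability along 1 is complex differentiability. *)
Lemma cdiffP F z : derivable (F : R[i]^o -> R[i]^o) z 1 <-> exists l, cdiff F z l.
Proof.
split.
  move=> /cvg_ex[l /= H]; exists l => e e0.
  have ec : 0 < e%:C by rewrite ltcR.
  move/cvgrPdist_le : H => /(_ _ ec)/nbhs_ballP[d /= dp hd].
  have [dE d0] := pos_complex dp; rewrite dE in hd.
  exists (cn d) => // h hd'.
  have [->|h0] := eqVneq h 0.
    by rewrite addr0 subrr mulr0 subrr cn0 mulr0.
  have := hd h; rewrite /ball/= sub0r normrN cnE ltcR => /(_ hd' h0).
  rewrite /GRing.scale/= mulr1 cnE lecR => H.
  have -> : F (z + h) - F z - l * h = - ((l - h^-1 * (F (h + z) - F z)) * h).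
    by rewrite (addrC h z); field.
  by rewrite cnN cnM ler_wpM2r ?cn_ge0.
move=> [l H]; apply/cvg_ex; exists l; apply/cvgrPdist_le => e ep; have [eE e0] := pos_complex ep; rewrite eE.
have [d d0 hd] := H _ e0.
apply/nbhs_ballP; exists d%:C; first by rewrite /= ltcR.
move=> h; rewrite /ball/= sub0r normrN cnE ltcR => hd' h0.
rewrite /GRing.scale/= mulr1 cnE lecR -(@ler_pM2r _ (cn h)) ?cn_gt0//.
rewrite -cnM -cnN (_ : - _ = F (z + h) - F z - l * h) ?hd//.
by rewrite (addrC h z); field.
Qed.

Lemma cdiff_eq F G z l d : 0 < d -> (forall h, cn h < d -> F (z + h) = G (z + h)) ->
  cdiff F z l -> cdiff G z l.
Proof.
move=> d0 FG H e /H[d1 d10 hd]; exists (Num.min d d1); first by rewrite lt_min d0.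
move=> h; rewrite lt_min => /andP[h1 h2].
by rewrite -FG// -[G z](_ : F z = G z) ?hd//; have := FG 0; rewrite !addr0 cn0 => ->.
Qed.

Lemma cdiff_cst k z : cdiff (fun=> k) z 0.
Proof. by move=> e e0; exists 1 => // h _; rewrite subrr mul0r subrr cn0 mulr_ge0 ?cn_ge0// ltW. Qed.

Lemma cdiff_id z : cdiff id z 1.
Proof.
by move=> e e0; exists 1 => // h _; rewrite mul1r (addrC z) addrK subrr cn0 mulr_ge0 ?cn_ge0// ltW.
Qed.

Lemma cdiffD F G z l k : cdiff F z l -> cdiff G z k -> cdiff (fun w => F w + G w) z (l + k).
Proof.
move=> hF hG e e0; have e20 : 0 < e / 2 by rewrite divr_gt0.
have [d1 d10 h1] := hF _ e20; have [d2 d20 h2] := hG _ e20.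
exists (Num.min d1 d2); first by rewrite lt_min d10.
move=> h; rewrite lt_min => /andP[xy1 xy2].
rewrite (_ : _ - _ = (F (z + h) - F z - l * h) + (G (z + h) - G z - k * h)); last by ring.
rewrite (le_trans (cnD _ _))// (_ : e * cn h = e / 2 * cn h + e / 2 * cn h); last by field.
by rewrite lerD ?h1 ?h2.
Qed.

Lemma cdiff_lip F z l : cdiff F z l -> exists M d, [/\ 0 < M, 0 < d &
  forall h, cn h < d -> cn (F (z + h) - F z) <= M * cn h].
Proof.
move=> /(_ 1 ltr01)[d d0 hd]; exists (1 + cn l), d; split=> //.
  by rewrite ltr_wpDr// cn_ge0.
move=> h /hd H; rewrite mulrDl -cnM.
rewrite (_ : F (z + h) - F z = (F (z + h) - F z - l * h) + l * h); last by ring.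
by rewrite (le_trans (cnD _ _))// lerD.
Qed.

Lemma cdiffM F G z l k : cdiff F z l -> cdiff G z k ->
  cdiff (fun w => F w * G w) z (l * G z + F z * k).
Proof.
move=> hF hG e e0.
have [M [d3 [M0 d30 h3]]] := cdiff_lip hF.
have [N [d4 [N0 d40 h4]]] := cdiff_lip hG.
have pos (A : R) : 0 <= A -> 0 < A + 1 by move=> ?; rewrite ltr_wpDl.
have eA (A : R) : 0 <= A -> 0 < e / 3 / (A + 1) by move=> /pos ?; rewrite !divr_gt0.
have [d1 d10 h1] := hF _ (eA _ (cn_ge0 (G z))).
have [d2 d20 h2] := hG _ (eA _ (cn_ge0 (F z))).
exists (Num.min (Num.min d1 d2) (Num.min (Num.min d3 d4) (e / 3 / (M * N)))).
  by rewrite !lt_min d10 d20 d30 d40 !divr_gt0// mulr_gt0.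
move=> h; rewrite !lt_min => /andP[/andP[hd1 hd2] /andP[/andP[hd3 hd4] hd5]].
rewrite (_ : _ - _ = (F (z + h) - F z - l * h) * G z + F z * (G (z + h) - G z - k * h) +
  (F (z + h) - F z) * (G (z + h) - G z)); last by ring.
have red (A : R) : 0 <= A -> e / 3 / (A + 1) * A <= e / 3.
  move=> A0; rewrite -mulrA ger_pMr ?divr_gt0// mulrC ler_pdivrMr ?mul1r ?lerDl//.
  exact: pos.
have hh := cn_ge0 h.
have b1 : cn (F (z + h) - F z - l * h) * cn (G z) <= e / 3 * cn h.
  apply: (@le_trans _ _ (e / 3 / (cn (G z) + 1) * cn h * cn (G z))).
    by rewrite ler_wpM2r ?cn_ge0// h1.
  by rewrite mulrAC ler_wpM2r ?red ?cn_ge0.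
have b2 : cn (F z) * cn (G (z + h) - G z - k * h) <= e / 3 * cn h.
  apply: (@le_trans _ _ (cn (F z) * (e / 3 / (cn (F z) + 1) * cn h))).
    by rewrite ler_wpM2l ?cn_ge0// h2.
  by rewrite mulrA (mulrC (cn (F z))) ler_wpM2r ?red ?cn_ge0.
have b3 : cn (F (z + h) - F z) * cn (G (z + h) - G z) <= e / 3 * cn h.
  apply: (@le_trans _ _ (M * cn h * (N * cn h))).
    by rewrite ler_pM ?cn_ge0 ?h3 ?h4.
  rewrite mulrA ler_wpM2r// mulrAC mulrC -ler_pdivlMr ?mulr_gt0//.
  exact: ltW.
rewrite (le_trans (cnD _ _))// (le_trans (lerD (cnD _ _) (lexx _)))// !cnM.
lra.
Qed.

Lemma cdiff_comp F G z l k : cdiff F z l -> cdiff G (F z) k ->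
  cdiff (fun w => G (F w)) z (k * l).
Proof.
move=> hF hG e e0.
have [M [d3 [M0 d30 h3]]] := cdiff_lip hF.
have e1 : 0 < e / 2 / (cn k + 1) by rewrite !divr_gt0// ltr_wpDl// cn_ge0.
have e2 : 0 < e / 2 / M by rewrite !divr_gt0.
have [d1 d10 h1] := hF _ e1.
have [d2 d20 h2] := hG _ e2.
exists (Num.min d1 (Num.min d3 (d2 / M))); first by rewrite !lt_min d10 d30 divr_gt0.
move=> h; rewrite !lt_min => /andP[hd1 /andP[hd3 hd2]].
set u := F (z + h) - F z.
have -> : G (F (z + h)) = G (F z + u) by rewrite /u subrKC.
rewrite (_ : _ - _ = (G (F z + u) - G (F z) - k * u) + k * (u - l * h)); last by rewrite /u; ring.
have hu : cn u <= M * cn h by exact: h3.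
have hh := cn_ge0 h.
rewrite (le_trans (cnD _ _))// (_ : e * cn h = e / 2 * cn h + e / 2 * cn h); last by field.
apply: lerD.
  have -> : e / 2 * cn h = e / 2 / M * (M * cn h) by field; rewrite gt_eqF.
  rewrite (le_trans (h2 _ _))//; last by rewrite ler_pM2l.
  by rewrite (le_lt_trans hu)// mulrC -ltr_pdivlMr.
rewrite cnM (@le_trans _ _ (cn k * (e / 2 / (cn k + 1) * cn h)))//.
  by rewrite ler_wpM2l ?cn_ge0// h1.
rewrite mulrA ler_wpM2r// mulrCA ger_pMr ?divr_gt0// ler_pdivrMr ?mul1r ?lerDl//.
by rewrite ltr_wpDl// cn_ge0.
Qed.

Lemma cdiffN F z l : cdiff F z l -> cdiff (fun w => - F w) z (- l).
Proof.
move=> H e /H[d d0 hd]; exists d => // h /hd.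
by rewrite -cnN (_ : - _ = - F (z + h) - - F z - - l * h)//; ring.
Qed.

Lemma cdiff_expC z : cdiff expC z (expC z).
Proof.
move=> e e0; pose N := cn (expC z); have N0 : 0 < N by rewrite cn_gt0 expC_neq0.
exists (Num.min 2^-1 (e / (16 * N))); first by rewrite lt_min invr_gt0 ltr0n divr_gt0// mulr_gt0.
move=> h; rewrite lt_min => /andP[/ltW h2 he].
rewrite expCD (_ : _ - _ = expC z * (expC h - 1 - h)); last by ring.
rewrite cnM -/N (@le_trans _ _ (N * (16 * cn h ^+ 2)))//.
  by rewrite ler_pM2l// expC_taylor.
rewrite expr2 !mulrA ler_wpM2r ?cn_ge0//.
by move: he; rewrite ltr_pdivlMr ?mulr_gt0//; lra.
Qed.

Lemma cdiff_inv z : z != 0 -> exists l, cdiff (fun w => w^-1) z l.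
Proof.
move=> z0; exists (- z^-1 ^+ 2) => e e0.
have n0 : 0 < cn z by rewrite cn_gt0.
pose N := cn z; rewrite -/N in n0.
exists (Num.min (N / 2) (e * N ^+ 3 / 2)).
  by rewrite lt_min !divr_gt0// mulr_gt0// exprn_gt0.
move=> h; rewrite lt_min => /andP[h1 h2].
have hz : N / 2 <= cn (z + h).
  have := cnB (z + h) h; rewrite addrK -/N; lra.
have zh : z + h != 0 by rewrite -cn_gt0 (lt_le_trans _ hz)// divr_gt0.
rewrite (_ : _ - _ = h * h * (z^-1 ^+ 2 * (z + h)^-1)); last by field; rewrite zh z0.
rewrite (cnM (h * h)) (cnM h) (cnM (_ ^+ 2)) cnX !cnV -/N -mulrA mulrC ler_wpM2r ?cn_ge0//.
rewrite exprVn -invfM ler_pdivrMr ?mulr_gt0 ?exprn_gt0 ?cn_gt0//.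
apply: (@le_trans _ _ (e * (N ^+ 2 * (N / 2)))).
  by rewrite (le_trans (ltW h2))// exprS; lra.
by rewrite ler_pM2l// ler_pM2l// exprn_gt0.
Qed.

Lemma entireP F : entire F <-> forall z, exists l, cdiff F z l.
Proof. by split=> H z; have /cdiffP := H z. Qed.

End complex_derivative.

(** * The identity theorem for entire functions *)

Section identity_theorem.
Context {R : realType}.
Implicit Types (a z w h l k : R[i]) (F D : R[i] -> R[i]) (x y s d e r M : R).

(** The pair consists of the coefficients of [Im (F dz) = Im F dx + Re F dy], and the Cauchy-Riemann
    equations make both mixed partials equal to [Re l]. *)
Lemma entire_curl_free F x y : entire F ->
  curl_free_at (fun x y => complex.Im (F (x +i* y))) (fun x y => complex.Re (F (x +i* y))) x y.
Proof.
move=> /entireP/(_ (x +i* y))[l H].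
exists (complex.Im l), (complex.Re l), (- complex.Im l) => e e0.
have [d d0 hd] := H _ e0; exists (d / 2); first by rewrite divr_gt0.
move=> x' y' xd yd; pose h := (x' - x) +i* (y' - y).
have hle : cn h <= `|x' - x| + `|y' - y| := cn_ReIm h.
have := hd h; have -> : (x +i* y) + h = x' +i* y'.
  by apply: complex_ext; rewrite ?ReD ?ImD /= subrKC.
have hlt : cn h < d by rewrite (le_lt_trans hle)// (splitr d) ltrD.
move=> /(_ hlt) hc.
have le2 : e * cn h <= e * (`|x' - x| + `|y' - y|) by rewrite ler_pM2l.
split; apply: le_trans le2; apply: le_trans hc.
- by apply: le_trans (cn_Im _); rewrite !(ImD, ImN, ImM)/= le_eqVlt (addrC (_ * (x' - x))) eqxx.
- by apply: le_trans (cn_Re _); rewrite !(ReD, ReN, ReM)/= mulNr le_eqVlt eqxx.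
Qed.

(* In logarithmic polar coordinates at a, the integral of Re F over a circle is
   an integral over a side of a rectangle whose horizontal sides cancel by
   2 pi i-periodicity; hence it does not depend on the radius e^s. *)
Lemma entire_Re_mean F a s M : entire F ->
  (forall y, 0 <= y <= pi *+ 2 -> cn (F (a + expC (s +i* y))) <= M) -> `|complex.Re (F a)| <= M.
Proof.
move=> eF FM; pose G z := F (a + expC z).
have eG : entire G.
  apply/entireP => z; move/entireP : eF => /(_ (a + expC z))[l Hl].
  have [k Hk] : exists k, cdiff (fun z => a + expC z) z k.
    by eexists; apply: cdiffD; [exact: cdiff_cst|exact: cdiff_expC].
  by eexists; apply: cdiff_comp Hk Hl.
pose q x y := complex.Re (G (x +i* y)).
have pq x y : curl_free_at (fun x y => complex.Im (G (x +i* y))) q x y by exact: entire_curl_free.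
pose P : R := pi *+ 2; have P0 : 0 < P by rewrite /P mulrn_wgt0 ?pi_gt0//.
have P0' := ltW P0.
have ucq x : uc 0 P (q x) by exact: (curl_free_ucq pq).
have rot s0 : s0 <= s -> itg 0 P (q s) = itg 0 P (q s0).
  move=> s0s; have := circulation_eq0 pq s0s (ltW P0); rewrite /circulation.
  rewrite (_ : itg s0 s ((fun x y => complex.Im (G (x +i* y)))^~ P) =
               itg s0 s ((fun x y => complex.Im (G (x +i* y)))^~ 0)).
    by rewrite subrr add0r => /eqP; rewrite subr_eq0 => /eqP.
  apply: itg_eq => x _; congr (complex.Im (F (a + _))).
  by rewrite /expC /= /P cos2pi sin2pi cos0 sin0.
have E : P * complex.Re (F a) = itg 0 P (q s).
  apply/eqP; rewrite -subr_eq0 -normr_le0; apply/ler_addgt0Pl => e e0; rewrite addr0.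
  move/entireP : eF => /(_ a)[l /cdiff_lip[N [d [N0 d0 hd]]]].
  (* On a circle of radius at most [r] the function differs from [F a] by at most [N * r <= e / P],
     so its integral over [[0, P]] is within [e] of the target. *)
  pose r := Num.min (d / 2) (e / (N * P)).
  have r0 : 0 < r by rewrite lt_min !divr_gt0// mulr_gt0.
  (* The radius [e^s0] is at most [r], and [s0 <= s] makes [rot] applicable. *)
  pose s0 := Num.min s (ln r).
  have s0r : expR s0 <= r.
    by rewrite -[X in _ <= X](lnK r0) ler_expR ge_min lexx orbT.
  rewrite (rot s0) ?ge_min ?lexx// -[P in P * _](subr0 P) -itg_cst// -itgB//; last exact: uc_cst.
  apply: (@le_trans _ _ ((P - 0) * (e / P))); last by rewrite subr0 mulrC divfK ?gt_eqF.
  apply: itg_bound; first exact: ltW.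
    by apply: ucB => //; exact: uc_cst.
  move=> y _; rewrite -normrN opprB.
  have := cn_Re (F (a + expC (s0 +i* y)) - F a); rewrite ReD ReN => /le_trans; apply.
  apply: (le_trans (hd _ _)); rewrite cn_expC/=.
    by rewrite (le_lt_trans s0r)// gt_min ltr_pdivrMr// ltr_pMr// ltr1n.
  rewrite -ler_pdivlMl// (le_trans s0r)// ge_min orbC.
  by rewrite invfM mulrCA lexx.
have : P * `|complex.Re (F a)| <= P * M.
  rewrite -[P in P * `|_|](gtr0_norm P0) -normrM E -[P in P * _](subr0 P).
  apply: itg_bound => //.
  by move=> y yP; apply: le_trans (cn_Re _) (FM _ yP).
by rewrite ler_pM2l.
Qed.

(** The previous bound is applied to [F] and to [- i F], whose real part is [Im F]; adding the two
    gives the factor 2. *)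
Lemma entire_circle_bound F a s M : entire F ->
  (forall y, 0 <= y <= pi *+ 2 -> cn (F (a + expC (s +i* y))) <= M) -> cn (F a) <= 2 * M.
Proof.
move=> eF FM; rewrite (le_trans (cn_ReIm _))// mulr2n mulrDl !mul1r lerD//.
  exact: entire_Re_mean FM.
have -> : complex.Im (F a) = complex.Re (- 'i%C * F a).
  by rewrite ReM /=; ring.
apply: (@entire_Re_mean (fun z => - 'i%C * F z) a s).
  apply/entireP => z; move/entireP : eF => /(_ z)[l Hl].
  by eexists; apply: cdiffM Hl; exact: cdiff_cst.
by move=> y yP; rewrite cnM cnN cni mul1r FM.
Qed.

Lemma entireM F D : entire F -> entire D -> entire (fun z => F z * D z).
Proof.
move=> /entireP eF /entireP eD; apply/entireP => z.
have [[l Fl] [k Dk]] := (eF z, eD z).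
by eexists; apply: cdiffM Fl Dk.
Qed.

Lemma entireD F D : entire F -> entire D -> entire (fun z => F z + D z).
Proof.
move=> /entireP eF /entireP eD; apply/entireP => z.
have [[l Fl] [k Dk]] := (eF z, eD z).
by eexists; apply: cdiffD Fl Dk.
Qed.

Lemma entire_comp F D : entire F -> entire D -> entire (fun z => D (F z)).
Proof.
move=> /entireP eF /entireP eD; apply/entireP => z.
have [l Fl] := eF z; have [k Dk] := eD (F z).
by eexists; apply: cdiff_comp Fl Dk.
Qed.

Lemma entire_cst k : entire (fun=> k).
Proof. by apply/entireP => z; exists 0; exact: cdiff_cst. Qed.

Lemma entire_id : entire (@id R[i]).
Proof. by apply/entireP => z; exists 1; exact: cdiff_id. Qed.

Lemma entire_expC : entire (@expC R).
Proof. by apply/entireP => z; exists (expC z); exact: cdiff_expC. Qed.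

Lemma entireB F D : entire F -> entire D -> entire (fun z => F z - D z).
Proof.
move=> eF /entireP eD; have eN : entire (fun z => - D z).
  by apply/entireP => z; have [k Dk] := eD z; exists (- k); apply: cdiffN.
exact: (entireD eF eN).
Qed.

(** The circle is the image of a vertical segment under [a + e^z]; real and imaginary parts of the
    composite are continuous on that segment. *)
Lemma entire_bounded_circle F a s : entire F -> exists M, forall y,
  0 <= y <= pi *+ 2 -> cn (F (a + expC (s +i* y))) <= M.
Proof.
move=> eF; pose G z := F (a + expC z).
have eG : entire G.
  have e1 : entire (fun z : R[i] => a + expC z) := entireD (entire_cst (k := a)) entire_expC.
  exact: (entire_comp e1 eF).
have ucRe H : entire H -> uc 0 (pi *+ 2) (fun y => complex.Re (H (s +i* y))).
  move=> eH; have pq x y := @entire_curl_free H x y eH.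
  exact: (@curl_free_ucq _ _ _ pq 0 (pi *+ 2) s).
have [M1 _ h1] := uc_bounded (ucRe _ eG).
have [M2 _ h2] := uc_bounded (ucRe _ (entireM (entire_cst (k := - 'i%C)) eG)).
exists (M1 + M2) => y yP; rewrite (le_trans (cn_ReIm _))// lerD ?h1//.
by apply: le_trans (h2 y yP); rewrite ReM /= oppr0 mul0r sub0r mulN1r opprK.
Qed.

(** Near [w] the quotient vanishes together with [D], and elsewhere the denominator is nonzero. *)
Lemma entire_div_pow D w d n : entire D -> 0 < d -> (forall z, cn (z - w) < d -> D z = 0) ->
  entire (fun z => D z / (z - w) ^+ n).
Proof.
move=> eD d0 D0; apply/entireP => z.
have [->|zw] := eqVneq z w.
  exists 0; apply: (@cdiff_eq _ (fun=> 0) _ _ _ d d0); last exact: cdiff_cst.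
  by move=> h hd; rewrite D0 ?mul0r// addrC addKr.
have [k Hk] : exists k, cdiff (fun z => (z - w) ^+ n) z k.
  elim: n => [|n [k IH]].
    exists 0; apply: (@cdiff_eq _ (fun=> 1) _ _ _ 1 ltr01); last exact: cdiff_cst.
    by move=> h _; rewrite expr0.
  have [k' Hk'] : exists k, cdiff (fun z => z - w) z k.
    by eexists; apply: cdiffD; [exact: cdiff_id|exact: cdiff_cst].
  exists (k' * (z - w) ^+ n + (z - w) * k).
  apply: (@cdiff_eq _ (fun z => (z - w) * (z - w) ^+ n) _ _ _ 1 ltr01).
    by move=> h _; rewrite exprS.
  exact: cdiffM.
have zn : (z - w) ^+ n != 0 by rewrite expf_neq0// subr_eq0.
have [k' Hk'] := cdiff_inv zn.
move/entireP : eD => /(_ z)[l Hl].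
by eexists; apply: (cdiffM Hl); apply: cdiff_comp Hk Hk'.
Qed.

(* D / (z - w)^N is entire for every N; on the circle of radius 3 |a - w| about
   a one has |z - w| >= 2 |a - w|, so |D a| <= 2 M / 2^N. *)
Lemma identity_theorem D w d : entire D -> 0 < d -> (forall z, cn (z - w) < d -> D z = 0) ->
  forall a, D a = 0.
Proof.
move=> eD d0 D0 a.
have [->|aw] := eqVneq a w; first by rewrite D0// subrr cn0.
pose r := cn (a - w); have r0 : 0 < r by rewrite cn_gt0 subr_eq0.
pose s := ln (3 * r); have sE : expR s = 3 * r by rewrite lnK// posrE mulr_gt0.
have [M HM] := entire_bounded_circle a s eD.
have M0 : 0 <= M.
  by apply: le_trans (cn_ge0 _) (HM 0 _); rewrite lexx mulrn_wge0// pi_ge0.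
have H n : cn (D a) <= 2 * M * 2^-1 ^+ n.
  have eDn := entire_div_pow (n := n) eD d0 D0.
  have /(entire_circle_bound eDn) : forall y, 0 <= y <= pi *+ 2 ->
      cn (D (a + expC (s +i* y)) / (a + expC (s +i* y) - w) ^+ n) <= M / (2 * r) ^+ n.
    move=> y yP; rewrite cnM cnV cnX ler_pM ?cn_ge0 ?invr_ge0 ?exprn_ge0 ?cn_ge0 ?HM//.
    have h2 : 2 * r <= cn (a + expC (s +i* y) - w).
      have := cnB (a + expC (s +i* y) - w) (a - w).
      rewrite (_ : _ - _ - (a - w) = expC (s +i* y)); last by ring.
      by rewrite cn_expC/= sE -/r; lra.
    have r20 : 0 < 2 * r by rewrite mulr_gt0.
    rewrite lef_pV2 ?posrE ?exprn_gt0//; last exact: lt_le_trans h2.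
    by rewrite lerXn2r ?nnegrE// ltW// (lt_le_trans _ h2).
  rewrite cnM cnV cnX -/r ler_pdivrMr ?exprn_gt0// => /le_trans; apply.
  rewrite le_eqVlt; apply/orP; left; apply/eqP; rewrite exprMn exprVn; field.
  by rewrite !expf_neq0// gt_eqF.
apply/eqP; rewrite -cn_eq0 eq_le cn_ge0 andbT; apply/ler_addgt0Pl => e e0; rewrite addr0.
have /cvgrPdist_lt/(_ _ e0)[N _ /(_ N (leqnn _))] :
    (fun n => 2 * M * 2^-1 ^+ n) @ \oo --> (2 * M * 0 : R).
  apply: cvgMr; apply: cvg_expr.
  by rewrite ger0_norm ?invr_ge0// invf_lt1// ltr1n.
rewrite /= mulr0 sub0r normrN => /ltW/(le_trans (ler_norm _)); exact: le_trans (H N).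
Qed.

(** The unit disc about [i (c + 1)] lies in the half-plane [Im z > c], so the difference vanishes on
    it. *)
Lemma entire_extension_unique c F G : entire F -> entire G ->
  (forall z, c < complex.Im z -> F z = G z) -> forall z, F z = G z.
Proof.
move=> eF eG FG z; apply/eqP; rewrite -subr_eq0; apply/eqP.
apply: (@identity_theorem (fun z => F z - G z) (0 +i* (c + 1)) 1); [exact: entireB|by []|].
move=> u; move/(le_lt_trans (cn_Im _)); rewrite ImD ImN/= ltr_norml => /andP[hu _].
by rewrite FG ?subrr//; lra.
Qed.

End identity_theorem.

(** * Hadamard's inequality and iterated integrals *)

Section hadamard.
Context {R : realFieldType}.

Definition psd n (G : 'M[R]_n) := G^T = G /\ forall v : 'rV[R]_n, 0 <= (v *m G *m v^T) 0 0.

Lemma psd_diag n (G : 'M[R]_n) i : psd G -> 0 <= G i i.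
Proof.
move=> [_ /(_ (delta_mx 0 i))].
by rewrite -rowE trmx_delta -colE !mxE.
Qed.

(** The quadratic form as a polynomial in [c]; [psd_det] exploits its nonnegativity for well-chosen
    [c]. *)
Lemma psd_block n (g : R) (u : 'rV[R]_n) (S : 'M[R]_n) c (w : 'rV[R]_n) :
  (row_mx c%:M w *m block_mx g%:M u u^T S *m (row_mx c%:M w)^T) 0 0 =
  c ^+ 2 * g + 2 * c * (u *m w^T) 0 0 + (w *m S *m w^T) 0 0.
Proof.
have E : w *m u^T = u *m w^T.
  by apply: trmx_inj; rewrite trmx_mul !trmxK; rewrite (mx11_scalar (u *m w^T)) tr_scalar_mx.
rewrite mul_row_block tr_row_mx mul_row_col tr_scalar_mx -scalar_mxM E mulmxDl.
rewrite -scalar_mxM mul_mx_scalar mulmxDl mul_scalar_mx -scalemxAl.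
set X := u *m w^T; set Y := w *m S *m w^T.
by rewrite !mxE eqxx mulr1n; ring.
Qed.

Lemma det_schur n (g : R) (u : 'rV[R]_n) (S : 'M[R]_n) : g != 0 ->
  \det (block_mx g%:M u u^T S) = g * \det (S - g^-1 *: (u^T *m u)).
Proof.
move=> g0.
have -> : block_mx g%:M u u^T S =
  block_mx 1%:M 0 (g^-1 *: u^T) 1%:M *m block_mx g%:M u 0 (S - g^-1 *: (u^T *m u)).
  rewrite mulmx_block !mul1mx !mul0mx !addr0 mul_mx_scalar scalerA mulfV// scale1r.
  by rewrite -scalemxAl addrC subrK.
by rewrite det_mulmx det_lblock det_ublock !det1 !mul1r det_scalar1.
Qed.

(** Induction by the Schur complement: [det G] is [g] times the determinant of the complement, which
    is again positive semidefinite and has no larger diagonal than [S]. *)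
Lemma psd_det n (G : 'M[R]_n) : psd G -> 0 <= \det G <= \prod_i G i i.
Proof.
elim: n G => [|n IH]; first by move=> G _; rewrite det_mx00 big_ord0 lexx ler01.
rewrite -[n.+1]/(1 + n)%N => G psdG; rewrite (@big_ord_recl _ _ _ n).
have [sG pG] := psdG.
pose g : R := G 0 0; pose u : 'rV[R]_n := ursubmx G; pose S : 'M[R]_n := drsubmx G.
have g0 : 0 <= g by exact: psd_diag.
have GE : G = block_mx g%:M u u^T S.
  have -> : u^T = dlsubmx G by rewrite /u trmx_ursub sG.
  have -> : g%:M = ulsubmx G.
    by rewrite [RHS]mx11_scalar !mxE; congr (_%:M); congr (G _ _); exact: val_inj.
  by rewrite submxK.
have Sii i : S i i = G (lift 0 i) (lift 0 i).
  by rewrite !mxE; congr (G _ _); apply: val_inj.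
under eq_bigr do rewrite -Sii.
have sS : S^T = S by rewrite trmx_drsub sG.
have pS c (w : 'rV[R]_n) : 0 <= c ^+ 2 * g + 2 * c * (u *m w^T) 0 0 + (w *m S *m w^T) 0 0.
  by rewrite -psd_block -GE pG.
have psdS : psd S.
  by split=> // w; have := pS 0 w; rewrite expr0n mulr0 !mul0r !add0r.
have -> : \det G = \det (block_mx g%:M u u^T S) by rewrite -GE.
rewrite -/g.
(* A vanishing diagonal entry forces its row [u] to vanish: otherwise the form at [w = u] would be
   affine and nonconstant in [c]. *)
have [gz|gnz] := eqVneq g 0.
  have u0 : u = 0.
    have H : (u *m u^T) 0 0 = 0.
      apply/eqP.
      have uu0 : 0 <= (u *m u^T) 0 0.
        by rewrite mxE sumr_ge0// => i _; rewrite [X in _ * X]mxE -expr2 sqr_ge0.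
      have us0 := psdS.2 u.
      have [//|nz] := eqVneq ((u *m u^T) 0 0) 0.
      pose a := (u *m u^T) 0 0; pose b := (u *m S *m u^T) 0 0.
      have a0 : 0 < a by rewrite lt_def nz.
      (* This [c] gives the form the value -1. *)
      have := pS (- (b + 1) / (2 * a)) u; rewrite gz mulr0 add0r -/a -/b.
      have -> : 2 * (- (b + 1) / (2 * a)) * a = - (b + 1) by field; rewrite gt_eqF.
      by rewrite opprD addrAC addNr add0r oppr_ge0 ler10.
    apply/rowP => j; rewrite [RHS]mxE; apply/eqP; rewrite -sqrf_eq0 -normr_le0 ger0_norm ?sqr_ge0//.
    rewrite -{}[X in _ <= X]H [X in _ <= X]mxE (bigD1 j)//= [X in _ <= _ * X + _]mxE -expr2 lerDl sumr_ge0// => i _.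
    by rewrite [X in _ * X]mxE -expr2 sqr_ge0.
  by rewrite u0 trmx0 det_ublock det_scalar1 gz !mul0r lexx.
have g1 : 0 < g by rewrite lt_def gnz.
rewrite det_schur// pmulr_rge0// ler_pM2l//.
set T := S - _.
have psdT : psd T.
  split.
    by rewrite /T linearB/= linearZ/= trmx_mul trmxK sS.
  move=> w; pose a := (u *m w^T) 0 0.
  (* This [c] minimises the form, and the minimum is the form of the Schur complement. *)
  have := pS (- a / g) w.
  suff -> : (w *m T *m w^T) 0 0 = (w *m S *m w^T) 0 0 - a ^+ 2 / g.
    rewrite -/a; set X := (w *m S *m w^T) 0 0.
    by rewrite (_ : _ + _ + X = X - a ^+ 2 / g)//; field.
  have E : (w *m u^T) 0 0 = a.
    by rewrite /a -[in LHS](trmxK w) -trmx_mul mxE.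
  rewrite /T mulmxBr mulmxBl -scalemxAr -scalemxAl mulmxA -(mulmxA (w *m u^T)).
  rewrite mxE [X in _ + X]mxE [X in - X]mxE [X in _ * X]mxE big_ord1 E -/a.
  by congr (_ + _); rewrite mulrC expr2.
have /andP[-> dT] := IH T psdT; rewrite (le_trans dT)//.
apply: ler_prod => i _; rewrite psd_diag//=.
have -> : T i i = S i i - g^-1 * u 0 i ^+ 2.
  rewrite /T [LHS]mxE; congr (_ + _); rewrite [LHS]mxE; congr (- _).
  by rewrite [LHS]mxE; congr (_ * _); rewrite [LHS]mxE big_ord1 [X in X * _]mxE expr2.
by rewrite lerBlDr lerDl mulr_ge0 ?invr_ge0// sqr_ge0.
Qed.

(** The Gram matrix of the rows is positive semidefinite, its determinant is [(det A)^2] and its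
    diagonal consists of the squared row norms. *)
Lemma hadamard n (A : 'M[R]_n) : (\det A) ^+ 2 <= \prod_i \sum_j A i j ^+ 2.
Proof.
have psdG : psd (A *m A^T).
  split; first by rewrite trmx_mul trmxK.
  move=> v; rewrite mulmxA -mulmxA -trmx_mul mxE sumr_ge0// => i _.
  by rewrite [X in _ * X]mxE -expr2 sqr_ge0.
have /andP[_] := psd_det psdG.
rewrite det_mulmx det_tr -expr2 => /le_trans; apply.
rewrite le_eqVlt; apply/orP; left; apply/eqP; apply: eq_bigr => i _.
by rewrite mxE; apply: eq_bigr => j _; rewrite mxE expr2.
Qed.

Lemma hadamard_bound n (A : 'M[R]_n) M : (forall i j, `|A i j| <= M) ->
  (\det A) ^+ 2 <= (n%:R * M ^+ 2) ^+ n.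
Proof.
move=> AM; apply: le_trans (hadamard A) _.
rewrite -[X in _ ^+ X](card_ord n) -prodr_const; apply: ler_prod => i _.
rewrite sumr_ge0 => [|j _]; last exact: sqr_ge0.
rewrite -[X in X%:R](card_ord n) mulr_natl -sumr_const ler_sum// => j _.
rewrite -real_normK ?num_real// lerXn2r ?nnegrE//.
exact: le_trans (AM i j).
Qed.

End hadamard.

(** * Bounded uniformly continuous functions of several variables *)

Section nice_functions.
Context {R : realType}.
Variable T : R.
Hypothesis T0 : 0 <= T.
Implicit Types (f g : seq R -> R) (s l : seq R) (x y d e t M : R) (n m N : nat).

(** The index is unrestricted: beyond the length the default 0 is read, harmless because
    [0 <= T]. *)
Definition boxed s := forall i, `|s`_i| <= T.
Definition near_seq d s l := forall i, `|s`_i - l`_i| < d.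

(** Functions of [N] variables are functions of lists, so that iterated integration is a recursion
    on [N]; only lists of length [N] in the box count. *)
Definition nice N f :=
  (exists2 M, 0 < M & forall s, size s = N -> boxed s -> `|f s| <= M) /\
  (forall e, 0 < e -> exists2 d, 0 < d & forall s l, size s = N -> size l = N ->
    boxed s -> boxed l -> near_seq d s l -> `|f s - f l| < e).

Lemma boxed_nil : boxed [::].
Proof. by move=> i; rewrite nth_nil normr0. Qed.

Lemma boxed_cons x s : `|x| <= T -> boxed s -> boxed (x :: s).
Proof. by move=> xT sT [|i] /=. Qed.

Lemma boxed_cat s l : boxed s -> boxed l -> boxed (s ++ l).
Proof. by move=> sT lT i; rewrite nth_cat; case: ifP. Qed.

Lemma near_seq_refl d s : 0 < d -> near_seq d s s.
Proof. by move=> d0 i; rewrite subrr normr0. Qed.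

Lemma near_seq_cat d s s' l l' : size s = size s' -> near_seq d s s' -> near_seq d l l' ->
  near_seq d (s ++ l) (s' ++ l').
Proof. by move=> ss h h' i; rewrite !nth_cat ss; case: ifP. Qed.

Lemma near_seq_cons d x y s l : `|x - y| < d -> near_seq d s l -> near_seq d (x :: s) (y :: l).
Proof. by move=> xy h [|i] /=. Qed.

(** Meant for the reordering, removal and insertion of variables, none of which increases entrywise
    distances. *)
Lemma nice_map N N' f (phi : seq R -> seq R) : nice N' f ->
  (forall s, size s = N -> size (phi s) = N') ->
  (forall s, size s = N -> boxed s -> boxed (phi s)) ->
  (forall d s l, 0 < d -> size s = N -> size l = N -> near_seq d s l ->
    near_seq d (phi s) (phi l)) ->
  nice N (fun s => f (phi s)).
Proof.
move=> [[M M0 fM] fc] sz bx nr; split.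
  by exists M => // s sN sT; apply: fM; [exact: sz|exact: bx].
move=> e /fc[d d0 hd]; exists d => // s l sN lN sT lT sl.
by apply: hd; [exact: sz|exact: sz|exact: bx|exact: bx|exact: nr].
Qed.

Lemma nice_ext N f g : (forall s, size s = N -> f s = g s) -> nice N f -> nice N g.
Proof.
move=> E [[M M0 fM] fc]; split; first by exists M => // s sN sT; rewrite -E// fM.
by move=> e /fc[d d0 hd]; exists d => // s l sN lN *; rewrite -!E// hd.
Qed.

Lemma nice_cst N k : nice N (fun=> k).
Proof.
split; first by exists (`|k| + 1); [rewrite ltr_wpDl|move=> *; rewrite lerDl].
by move=> e e0; exists 1 => // *; rewrite subrr normr0.
Qed.

Lemma niceD N f g : nice N f -> nice N g -> nice N (fun s => f s + g s).
Proof.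
move=> [[M M0 fM] fc] [[M' M'0 gM] gc]; split.
  exists (M + M'); first by rewrite addr_gt0.
  by move=> s sN sT; rewrite (le_trans (ler_normD _ _))// lerD ?fM ?gM.
move=> e e0; have e20 : 0 < e / 2 by rewrite divr_gt0.
have [d1 d10 h1] := fc _ e20; have [d2 d20 h2] := gc _ e20.
exists (Num.min d1 d2); first by rewrite lt_min d10.
move=> s l sN lN sT lT sl.
rewrite (_ : _ - _ = (f s - f l) + (g s - g l)); last by ring.
rewrite (le_lt_trans (ler_normD _ _))// (splitr e) ltrD// ?h1 ?h2// => i.
  by have := sl i; rewrite lt_min => /andP[].
by have := sl i; rewrite lt_min => /andP[].
Qed.

Lemma niceM N f g : nice N f -> nice N g -> nice N (fun s => f s * g s).
Proof.
move=> [[M M0 fM] fc] [[M' M'0 gM] gc]; split.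
  exists (M * M'); first by rewrite mulr_gt0.
  by move=> s sN sT; rewrite normrM ler_pM ?fM ?gM.
move=> e e0.
have e1 : 0 < e / (2 * M') by rewrite divr_gt0// mulr_gt0.
have e2 : 0 < e / (2 * M) by rewrite divr_gt0// mulr_gt0.
have [d1 d10 h1] := fc _ e1; have [d2 d20 h2] := gc _ e2.
exists (Num.min d1 d2); first by rewrite lt_min d10.
move=> s l sN lN sT lT sl.
have {}h1 : `|f s - f l| < e / (2 * M').
  by apply: h1 => // i; have := sl i; rewrite lt_min => /andP[].
have {}h2 : `|g s - g l| < e / (2 * M).
  by apply: h2 => // i; have := sl i; rewrite lt_min => /andP[].
rewrite (_ : _ - _ = (f s - f l) * g s + f l * (g s - g l)); last by ring.
rewrite (le_lt_trans (ler_normD _ _))// !normrM.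
rewrite (_ : e = e / (2 * M') * M' + M * (e / (2 * M))); last first.
  by field; rewrite !gt_eqF.
apply: ltr_leD.
  rewrite (@le_lt_trans _ _ (`|f s - f l| * M')) ?ler_wpM2l ?gM//.
  by rewrite ltr_pM2r.
by rewrite ler_pM ?fM// ltW.
Qed.

Lemma niceZ N k f : nice N f -> nice N (fun s => k * f s).
Proof. by apply: niceM; exact: nice_cst. Qed.

Lemma nice_sum N (I : Type) (r : seq I) (P : pred I) (F : I -> seq R -> R) :
  (forall i, nice N (F i)) -> nice N (fun s => \sum_(i <- r | P i) F i s).
Proof.
move=> H; elim: r => [|i r IH].
  by apply: (nice_ext (f := fun=> 0)) (nice_cst _ _) => s _; rewrite big_nil.
have [Pi|Pi] := boolP (P i); last first.
  by apply: nice_ext IH => s _; rewrite big_cons (negbTE Pi).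
by apply: nice_ext (niceD (H i) IH) => s _; rewrite big_cons Pi.
Qed.

Lemma nice_prod N (I : Type) (r : seq I) (P : pred I) (F : I -> seq R -> R) :
  (forall i, nice N (F i)) -> nice N (fun s => \prod_(i <- r | P i) F i s).
Proof.
move=> H; elim: r => [|i r IH].
  by apply: (nice_ext (f := fun=> 1)) (nice_cst _ _) => s _; rewrite big_nil.
have [Pi|Pi] := boolP (P i); last first.
  by apply: nice_ext IH => s _; rewrite big_cons (negbTE Pi).
by apply: nice_ext (niceM (H i) IH) => s _; rewrite big_cons Pi.
Qed.

Lemma nice_det N m (A : 'I_m -> 'I_m -> seq R -> R) : (forall i j, nice N (A i j)) ->
  nice N (fun s => \det (\matrix_(i < m, j < m) A i j s)).
Proof.
move=> H; rewrite /determinant; apply: nice_sum => p; apply: niceZ.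
suff: nice N (fun s => \prod_(i < m) A i (fun_of_perm p i) s).
  by apply: nice_ext => s _; apply: eq_bigr => i _; rewrite mxE.
by apply: nice_prod => i.
Qed.

Lemma nice_nth N i (h : R -> R) : uc (- T) T h -> nice N (fun s => h s`_i).
Proof.
move=> H; split.
  have [M M0 hM] := uc_bounded H; exists M => // s _ sT; apply: hM.
  by rewrite -ler_norml.
move=> e /H[d d0 hd]; exists d => // s l _ _ sT lT sl.
by apply: hd; rewrite -?ler_norml.
Qed.

Lemma nice_nth2 N i j (k : R -> R -> R) : uc2 (- T) T (- T) T k ->
  (exists2 M, 0 < M & forall x y, `|x| <= T -> `|y| <= T -> `|k x y| <= M) ->
  nice N (fun s => k s`_i s`_j).
Proof.
move=> H [M M0 kM]; split; first by exists M => // s _ sT; apply: kM.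
move=> e /H[d d0 hd]; exists d => // s l _ _ sT lT sl.
by apply: hd; rewrite -?ler_norml.
Qed.

Lemma nice_cons N f x : `|x| <= T -> nice N.+1 f -> nice N (fun l => f (x :: l)).
Proof.
move=> xT nf; apply: (nice_map nf) => [s sN|s _ sT|d s l d0 _ _ sl].
- by rewrite /= sN.
- exact: boxed_cons.
- by apply: near_seq_cons; rewrite // subrr normr0.
Qed.

Lemma nice_cat m n f s : boxed s -> size s = m -> nice (m + n) f -> nice n (fun l => f (s ++ l)).
Proof.
move=> sT sm nf; apply: (nice_map nf) => [l <-|l _ lT|d l l' d0 _ _ ll].
- by rewrite size_cat sm.
- exact: boxed_cat.
- by apply: near_seq_cat => //; exact: near_seq_refl.
Qed.

Lemma nice1_uc f : nice 1 f -> uc (- T) T (fun x => f [:: x]).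
Proof.
move=> [_ H] e /H[d d0 hd]; exists d => // x y; rewrite -!ler_norml => xT yT xy.
apply: hd => //; [exact: boxed_cons boxed_nil|exact: boxed_cons boxed_nil|].
by apply: near_seq_cons => //; exact: near_seq_refl.
Qed.

Lemma nice2_uc2 f : nice 2 f -> uc2 (- T) T (- T) T (fun x y => f [:: x; y]).
Proof.
move=> [_ H] e /H[d d0 hd]; exists d => // x x' y y'.
rewrite -!ler_norml => xT x'T yT y'T xx yy.
apply: hd => //; [by do 2!apply: boxed_cons => //; exact: boxed_nil..|].
by do 2!apply: near_seq_cons => //; exact: near_seq_refl.
Qed.

End nice_functions.

(** * Iterated integrals over cubes and their dependence on the endpoint *)

Section iterated_integral.
Context {R : realType}.
Variable T : R.
Hypothesis T0 : 0 <= T.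
Implicit Types (f g : seq R -> R) (s l : seq R) (x y d e t M : R) (n m N : nat).

Fixpoint iint t n f : R :=
  if n is n'.+1 then itg (- T) t (fun x => iint t n' (fun l => f (x :: l))) else f [::].

Lemma eq_iint t n f g : (forall l, size l = n -> f l = g l) -> iint t n f = iint t n g.
Proof.
elim: n f g => [|n IH] f g E /=; first exact: E.
by apply: itg_eq => x _; apply: IH => l ln; apply: E; rewrite /= ln.
Qed.

(** Linearity and the bound are proved together: in dimension [n + 1] both need continuity of the
    inner integral in the outer variable, and this is the bound in dimension [n] for a difference,
    which linearity makes a single integral. *)
Lemma iint_linear t n : - T <= t <= T ->
  (forall k f g, nice T n f -> nice T n g ->
    iint t n (fun l => k * f l + g l) = k * iint t n f + iint t n g) /\
  (forall f M, nice T n f -> (forall l, size l = n -> boxed T l -> `|f l| <= M) ->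
    `|iint t n f| <= (2 * T) ^+ n * M).
Proof.
move=> /andP[tl tr]; elim: n => [|n [IHl IHb]].
  split=> // f M _ fM /=; rewrite expr0 mul1r; apply: fM => //; exact: boxed_nil.
have ucI f : nice T n.+1 f -> uc (- T) T (fun x => iint t n (fun l => f (x :: l))).
  move=> nf e e0; pose c := (2 * T) ^+ n.
  have c0 : 0 <= c by rewrite exprn_ge0// mulr_ge0.
  have e1 : 0 < e / (c + 1) by rewrite divr_gt0// ltr_wpDl.
  have [_ /(_ _ e1)[d d0 hd]] := nf; exists d => // x y; rewrite -!ler_norml => xT yT xy.
  have nx := nice_cons xT nf; have ny := nice_cons yT nf.
  have -> : iint t n (fun l => f (x :: l)) - iint t n (fun l => f (y :: l)) =
     iint t n (fun l => -1 * f (y :: l) + f (x :: l)) by rewrite IHl// mulN1r addrC.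
  apply: (@le_lt_trans _ _ (c * (e / (c + 1)))).
    apply: IHb; first by apply: niceD => //; exact: niceZ.
    move=> l ln lT; rewrite mulN1r addrC ltW// hd ?ln//=; try by rewrite ln.
    - exact: boxed_cons.
    - exact: boxed_cons.
    - by apply: near_seq_cons => //; exact: near_seq_refl.
  by rewrite mulrCA gtr_pMr// ltr_pdivrMr ?mul1r ?ltrDl// ltr_wpDl.
have ucI' f : nice T n.+1 f -> uc (- T) t (fun x => iint t n (fun l => f (x :: l))).
  by move=> /ucI; apply: uc_sub.
split=> [k f g nf ng|f M nf fM] /=.
  rewrite -itgZ; last exact: (ucI' _ nf).
  rewrite -itgD; [|by apply: ucZ; exact: (ucI' _ nf)|exact: (ucI' _ ng)].
  apply: itg_eq => x /andP[xl xr]; rewrite IHl//; apply: nice_cons => //;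
    by rewrite ler_norml xl (le_trans xr).
apply: (@le_trans _ _ ((t - - T) * ((2 * T) ^+ n * M))).
  apply: itg_bound => //; first exact: (ucI' _ nf).
  move=> x /andP[xl xr]; have xT : `|x| <= T by rewrite ler_norml xl (le_trans xr).
  apply: IHb; first exact: nice_cons.
  by move=> l ln lT; apply: fM; [rewrite /= ln|exact: boxed_cons].
rewrite exprS -mulrA; apply: ler_wpM2r; last by lra.
rewrite mulr_ge0// ?exprn_ge0 ?mulr_ge0//.
(* A point of the box shows [0 <= M], needed to replace [t + T] by [2 * T]. *)
have /fM : size (nseq n.+1 0 : seq R) = n.+1 by rewrite size_nseq.
move=> /(_ _)/(le_trans _); apply=> // i; rewrite nth_nseq; case: ifP; by rewrite normr0.
Qed.

Section fixed_endpoint.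
Variable t : R.
Hypothesis tP : - T <= t <= T.

Lemma iintD n f g : nice T n f -> nice T n g ->
  iint t n (fun l => f l + g l) = iint t n f + iint t n g.
Proof.
move=> nf ng; have [H _] := iint_linear n tP; rewrite -[iint t n f]mul1r -H//.
by apply: eq_iint => l _; rewrite mul1r.
Qed.

Lemma iintZ n k f : nice T n f -> iint t n (fun l => k * f l) = k * iint t n f.
Proof.
move=> nf; have [H _] := iint_linear n tP.
have := H k f _ nf (niceZ 0 nf).
rewrite (@eq_iint t n _ (fun l => k * f l)) => [->|l _]; last by rewrite mul0r addr0.
have := H (-1) f f nf nf; rewrite (@eq_iint t n _ (fun l => 0 * f l)) => [->|l _].
  by rewrite mulN1r addNr addr0.
by rewrite mulN1r mul0r addNr.
Qed.

Lemma iintB n f g : nice T n f -> nice T n g ->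
  iint t n (fun l => f l - g l) = iint t n f - iint t n g.
Proof.
move=> nf ng; rewrite -mulN1r -iintZ// -iintD//; last exact: niceZ.
by apply: eq_iint => l _; rewrite mulN1r.
Qed.

Lemma iint_bound n f M : nice T n f -> (forall l, size l = n -> boxed T l -> `|f l| <= M) ->
  `|iint t n f| <= (2 * T) ^+ n * M.
Proof. by have [_] := iint_linear n tP; apply. Qed.

Lemma iint_sum n m (F : 'I_m -> seq R -> R) : (forall i, nice T n (F i)) ->
  iint t n (fun l => \sum_i F i l) = \sum_i iint t n (F i).
Proof.
elim: m F => [|m IH] F nF.
  rewrite big_ord0 (@eq_iint t n _ (fun l => 0 * 0)) => [|l _]; last by rewrite big_ord0 mul0r.
  by rewrite iintZ ?mul0r//; exact: nice_cst.
rewrite big_ord_recl -IH// -iintD//; last exact: nice_sum.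
by apply: eq_iint => l _; rewrite big_ord_recl.
Qed.

End fixed_endpoint.

Lemma nice_iint m n t f : - T <= t <= T -> nice T (m + n) f ->
  nice T m (fun s => iint t n (fun l => f (s ++ l))).
Proof.
move=> tP nf; have [[M M0 fM] fc] := nf.
have c0 : 0 <= (2 * T) ^+ n by rewrite exprn_ge0// mulr_ge0.
split.
  exists ((2 * T) ^+ n * M + 1); first by rewrite ltr_wpDl// mulr_ge0// ltW.
  move=> s sm sT; apply: (@le_trans _ _ ((2 * T) ^+ n * M)); last by rewrite lerDl.
  apply: iint_bound => //; first exact: nice_cat nf.
  by move=> l ln lT; apply: fM; [rewrite size_cat sm ln|exact: boxed_cat].
move=> e e0; have e1 : 0 < e / ((2 * T) ^+ n + 1) by rewrite divr_gt0// ltr_wpDl.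
have [d d0 hd] := fc _ e1; exists d => // s s' sm s'm sT s'T ss.
have ns := nice_cat sT sm nf; have ns' := nice_cat s'T s'm nf.
rewrite -iintB//; apply: (@le_lt_trans _ _ ((2 * T) ^+ n * (e / ((2 * T) ^+ n + 1)))).
  apply: iint_bound => //; first by apply: niceD => //; under eq_fun do rewrite -mulN1r; exact: niceZ.
  move=> l ln lT; apply: ltW; apply: hd; rewrite ?size_cat ?sm ?s'm ?ln//; try exact: boxed_cat.
  by apply: near_seq_cat; rewrite ?sm//; exact: near_seq_refl.
by rewrite mulrCA gtr_pMr// ltr_pdivrMr ?mul1r ?ltrDl// ltr_wpDl.
Qed.

Lemma uc_iint n t f : - T <= t <= T -> nice T n.+1 f ->
  uc (- T) T (fun x => iint t n (fun l => f (x :: l))).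
Proof. by move=> tP nf; exact: (nice1_uc T0 (nice_iint (m := 1) tP nf)). Qed.

Lemma itv_norm t x : - T <= t <= T -> - T <= x <= t -> `|x| <= T.
Proof. by move=> tP xP; rewrite ler_norml; lra. Qed.

(** Moving the endpoint costs one slab of the outer variable and, by induction, the change of the
    inner integrals. The constant depends on [n] and [M] but not on [f], so it can be used under an
    outer integral. *)
Lemma iint_lip n M : 0 <= M -> exists2 C, 0 <= C & forall f t t', nice T n f ->
  (forall l, size l = n -> boxed T l -> `|f l| <= M) -> - T <= t <= T -> - T <= t' <= T ->
  `|iint t' n f - iint t n f| <= C * `|t' - t|.
Proof.
move=> M0; elim: n => [|n [C C0 IH]].
  by exists 0 => // f t t' _ _ _ _ /=; rewrite subrr normr0 mul0r.
have c0 : 0 <= (2 * T) ^+ n * M by rewrite mulr_ge0// exprn_ge0// mulr_ge0.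
exists ((2 * T) ^+ n * M + 2 * T * C); first by rewrite addr_ge0// !mulr_ge0.
move=> f t t' nf fM; wlog tt : t t' / t <= t' => [hw tP t'P|tP t'P].
  have [?|/ltW ?] := leP t t'; first exact: hw.
  by rewrite distrC (distrC t'); apply: hw.
have [tl tr] : - T <= t /\ t <= T by apply/andP.
have [tl' tr'] : - T <= t' /\ t' <= T by apply/andP.
have U := uc_iint t'P nf; have U' := uc_iint tP nf.
rewrite /= (@itg_cat _ (- T) t t')//; last exact: uc_sub U.
rewrite addrAC -itgB; [|exact: uc_sub U|exact: uc_sub U'].
rewrite addrC (le_trans (ler_normD _ _))// mulrDl; apply: lerD.
  rewrite (ger0_norm (x := t' - t)) ?subr_ge0// mulrC.
  apply: itg_bound => //; first exact: uc_sub U.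
  move=> x xP; have xT : `|x| <= T by rewrite ler_norml; lra.
  apply: iint_bound => //; first exact: nice_cons.
  by move=> l ln lT; apply: fM; [rewrite /= ln|exact: boxed_cons].
apply: (@le_trans _ _ ((t - - T) * (C * `|t' - t|))).
  apply: itg_bound => //; first by apply: ucB; [exact: uc_sub U|exact: uc_sub U'].
  move=> x xP; have xT := itv_norm tP xP.
  apply: IH => //; first exact: nice_cons.
  by move=> l ln lT; apply: fM; [rewrite /= ln|exact: boxed_cons].
by rewrite mulrA; apply: ler_wpM2r => //; apply: ler_wpM2r => //; lra.
Qed.

(* Integrating over x_j first: Fubini moves the j-th variable outermost. *)
Lemma iint_pick n j t (h : R -> seq R -> R) : - T <= t <= T -> (j <= n)%N ->
  nice T n.+1 (fun l => h (head 0 l) (behead l)) ->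
  iint t n.+1 (fun l => h l`_j (take j l ++ drop j.+1 l)) = itg (- T) t (fun y => iint t n (h y)).
Proof.
move=> tP; elim: n j h => [|n IH] [|j] h jn nh //.
have [tl tr] : - T <= t /\ t <= T by apply/andP.
have nh' : nice T (2 + n) (fun s => h (nth 0 s 1) (nth 0 s 0 :: behead (behead s))).
  apply: (@nice_map _ T _ _ _ (fun s => [:: nth 0 s 1, nth 0 s 0 & behead (behead s)]) nh).
  - by move=> [|x [|y s]]//= [].
  - move=> [|x [|y s]]// _ H [|[|i]] /=; [exact: (H 1%N)|exact: (H 0%N)|].
    exact: (H i.+2).
  - move=> d [|x [|y s]]// [|x' [|y' s']]// d0 _ _ H [|[|i]] /=.
    + exact: (H 1%N).
    + exact: (H 0%N).
    + exact: (H i.+2).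
have U2 := nice2_uc2 T0 (nice_iint (m := 2) tP nh').
rewrite [RHS](_ : _ = itg (- T) t (fun y => itg (- T) t (fun x => iint t n (fun l => h y (x :: l)))))//.
rewrite -itg_fubini//; last first.
  apply: uc2_sub U2 => //.
apply: itg_eq => x xP /=; have xT := itv_norm tP xP.
apply: (IH j (fun y l => h y (x :: l))) => //.
apply: (@nice_map _ T _ _ _ (fun s => [:: head 0 s, x & behead s]) nh).
- by move=> [|y s]//= [->].
- by move=> [|y s]// _ H [|[|i]] /=; [exact: (H 0%N)|exact: xT|exact: (H i.+1)].
- move=> d [|y s]// [|y' s']// d0 _ _ H [|[|i]] /=.
  + exact: (H 0%N).
  + by rewrite subrr normr0.
  + exact: (H i.+1).
Qed.

(** [Q x] is the derivative in the endpoint of the integral over the variables other than [x]. By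
    symmetry [x] and [t] may be exchanged, and integrating over [x] restores an [n]-fold integral.
    For [n = 0] the junk [n.-1] is multiplied by 0. *)
Lemma itg_swap n g t : nice T n.+1 g -> (forall l l', perm_eq l l' -> g l = g l') ->
  - T <= t <= T -> let Q x := n%:R * iint t n.-1 (fun l => g [:: x, t & l]) in
  uc (- T) T Q /\ itg (- T) t Q = n%:R * iint t n (fun l => g (t :: l)).
Proof.
move=> ng pg tP Q; have tT : `|t| <= T by rewrite ler_norml.
case: n @Q ng => [|n] Q ng.
  split; first by apply: (@uc_eq _ _ _ (fun=> 0)) (uc_cst _ _ _) => x _; rewrite /Q mul0r.
  by rewrite mul0r -(itg0 (- T) t); apply: itg_eq => x _; rewrite /Q mul0r.
have E x : Q x = n.+1%:R * iint t n (fun l => g [:: t, x & l]).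
  congr (_ * _); apply: eq_iint => l _; apply: pg.
  by rewrite -(cat1s x) -(cat1s t l) perm_catCA.
have U := uc_iint tP (nice_cons tT ng).
split; first by apply: uc_eq (ucZ n.+1%:R U) => x _; rewrite E.
rewrite -itgZ; first by apply: itg_eq => x _; rewrite E.
by apply: uc_sub U => //; case/andP: tP.
Qed.

(** Each of the [n] variables contributes the face where it equals [t], and symmetry makes these
    contributions equal. The induction moves the outer variable into the parameters [s], which is
    why [d] must be uniform in [s]. *)
Lemma iint_deriv m n f : nice T (m + n) f -> (forall l l', perm_eq l l' -> f l = f l') ->
  forall e, 0 < e -> exists2 d, 0 < d & forall s t t', size s = m -> boxed T s ->
  - T <= t <= T -> - T <= t' <= T -> `|t' - t| < d ->
  `|iint t' n (fun l => f (s ++ l)) - iint t n (fun l => f (s ++ l)) -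
    (t' - t) * (n%:R * iint t n.-1 (fun l => f (s ++ t :: l)))| <= e * `|t' - t|.
Proof.
elim: n m f => [|n IH] m f nf pf e e0.
  by exists 1 => // s t t' *; rewrite mul0r mulr0 subr0 /= subrr normr0 mulr_ge0// ltW.
have nf' : nice T (m.+1 + n) f by rewrite addSnnS.
have [[M M0 fM] fc] := nf.
have [C C0 hC] := iint_lip n (ltW M0).
have c0 : 0 <= (2 * T) ^+ n by rewrite exprn_ge0// mulr_ge0.
(* The inner increments cost [2 * T * e1] and the slab [2 * e1], together [e]. *)
pose e1 := e / (2 * T + 2).
have e10 : 0 < e1 by rewrite divr_gt0// ltr_wpDl// mulr_ge0.
have [d1 d10 h1] := IH m.+1 f nf' pf _ e10.
have [d2 d20 h2] := fc (e1 / ((2 * T) ^+ n + 1)) (divr_gt0 e10 (ltr_wpDl c0 ltr01)).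
exists (Num.min d1 (Num.min d2 (e1 / (C + 1)))).
  by rewrite !lt_min d10 d20 divr_gt0// ltr_wpDl.
move=> s t t' sm sT tP t'P; rewrite !lt_min => /andP[td1 /andP[td2 td3]].
have [tl tr] : - T <= t /\ t <= T by apply/andP.
have [tl' tr'] : - T <= t' /\ t' <= T by apply/andP.
have tT : `|t| <= T by rewrite ler_norml.
pose P u x := iint u n (fun l => f (s ++ x :: l)).
have ns : nice T n.+1 (fun l => f (s ++ l)) by exact: nice_cat nf.
have Pu u : - T <= u <= T -> uc (- T) T (P u) by move=> uP; exact: uc_iint uP ns.
have nsx x : `|x| <= T -> nice T n (fun l => f (s ++ x :: l)).
  by move=> xT; exact: nice_cons xT ns.
have fMx x : `|x| <= T -> forall l, size l = n -> boxed T l -> `|f (s ++ x :: l)| <= M.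
  move=> xT l ln lT; apply: fM; first by rewrite size_cat sm /= ln.
  by apply: boxed_cat => //; exact: boxed_cons.
have Pxx x : `|x| <= T -> `|x - t| <= `|t' - t| -> `|P t' x - P t t| <= 2 * e1.
  move=> xT xt; rewrite (_ : _ - _ = (P t' x - P t x) + (P t x - P t t)); last by ring.
  rewrite (le_trans (ler_normD _ _))// mulr2n mulrDl !mul1r; apply: lerD.
    apply: (le_trans (hC _ _ _ (nsx x xT) (fMx x xT) tP t'P)).
    rewrite (@le_trans _ _ ((C + 1) * `|t' - t|)) ?ler_wpM2r ?lerDl//.
    by rewrite mulrC -ler_pdivlMr ?ltr_wpDl// ltW.
  rewrite -iintB//; [|exact: nsx|exact: nsx].
  apply: (@le_trans _ _ ((2 * T) ^+ n * (e1 / ((2 * T) ^+ n + 1)))).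
    apply: iint_bound => //.
      by apply: niceD (nsx x xT) _; under eq_fun do rewrite -mulN1r; apply: niceZ; exact: nsx.
    move=> l ln lT; apply: ltW; apply: h2; rewrite ?size_cat/= ?sm ?ln//.
    - by apply: boxed_cat => //; exact: boxed_cons.
    - by apply: boxed_cat => //; exact: boxed_cons.
    - apply: near_seq_cat => //; first exact: near_seq_refl.
      by apply: near_seq_cons; [exact: le_lt_trans xt _|exact: near_seq_refl].
  by rewrite mulrCA ger_pMr// ler_pdivrMr ?mul1r ?lerDl// ltr_wpDl.
pose Q x := n%:R * iint t n.-1 (fun l => f (s ++ x :: t :: l)).
have hQ x : `|x| <= T -> `|P t' x - P t x - (t' - t) * Q x| <= e1 * `|t' - t|.
  move=> xT; have := h1 (rcons s x) t t'; rewrite size_rcons sm => /(_ erefl _ tP t'P td1).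
  have bsx : boxed T (rcons s x) by rewrite -cats1; apply: boxed_cat => //; exact: boxed_cons (boxed_nil T0).
  have E (k : seq R -> seq R) u j : iint u j (fun l => f (rcons s x ++ k l)) =
      iint u j (fun l => f (s ++ x :: k l)) by apply: eq_iint => l _; rewrite cat_rcons.
  by move=> /(_ bsx); rewrite (E id) (E id t) (E (cons t)).
have pg l l' : perm_eq l l' -> f (s ++ l) = f (s ++ l').
  by move=> ll; apply: pf; rewrite perm_cat2l.
have [UQ EQ] := itg_swap ns pg tP; rewrite -/Q in UQ EQ.
rewrite -natr1 [X in (t' - t) * X]mulrDl mul1r -EQ /= -/(P t') -/(P t) -/(P t t).
rewrite (_ : e * _ = (2 * T) * (e1 * `|t' - t|) + `|t' - t| * (2 * e1)); last first.
  by rewrite /e1; field; rewrite gt_eqF// ltr_wpDl// mulr_ge0.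
have Ut := uc_sub (lexx _) tr (Pu _ tP); have Ut' := uc_sub (lexx _) tr (Pu _ t'P).
have UQt := uc_sub (lexx _) tr UQ.
have b1 : `|itg (- T) t (fun x => P t' x - P t x - (t' - t) * Q x)| <= (2 * T) * (e1 * `|t' - t|).
  apply: (@le_trans _ _ ((t - - T) * (e1 * `|t' - t|))).
    apply: itg_bound => //; first by apply: ucB; [exact: ucB|exact: ucZ].
    by move=> x xP; apply: hQ; exact: itv_norm xP.
  apply: ler_wpM2r; first by apply: mulr_ge0 => //; exact: ltW.
  by clear -tr; lra.
rewrite itgB in b1; [|exact: ucB|exact: ucZ]; rewrite (itgB Ut' Ut) (itgZ _ UQt) in b1.
(* As [itg] is unoriented, the slab between [t] and [t'] is added in one case and subtracted in the
   other. *)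
have [tt|/ltW tt] := leP t t'.
  rewrite (@itg_cat _ (- T) t t')//; last exact: uc_sub (Pu _ t'P).
  rewrite (_ : _ - _ = (itg (- T) t (P t') - itg (- T) t (P t) - (t' - t) * itg (- T) t Q) +
     (itg t t' (P t') - (t' - t) * P t t)); last by ring.
  rewrite (le_trans (ler_normD _ _))// lerD//.
  have Up : uc t t' (P t') by apply: uc_sub (Pu _ t'P).
  rewrite -itg_cst// -itgB//; last exact: uc_cst.
  rewrite (ger0_norm (x := t' - t)) ?subr_ge0//; apply: itg_bound => //.
    by apply: ucB => //; exact: uc_cst.
  move=> x xP; apply: Pxx; first by rewrite ler_norml; lra.
  by rewrite !ger0_norm; lra.
have -> : itg (- T) t' (P t') = itg (- T) t (P t') - itg t' t (P t').
  by rewrite (@itg_cat _ (- T) t' t)// addrK.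
rewrite (_ : _ - _ = (itg (- T) t (P t') - itg (- T) t (P t) - (t' - t) * itg (- T) t Q) -
     (itg t' t (P t') - (t - t') * P t t)); last by ring.
rewrite (le_trans (ler_normB _ _))// lerD//.
have Up : uc t' t (P t') by apply: uc_sub (Pu _ t'P).
rewrite -itg_cst// -itgB//; last exact: uc_cst.
rewrite (distrC t') (ger0_norm (x := t - t')) ?subr_ge0//; apply: itg_bound => //.
  by apply: ucB => //; exact: uc_cst.
move=> x xP; apply: Pxx; first by rewrite ler_norml; lra.
by rewrite !ler0_norm; lra.
Qed.

End iterated_integral.

(** * Fredholm series *)

Section dominated_series.
Context {R : realType}.
Implicit Types (f g : nat -> R) (C M : R) (n m N : nat).

(** Domination by a geometric series of fixed ratio gives remainders depending on [C] only, hence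
    uniform in any parameter. *)
Definition geo C f := forall n, `|f n| <= C * 2^-1 ^+ n.

Definition gsum f : R := limn (series f).

Lemma geo_tail C f : 0 <= C -> geo C f -> forall n m, (n <= m)%N ->
  `|series f m - series f n| <= 2 * C * 2^-1 ^+ n - 2 * C * 2^-1 ^+ m.
Proof.
move=> C0 fC n; elim=> [|m IH] nm.
  by move: nm; rewrite leqn0 => /eqP ->; rewrite !subrr normr0.
move: nm; rewrite leq_eqVlt => /predU1P[->|]; first by rewrite !subrr normr0.
rewrite ltnS => /IH {}IH; rewrite seriesSr.
rewrite (_ : _ - _ = (series f m - series f n) + f m); last by ring.
rewrite (le_trans (ler_normD _ _))// exprS.
have := fC m; set A := `|f m|; set B := `|_ - _| in IH *; move: IH.
set c := 2^-1 ^+ m; set d := 2^-1 ^+ n => h1 h2; lra.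
Qed.

Lemma geo_cvg C f : 0 <= C -> geo C f -> cvgn (series f).
Proof.
move=> C0 fC; apply: normed_cvg.
apply: (@series_le_cvg _ _ (geometric C 2^-1)) => //.
- by move=> n /=.
- by move=> n; rewrite /geometric/= mulr_ge0// exprn_ge0// invr_ge0.
- by apply: is_cvg_geometric_series; rewrite ger0_norm ?invr_ge0// invf_lt1// ltr1n.
Qed.

Lemma gsum_tail C f : 0 <= C -> geo C f -> forall n,
  `|gsum f - series f n| <= 2 * C * 2^-1 ^+ n.
Proof.
move=> C0 fC n; have fc := geo_cvg C0 fC.
have H : (fun m => `|series f m - series f n|) @ \oo --> `|gsum f - series f n|.
  by apply: cvg_norm; apply: cvgB => //; exact: cvg_cst.
rewrite -(cvg_lim _ H)//; apply: limr_le; first by apply/cvg_ex; eexists; exact: H.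
near=> m; apply: (le_trans (geo_tail C0 fC _)).
  by near: m; exists n.
by rewrite lerBlDr lerDl !mulr_ge0// exprn_ge0// invr_ge0.
Unshelve. all: by end_near. Qed.

Lemma gsum_bound C f : 0 <= C -> geo C f -> `|gsum f| <= 2 * C.
Proof.
by move=> C0 /(gsum_tail C0)/(_ 0%N); rewrite /series/= big_geq// subr0 expr0 mulr1.
Qed.

Lemma half_small C e : 0 < e -> exists n, C * 2^-1 ^+ n < e.
Proof.
move=> e0; have /cvgrPdist_lt/(_ _ e0)[N _ /(_ N (leqnn _))] :
    (fun n => C * 2^-1 ^+ n) @ \oo --> (C * 0 : R).
  apply: cvgMr; apply: cvg_expr.
  by rewrite ger0_norm ?invr_ge0// invf_lt1// ltr1n.
by rewrite /= mulr0 sub0r normrN => /(le_lt_trans (ler_norm _)); exists N.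
Qed.

(** Identifies a sum by an explicit remainder; the termwise operations below are checked on partial
    sums by means of it. *)
Lemma gsum_uniq C f l : (forall n, `|l - series f n| <= C * 2^-1 ^+ n) -> gsum f = l.
Proof.
move=> H; apply: cvg_lim => //; apply/cvgrPdist_lt => e e0.
have [n hn] := half_small C e0.
have C0 : 0 <= C by have := H 0%N; rewrite expr0 mulr1; exact: le_trans.
exists n => // m /= nm; apply: le_lt_trans (H m) _; apply: le_lt_trans hn.
by rewrite ler_wpM2l// ler_wiXn2l// ?invr_ge0// invf_le1// ler1n.
Qed.

Lemma eq_gsum f g : f =1 g -> gsum f = gsum g.
Proof. by move=> /funext ->. Qed.

Lemma gsumD C D f g : 0 <= C -> 0 <= D -> geo C f -> geo D g ->
  gsum (fun n => f n + g n) = gsum f + gsum g.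
Proof.
move=> C0 D0 fC gD; apply: (@gsum_uniq (2 * C + 2 * D)) => n.
rewrite /series/= big_split/= mulrDl opprD addrACA (le_trans (ler_normD _ _))//.
by rewrite lerD// gsum_tail.
Qed.

Lemma gsumZ C f k : 0 <= C -> geo C f -> gsum (fun n => k * f n) = k * gsum f.
Proof.
move=> C0 fC; apply: (@gsum_uniq (`|k| * (2 * C))) => n.
by rewrite /series/= -mulr_sumr -mulrBr normrM -mulrA ler_wpM2l// gsum_tail.
Qed.

Lemma gsum_recl C f : 0 <= C -> geo C f -> gsum f = f 0%N + gsum (fun n => f n.+1).
Proof.
move=> C0 fC; apply: (@gsum_uniq (4 * C)) => n.
have gS : geo C (fun n => f n.+1).
  move=> m; apply: (le_trans (fC m.+1)).
  by rewrite exprS ler_wpM2l// ler_piMl ?exprn_ge0 ?invr_ge0// invf_le1// ler1n.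
case: n => [|n].
  rewrite /series/= big_geq// subr0 expr0 mulr1 (le_trans (ler_normD _ _))//.
  have := gsum_bound C0 gS; have := fC 0%N; rewrite expr0 mulr1; lra.
rewrite /series/= big_nat_recl// opprD addrACA subrr add0r.
apply: (le_trans (gsum_tail C0 gS n)); rewrite exprS.
by rewrite le_eqVlt; apply/orP; left; apply/eqP; field.
Qed.

Lemma series_uc a b (F : nat -> R -> R) n : (forall n, uc a b (F n)) ->
  uc a b (fun x => series (F^~ x) n).
Proof.
move=> H; elim: n => [|n IH].
  by apply: (@uc_eq _ _ _ (fun=> 0)) (uc_cst _ _ _) => x _; rewrite /series/= big_geq.
by apply: uc_eq (ucD IH (H n)) => x _; rewrite /series/= big_nat_recr.
Qed.

Lemma series_itg a b (F : nat -> R -> R) n : (forall n, uc a b (F n)) ->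
  itg a b (fun x => series (F^~ x) n) = series (fun n => itg a b (F n)) n.
Proof.
move=> H; elim: n => [|n IH].
  have E (f : nat -> R) : series f 0%N = 0 by rewrite /series/= big_geq.
  by rewrite E -(itg0 a b); apply: itg_eq => x _; rewrite E.
rewrite seriesSr -IH -itgD//; last exact: series_uc.
by apply: itg_eq => x _; rewrite seriesSr.
Qed.

Lemma gsum_uc a b C (F : nat -> R -> R) : 0 <= C -> (forall n, uc a b (F n)) ->
  (forall x, a <= x <= b -> geo C (F^~ x)) -> uc a b (fun x => gsum (F^~ x)).
Proof.
move=> C0 H FC; apply: (uc_lim (hn := fun n x => series (F^~ x) n)) => [n|e e0].
  exact: series_uc.
have [n hn] := half_small (2 * C) e0; exists n => x xab.
by apply: le_trans (gsum_tail C0 (FC x xab) n) (ltW hn).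
Qed.

Lemma gsum_itg a b C (F : nat -> R -> R) : a <= b -> 0 <= C -> (forall n, uc a b (F n)) ->
  (forall x, a <= x <= b -> geo C (F^~ x)) ->
  itg a b (fun x => gsum (F^~ x)) = gsum (fun n => itg a b (F n)).
Proof.
move=> ab C0 H FC; apply/esym/(@gsum_uniq ((b - a) * (2 * C))) => n.
have U := gsum_uc C0 H FC; have V := series_uc n H.
rewrite -series_itg// -itgB// -mulrA; apply: itg_bound => //; first exact: ucB.
by move=> x xab; exact: (gsum_tail C0 (FC x xab) n).
Qed.

End dominated_series.

(** * Hadamard's bound against factorials *)

Section factorial_decay.
Context {R : realType}.
Implicit Types (A M r x : R) (n : nat).

Lemma pow_fact_le x n : 0 <= x -> x ^+ n / n`!%:R <= expR x.
Proof.
move=> x0; case: n => [|n].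
  by rewrite expr0 fact0 divr1 -[X in X <= _]addr0 (le_trans _ (expR_ge1Dx x))// lerD2l.
by apply: le_trans (expR_ge1Dxn n x0); rewrite lerDr.
Qed.

(** [n^n / n!] is one term of the series of [e^n]. *)
Lemma expn_le_fact n : n%:R ^+ n <= expR 1 ^+ n * n`!%:R :> R.
Proof.
have := pow_fact_le n (ler0n R n).
by rewrite ler_pdivrMr ?ltr0n ?fact_gt0// -{2}[n%:R]mul1r expRM_natr.
Qed.

(** Hadamard's bound for a determinant of order [n] with entries at most [M] in absolute value. *)
Definition hadamard_const M n : R := Num.sqrt ((n%:R * M ^+ 2) ^+ n).

(** In the square, [(n+1)^(n+1) <= e^(n+1) (n+1)!] uses up one of the two factorials of the
    denominator; the other one beats every geometric rate. *)
Lemma hadamard_const_decay A M r : 0 <= A -> 0 <= M -> 0 < r ->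
  exists2 C, 0 <= C & forall n, A ^+ n * hadamard_const M n.+1 / n`!%:R <= C * r ^+ n.
Proof.
move=> A0 M0 r0.
pose e : R := expR 1; have e0 : 0 < e by exact: expR_gt0.
(* [B ^+ n] gathers the geometric factors of the square, among them [r^(-2n)] and the [2 ^+ n]
   bounding [n + 1]; then [B^n / n! <= e^B]. *)
pose B := 2 * A ^+ 2 * M ^+ 2 * e / r ^+ 2.
have B0 : 0 <= B by rewrite !mulr_ge0 ?invr_ge0 ?exprn_ge0// ltW.
pose D := M ^+ 2 * e * expR B.
have D0 : 0 <= D by rewrite !mulr_ge0 ?exprn_ge0 ?expR_ge0// ltW.
exists (Num.sqrt D); first exact: sqrtr_ge0.
move=> n.
have f0 : 0 < n`!%:R :> R by rewrite ltr0n fact_gt0.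
rewrite -(@ler_pXn2r _ 2) ?nnegrE//; last 2 first.
- by rewrite !mulr_ge0 ?exprn_ge0 ?sqrtr_ge0 ?invr_ge0// ltW.
- by rewrite mulr_ge0 ?sqrtr_ge0 ?exprn_ge0// ltW.
rewrite !exprMn !sqr_sqrtr//; last by rewrite exprn_ge0// mulr_ge0// sqr_ge0.
rewrite exprVn ler_pdivrMr ?exprn_gt0// exprMn.
have h1 := expn_le_fact n.+1; rewrite -/e in h1.
have h2 : n.+1%:R <= 2 ^+ n :> R by rewrite -natrX ler_nat; exact: ltn_expl.
have h3 := pow_fact_le n B0; rewrite ler_pdivrMr// in h3.
apply: (@le_trans _ _ (A ^+ n ^+ 2 * (e ^+ n.+1 * (n.+1)`!%:R * M ^+ 2 ^+ n.+1))).
  by rewrite ler_wpM2l ?exprn_ge0 ?sqr_ge0// ler_wpM2r// exprn_ge0 ?sqr_ge0.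
rewrite factS natrM.
apply: (@le_trans _ _ (A ^+ n ^+ 2 * (e ^+ n.+1 * (2 ^+ n * n`!%:R) * M ^+ 2 ^+ n.+1))).
  rewrite ler_wpM2l ?exprn_ge0 ?sqr_ge0// ler_wpM2r ?exprn_ge0 ?sqr_ge0//.
  by rewrite ler_wpM2l ?exprn_ge0 ?(ltW e0)// ler_wpM2r// ltW.
have -> : A ^+ n ^+ 2 * (e ^+ n.+1 * (2 ^+ n * n`!%:R) * M ^+ 2 ^+ n.+1) =
    (M ^+ 2 * e) * r ^+ n ^+ 2 * (B ^+ n * n`!%:R).
  rewrite /B (exprMn n _ (r ^+ 2)^-1) (exprMn n _ e) (exprMn n _ (M ^+ 2)) (exprMn n 2) exprVn (exprS e) (exprS (M ^+ 2)) (exprAC _ n) (exprAC r).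
  have : r ^+ 2 ^+ n != 0 by rewrite gt_eqF// !exprn_gt0.
  move: (r ^+ 2 ^+ n) (A ^+ 2 ^+ n) (M ^+ 2 ^+ n) (e ^+ n) (2 ^+ n) => u v w y z u0.
  by field.
rewrite /D.
rewrite (_ : M ^+ 2 * e * expR B * r ^+ n ^+ 2 * n`!%:R ^+ 2 =
  M ^+ 2 * e * r ^+ n ^+ 2 * (expR B * n`!%:R * n`!%:R)); last by ring.
apply: ler_wpM2l; last by apply: ler_wpM2r; [exact: ltW|].
by apply: mulr_ge0; [apply: mulr_ge0; [exact: sqr_ge0|exact: ltW]|exact: sqr_ge0].
Qed.

(** Lets the plain determinants of order [n] share the constant of the bordered ones of order
    [n + 1]. *)
Lemma hadamard_const_ge M n : 1 <= M -> hadamard_const M n <= hadamard_const M n.+1.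
Proof.
move=> M1; rewrite ler_wsqrtr//; case: n => [|n].
  by rewrite expr0 expr1 mul1r exprn_ege1.
have h : 1 <= n.+2%:R * M ^+ 2.
  have M2 : 1 <= M ^+ 2 := exprn_ege1 2 M1.
  by apply: (le_trans M2); rewrite ler_peMl ?ler1n// (le_trans ler01 M2).
apply: (@le_trans _ _ ((n.+2%:R * M ^+ 2) ^+ n.+1)).
  have M2 := sqr_ge0 M.
  rewrite lerXn2r ?nnegrE ?(mulr_ge0 (ler0n _ _) M2)// ler_wpM2r// ler_nat.
  exact: leqnSn.
by rewrite [X in _ <= X]exprS ler_peMl// exprn_ge0// (le_trans ler01).
Qed.

End factorial_decay.

(** * Finite Fredholm determinants and their bordered variants *)

Section bordered_determinants.
Context {R : realType}.
Implicit Types (k : R -> R -> R) (g : R -> R) (x : R) (l : seq R).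

Definition fdet k l := \det (\matrix_(i < size l, j < size l) k l`_i l`_j).

(** Cramer's numerator: in the determinant on the points [x :: l] the column of [x] is replaced by
    the values of [g]. Summed over [l] it solves the integral equation with right-hand side [g], up
    to the factor [D]. *)
Definition bdet k g x l := \det (\matrix_(i < (size l).+1, j < (size l).+1)
  if j == 0 :> nat then g (x :: l)`_i else k (x :: l)`_i (x :: l)`_j).

Lemma fdetE k n l : size l = n -> fdet k l = \det (\matrix_(i < n, j < n) k l`_i l`_j).
Proof. by move=> <-. Qed.

Lemma bdetE k g x n l : size l = n -> bdet k g x l = \det (\matrix_(i < n.+1, j < n.+1)
  if j == 0 :> nat then g (x :: l)`_i else k (x :: l)`_i (x :: l)`_j).
Proof. by move=> <-. Qed.

Lemma fdet_cons k x l : fdet k (x :: l) = bdet k (k^~ x) x l.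
Proof.
congr (\det _); apply/matrixP => i j; rewrite !mxE.
by case: j => -[|j] ?.
Qed.

(** Rows and columns undergo the same permutation, so the signs cancel. *)
Lemma fdet_perm k l l' : perm_eq l l' -> fdet k l = fdet k l'.
Proof.
move=> ll; have sz := perm_size ll.
have /tuple_permP[p lE] : perm_eq l (in_tuple l') by [].
rewrite (fdetE _ sz) (fdetE _ (erefl (size l'))).
set A := \matrix_(i < size l', j < size l') k l'`_i l'`_j.
have -> : \matrix_(i < size l', j < size l') k l`_i l`_j = row_perm p (col_perm p A).
  apply/matrixP => i j; rewrite !mxE lE.
  by rewrite !(nth_mktuple _ _ _) !(tnth_nth 0).
rewrite row_permE col_permE !det_mulmx !det_perm odd_permV.
by rewrite mulrC -mulrA -signr_addb addbb expr0 mulr1.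
Qed.

Lemma nth_rem (l : seq R) j i : (j < size l)%N ->
  (take j l ++ drop j.+1 l)`_i = l`_(bump j i).
Proof.
move=> jl; rewrite nth_cat size_take jl /bump; have [ij|ji] := ltnP i j.
  by rewrite nth_take// leqNgt ij.
by rewrite nth_drop addSn subnKC// add1n.
Qed.

(** Expansion along the row of [x]: deleting the column of [l_j] leaves a bordered determinant in
    which [l_j] takes the place of [x], once its row has been moved to the top. *)
Lemma bdet_expand k g x n l : size l = n -> bdet k g x l =
  g x * fdet k l - \sum_(j < n) k x l`_j * bdet k g l`_j (take j l ++ drop j.+1 l).
Proof.
move=> ln; rewrite (bdetE _ _ _ ln) (fdetE _ ln).
set A := \matrix_(i, j) _.
have AE i j : A i j = if j == 0 :> nat then g (x :: l)`_i else k (x :: l)`_i (x :: l)`_j.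
  by rewrite mxE.
rewrite (expand_det_row A ord0) big_ord_recl; congr (_ + _).
  rewrite mxE /= /cofactor expr0 mul1r; congr (_ * \det _).
  by apply/matrixP => i j; rewrite !mxE.
rewrite -sumrN; apply: eq_bigr => j _.
case: n ln A AE j => [|n] ln A AE j; first by case: j.
have jl : (j < size l)%N by rewrite ln ltn_ord.
have sz : size (take j l ++ drop j.+1 l) = n.
  by rewrite size_cat size_take jl size_drop ln subSS subnKC// -ltnS ltn_ord.
rewrite AE /= -mulrN; congr (_ * _).
rewrite (bdetE _ _ _ sz) /cofactor add0n.
set q := l`_j :: _; set B := \matrix_(i, j) _.
have q0 : q`_0 = l`_j by [].
have qS i : q`_i.+1 = l`_(bump j i) by rewrite /= nth_rem.
(* Moving row [j] to the top is a cycle of sign [(-1)^j], against the cofactor sign [(-1)^(j+1)];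
   the product is the minus sign of the statement. *)
have -> : row' ord0 (col' (lift ord0 j) A) = row_perm (lift_perm j ord0 1) B.
  apply/matrixP => i m; rewrite !mxE AE /=.
  have -> : q`_(lift_perm j ord0 1 i) = l`_i.
    case: (unliftP j i) => [i' ->|->]; last by rewrite lift_perm_id.
    by rewrite lift_perm_lift perm1 lift0 qS.
  case: m => -[|m] mn /=; first by [].
  have -> : bump (bump 0 j) m.+1 = (bump j m).+1 by rewrite /bump /= !add1n ltnS addnS.
  by rewrite nth_rem.
rewrite row_permE det_mulmx det_perm odd_lift_perm odd_perm1 addbF /= addbF.
rewrite exprS mulN1r mulNr mulrA; congr (- _).
by rewrite -[X in X * _ * _]signr_odd -signr_addb addbb expr0 mul1r.
Qed.

End bordered_determinants.

(** * The Fredholm series and its Taylor coefficients in the parameter *)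

Section fredholm_series.
Context {R : realType}.
Variables (T M lam : R) (k : R -> R -> R).
Hypotheses (T0 : 0 <= T) (M1 : 1 <= M) (lam1 : `|lam| <= 1).
Hypothesis kc : uc2 (- T) T (- T) T k.
Hypothesis kM : forall x y, `|x| <= T -> `|y| <= T -> `|k x y| <= M.
Implicit Types (g w : R -> R) (t x y : R) (n : nat).

Let M0 : 0 <= M. Proof. exact: le_trans M1. Qed.
Let M0' : 0 < M. Proof. exact: lt_le_trans M1. Qed.

Let kex : exists2 M : R, 0 < M & forall x y, `|x| <= T -> `|y| <= T -> `|k x y| <= M.
Proof. by exists M. Qed.

Lemma nice_fdet n : nice T n (fdet k).
Proof.
apply: nice_ext (nice_det (A := fun i j s => k s`_i s`_j) _) => [s sn|i j].
  by rewrite (fdetE _ sn).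
exact: nice_nth2.
Qed.

Lemma nice_bdet n g : uc (- T) T g -> nice T n.+1 (fun l => bdet k g (head 0 l) (behead l)).
Proof.
move=> gc.
apply: nice_ext (nice_det (m := n.+1) (A := fun i j s =>
  if j == 0 :> nat then g s`_i else k s`_i s`_j) _) => [[|x s]//= [sn]|i j].
  by rewrite (bdetE _ _ _ sn).
by case: eqP => _; [exact: nice_nth|exact: nice_nth2].
Qed.

Lemma nice_bdet_l n g x : uc (- T) T g -> `|x| <= T -> nice T n (bdet k g x).
Proof. by move=> gc xT; have := nice_cons xT (nice_bdet n gc). Qed.

Lemma det_hadamard n (A : 'M[R]_n) : (forall i j, `|A i j| <= M) ->
  `|\det A| <= hadamard_const M n.
Proof. by move=> /hadamard_bound H; rewrite -sqrtr_sqr ler_wsqrtr. Qed.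

Lemma fdet_bound n l : size l = n -> boxed T l -> `|fdet k l| <= hadamard_const M n.
Proof.
by move=> ln lT; rewrite (fdetE _ ln); apply: det_hadamard => i j; rewrite mxE kM.
Qed.

Lemma bdet_bound g x n l : (forall y, `|y| <= T -> `|g y| <= M) -> `|x| <= T ->
  size l = n -> boxed T l -> `|bdet k g x l| <= hadamard_const M n.+1.
Proof.
move=> gM xT ln lT; rewrite (bdetE _ _ _ ln); apply: det_hadamard => i j; rewrite mxE.
by have xl := boxed_cons xT lT; case: eqP => _; [exact: gM|exact: kM].
Qed.

Section fixed_endpoint.
Variable t : R.
Hypothesis tP : - T <= t <= T.

Let tl : - T <= t. Proof. by case/andP: tP. Qed.
Let tr : t <= T. Proof. by case/andP: tP. Qed.

Definition fnum n := iint T t n (fdet k).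
Definition bnum g x n := iint T t n (bdet k g x).

Lemma bnum_uc g n : uc (- T) T g -> uc (- T) T (fun x => bnum g x n).
Proof. by move=> gc; have := uc_iint T0 tP (nice_bdet n gc). Qed.

Lemma kr_uc x : `|x| <= T -> uc (- T) T (k x).
Proof. by rewrite ler_norml => xT; exact: uc2_r kc xT. Qed.

Lemma kl_uc y : `|y| <= T -> uc (- T) T (k^~ y).
Proof. by rewrite ler_norml => yT; exact: uc2_l kc yT. Qed.

(** Integrated form of [bdet_expand]: the [n] terms of the sum have the same integral, because
    [iint_pick] lets the distinguished variable be integrated last. *)
Lemma bnum_rec g x n : uc (- T) T g -> `|x| <= T ->
  bnum g x n = g x * fnum n - n%:R * itg (- T) t (fun y => k x y * bnum g y n.-1).
Proof.
move=> gc xT; case: n => [|n].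
  by rewrite /bnum /fnum /= (@bdet_expand _ k g x 0 [::])// big_ord0 mul0r.
have nk : nice T n.+1 (fun l => k x (head 0 l) * bdet k g (head 0 l) (behead l)).
  apply: niceM; last exact: nice_bdet.
  by apply: nice_ext (nice_nth n.+1 0 (kr_uc xT)) => -[].
have nj (j : 'I_n.+1) : nice T n.+1 (fun l => k x l`_j * bdet k g l`_j (take j l ++ drop j.+1 l)).
  apply: niceM; first by apply: nice_nth; exact: kr_uc.
  apply: (@nice_map _ T _ _ _ (fun l => l`_j :: (take j l ++ drop j.+1 l)) (nice_bdet n gc)).
  - move=> s sn; rewrite /= size_cat size_take sn ltn_ord size_drop sn subSS subnKC//.
    by rewrite -ltnS ltn_ord.
  - by move=> s sn sT [|i] /=; [exact: sT|rewrite nth_rem ?sn//; exact: sT].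
  - by move=> d s l d0 sn ln sl [|i] /=; [exact: sl|rewrite !nth_rem ?sn ?ln//; exact: sl].
rewrite /bnum (@eq_iint _ T t n.+1 _ (fun l => g x * fdet k l -
    \sum_(j < n.+1) k x l`_j * bdet k g l`_j (take j l ++ drop j.+1 l))); last first.
  by move=> l ln; rewrite (bdet_expand _ _ _ ln).
rewrite iintB//; [|by apply: niceZ; exact: nice_fdet|exact: nice_sum].
rewrite iintZ//; last exact: nice_fdet.
congr (_ - _); rewrite iint_sum//.
rewrite (eq_bigr (fun=> itg (- T) t (fun y => iint T t n (fun l => k x y * bdet k g y l)))).
  rewrite sumr_const card_ord -[LHS]mulr_natl; congr (_ * _).
  apply: itg_eq => y yP /=; rewrite iintZ//; apply: nice_bdet_l => //.
  exact: itv_norm yP.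
move=> j _; rewrite (iint_pick (h := fun y l => k x y * bdet k g y l) T0 tP _ nk)//.
by rewrite -ltnS ltn_ord.
Qed.

Lemma fnum_trace n : fnum n.+1 = itg (- T) t (fun x => bnum (k^~ x) x n).
Proof. by apply: itg_eq => x _; apply: eq_iint => l _; rewrite fdet_cons. Qed.

Lemma fnum_trace_uc n : uc (- T) t (fun x => bnum (k^~ x) x n).
Proof.
apply: (@uc_eq _ _ _ (fun x => iint T t n (fun l => fdet k (x :: l)))).
  by move=> x _; apply: eq_iint => l _; rewrite fdet_cons.
by apply: uc_sub (uc_iint T0 tP (nice_fdet n.+1)).
Qed.

(** The rate 1/4 leaves the rate 1/2 of [geo] after multiplication by [fcoef], which is at most
    [2 ^+ n]. *)
Lemma hadamard_const_decay4 : {C : R | 0 <= C &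
  forall n, (2 * T) ^+ n * hadamard_const M n.+1 / n`!%:R <= C * 4^-1 ^+ n}.
Proof.
apply: cid2; apply: hadamard_const_decay => //; first by rewrite mulr_ge0.
Qed.

Definition fconst := s2val hadamard_const_decay4.

Lemma fconst_ge0 : 0 <= fconst.
Proof. exact: (s2valP hadamard_const_decay4). Qed.

Lemma fconstP n : (2 * T) ^+ n * hadamard_const M n.+1 / n`!%:R <= fconst * 4^-1 ^+ n.
Proof. exact: (s2valP' hadamard_const_decay4). Qed.

Lemma bnum_bound g x n : uc (- T) T g -> (forall y, `|y| <= T -> `|g y| <= M) -> `|x| <= T ->
  `|bnum g x n / n`!%:R| <= fconst * 4^-1 ^+ n.
Proof.
move=> gc gM xT; apply: le_trans (fconstP n).
rewrite normrM [X in _ * X]ger0_norm ?invr_ge0// ler_wpM2r ?invr_ge0//.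
apply: iint_bound => //; first exact: nice_bdet_l.
by move=> l ln lT; exact: bdet_bound.
Qed.

Lemma fnum_bound n : `|fnum n / n`!%:R| <= fconst * 4^-1 ^+ n.
Proof.
apply: le_trans (fconstP n).
rewrite normrM [X in _ * X]ger0_norm ?invr_ge0// ler_wpM2r ?invr_ge0//.
apply: iint_bound => //; first exact: nice_fdet.
move=> l ln lT; apply: le_trans (hadamard_const_ge _ M1); exact: fdet_bound.
Qed.

(** The coefficient of [h ^+ j] in [(lam + h) ^+ n]. *)
Definition fcoef n j := 'C(n, j)%:R * lam ^+ (n - j).

Lemma fcoef_bound n j : `|fcoef n j| <= 2 ^+ n.
Proof.
rewrite /fcoef normrM normrX ger0_norm// -[X in _ <= X]mulr1 ler_pM ?exprn_ge0//.
  rewrite -natrX ler_nat; have [nj|jn] := ltnP n j; first by rewrite bin_small.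
  rewrite -[X in (_ <= X ^ n)%N]/(1 + 1)%N expnDn (bigD1 (Ordinal (jn : (j < n.+1)%N)))//=.
  by rewrite !exp1n !muln1 leq_addr.
by rewrite exprn_ile1.
Qed.

Lemma fgeo (a : nat -> R) j : (forall n, `|a n / n`!%:R| <= fconst * 4^-1 ^+ n) ->
  geo fconst (fun n => fcoef n j * (a n / n`!%:R)).
Proof.
move=> H n; rewrite normrM (@le_trans _ _ (2 ^+ n * (fconst * 4^-1 ^+ n)))//.
  by rewrite ler_pM ?fcoef_bound.
rewrite mulrCA -exprMn (_ : 2 * 4^-1 = 2^-1 :> R)//; by field.
Qed.

(* dser j and bser g j are the j-th Taylor coefficients at lam of the Fredholm
   determinant and of its bordered variant *)
Definition dser j := gsum (fun n => fcoef n j * (fnum n / n`!%:R)).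
Definition bser g j x := gsum (fun n => fcoef n j * (bnum g x n / n`!%:R)).

Lemma bser_uc g j : uc (- T) T g -> (forall y, `|y| <= T -> `|g y| <= M) ->
  uc (- T) T (bser g j).
Proof.
move=> gc gM; apply: (gsum_uc fconst_ge0) => [n|x].
  apply: ucZ; apply: (@uc_eq _ _ _ (fun x => n`!%:R^-1 * bnum g x n)).
    by move=> x _; rewrite mulrC.
  by apply: ucZ; exact: bnum_uc.
by rewrite -ler_norml => xT; apply: fgeo => n; exact: bnum_bound.
Qed.

Lemma bser_bound g j x : uc (- T) T g -> (forall y, `|y| <= T -> `|g y| <= M) -> `|x| <= T ->
  `|bser g j x| <= 2 * fconst.
Proof.
move=> gc gM xT; apply: gsum_bound; first exact: fconst_ge0.
by apply: fgeo => n; exact: bnum_bound.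
Qed.

Lemma fcoefS m j : fcoef m.+1 j = lam * fcoef m j + (if j is j'.+1 then fcoef m j' else 0).
Proof.
case: j => [|j]; first by rewrite /fcoef !bin0 !subn0 exprS addr0; ring.
rewrite /fcoef binS natrD subSS mulrDl; congr (_ + _).
have [jm|mj] := ltnP j m; last by rewrite bin_small// !mul0r mulr0.
by rewrite -[(m - j)%N]prednK ?subn_gt0// subnS exprS; ring.
Qed.

(** With [U(mu)] the bordered series and [D(mu)] the determinant at the parameter [mu], [bnum_rec]
    sums to [U(mu) = g D(mu) - mu int k U(mu)]. This is the coefficient of order [j] about [lam];
    writing [mu = lam + h] brings in the order [j - 1]. *)
Lemma bser_eq g j x : uc (- T) T g -> (forall y, `|y| <= T -> `|g y| <= M) -> `|x| <= T ->
  bser g j x = g x * dser j - itg (- T) t (fun y => k x y *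
    (lam * bser g j y + (if j is j'.+1 then bser g j' y else 0))).
Proof.
move=> gc gM xT.
pose I m := itg (- T) t (fun y => k x y * (bnum g y m / m`!%:R)).
have kxc : uc (- T) t (k x) by apply: uc_sub (kr_uc xT).
have bc m : uc (- T) t (fun y => bnum g y m / m`!%:R).
  apply: (@uc_eq _ _ _ (fun x => m`!%:R^-1 * bnum g x m)); first by move=> *; rewrite mulrC.
  by apply: ucZ; apply: uc_sub (bnum_uc m gc).
have kbc m : uc (- T) t (fun y => k x y * (bnum g y m / m`!%:R)) by exact: ucM.
(* The part of the [n]-th term coming from the integral in [bnum_rec]; since [a 0 = 0] the index can
   be shifted to match [bnum g y m]. *)
pose a n := fcoef n j * (n%:R / n`!%:R * itg (- T) t (fun y => k x y * bnum g y n.-1)).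
have aE n : fcoef n j * (bnum g x n / n`!%:R) =
    g x * (fcoef n j * (fnum n / n`!%:R)) + - a n.
  by rewrite bnum_rec// /a; ring.
have aS m : a m.+1 = itg (- T) t (fun y => k x y * (fcoef m.+1 j * (bnum g y m / m`!%:R))).
  rewrite /a /= factS natrM -itgZ; last first.
    by apply: ucM => //; apply: uc_sub (bnum_uc m gc).
  rewrite -itgZ; last first.
    by apply: ucZ; apply: ucM => //; apply: uc_sub (bnum_uc m gc).
  apply: itg_eq => y _; field.
  by rewrite pnatr_eq0 -lt0n fact_gt0 nat1r pnatr_eq0.
have gd : geo fconst (fun n => fcoef n j * (fnum n / n`!%:R)) by apply: fgeo; exact: fnum_bound.
have gb : geo fconst (fun n => fcoef n j * (bnum g x n / n`!%:R)).
  by apply: fgeo => n; exact: bnum_bound.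
pose D := `|g x| * fconst + fconst.
have D0 : 0 <= D by rewrite addr_ge0 ?mulr_ge0// fconst_ge0.
have ga : geo D a.
  move=> n; have -> : a n = g x * (fcoef n j * (fnum n / n`!%:R)) - fcoef n j * (bnum g x n / n`!%:R).
    by rewrite aE opprD opprK addrA subrr add0r.
  rewrite (le_trans (ler_normB _ _))// mulrDl lerD//.
  by rewrite normrM -(mulrA _ fconst) ler_wpM2l.
have gz : geo (`|g x| * fconst) (fun n => g x * (fcoef n j * (fnum n / n`!%:R))).
  by move=> n; rewrite normrM -(mulrA _ fconst) ler_wpM2l.
have gna : geo D (fun n => - a n) by move=> n; rewrite normrN.
rewrite /bser (eq_gsum aE) (gsumD _ D0 gz gna) ?mulr_ge0 ?fconst_ge0//.
rewrite (gsumZ _ fconst_ge0 gd); congr (_ + _).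
rewrite (eq_gsum (g := fun n => -1 * a n)) => [|n]; last by rewrite mulN1r.
rewrite (gsumZ _ D0 ga) mulN1r; congr (- _).
rewrite (gsum_recl D0 ga) {1}/a mul0r mul0r mulr0 add0r (eq_gsum aS).
rewrite -(@gsum_itg _ (- T) t (M * (2 * fconst))) //; last 3 first.
- by rewrite !mulr_ge0// fconst_ge0.
- by move=> n; apply: ucM => //; exact: ucZ.
- move=> y yP; have yT := itv_norm tP yP; move=> n; rewrite normrM -mulrA.
  apply: ler_pM => //; first exact: kM.
  have h : geo fconst (fun n => fcoef n j * (bnum g y n / n`!%:R)).
    by apply: fgeo => i; exact: bnum_bound.
  rewrite fcoefS mulrDl (le_trans (ler_normD _ _))// mulr2n !mulrDl !mul1r lerD//.
    by rewrite -mulrA normrM (le_trans (ler_wpM2r _ lam1))// mul1r.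
  case: j {aE aS gd gb ga gna gz h a} => [|j].
    by rewrite mul0r normr0 mulr_ge0 ?fconst_ge0// exprn_ge0// invr_ge0.
  have h : geo fconst (fun n => fcoef n j * (bnum g y n / n`!%:R)).
    by apply: fgeo => i; exact: bnum_bound.
  exact: h.
apply: itg_eq => y yP; have yT := itv_norm tP yP.
have h i : geo fconst (fun n => fcoef n i * (bnum g y n / n`!%:R)).
  by apply: fgeo => ?; exact: bnum_bound.
have gl : geo (`|lam| * fconst) (fun n => lam * (fcoef n j * (bnum g y n / n`!%:R))).
  by move=> n; rewrite normrM -(mulrA _ fconst) ler_wpM2l//; exact: h.
have gl0 : 0 <= `|lam| * fconst by rewrite mulr_ge0// fconst_ge0.
pose b n := (if j is j'.+1 then fcoef n j' else 0) * (bnum g y n / n`!%:R).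
have gb' : geo fconst b.
  move=> n; rewrite /b; case: (j) => [|j']; last exact: h.
  by rewrite mul0r normr0 mulr_ge0 ?fconst_ge0// exprn_ge0// invr_ge0.
have E n : fcoef n.+1 j * (bnum g y n / n`!%:R) =
    lam * (fcoef n j * (bnum g y n / n`!%:R)) + b n.
  by rewrite fcoefS /b [LHS]mulrDl; congr (_ + _); rewrite -[LHS]mulrA.
rewrite (eq_gsum (g := fun n => k x y * (lam * (fcoef n j * (bnum g y n / n`!%:R)) + b n)));
  last by move=> n; rewrite E.
have gs : geo (`|lam| * fconst + fconst) (fun n => lam * (fcoef n j * (bnum g y n / n`!%:R)) + b n).
  by move=> n; apply: (le_trans (ler_normD _ _)); rewrite [X in _ <= X]mulrDl; apply: lerD; [exact: gl|exact: gb'].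
rewrite (gsumZ _ _ gs) ?addr_ge0 ?fconst_ge0//; congr (_ * _).
rewrite (gsumD gl0 fconst_ge0 gl gb') (gsumZ _ fconst_ge0 (h j)); congr (_ + _).
rewrite /b; case: (j) => [|j'] //.
rewrite (eq_gsum (g := fun n => 0 * 0)) => [|n]; last by rewrite !mul0r.
by rewrite (@gsumZ _ 0) ?mul0r// => n; rewrite normr0 mul0r.
Qed.

(** Coefficient form of Fredholm's identity: the derivative of the determinant is the integral over
    [x] of the bordered series for [g = k(., x)] at [x]. Termwise it is [fnum_trace] with
    [(j+1) C(n+1, j+1) = (n+1) C(n, j)]. *)
Lemma dser_trace j : j.+1%:R * dser j.+1 = itg (- T) t (fun x => bser (k^~ x) j x).
Proof.
have gd : geo fconst (fun n => fcoef n j.+1 * (fnum n / n`!%:R)) by apply: fgeo; exact: fnum_bound.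
have gdj : geo (j.+1%:R * fconst) (fun n => j.+1%:R * (fcoef n j.+1 * (fnum n / n`!%:R))).
  by move=> n; rewrite normrM -mulrA [X in X * _]ger0_norm// ler_wpM2l.
rewrite /dser -(gsumZ _ fconst_ge0 gd).
rewrite (gsum_recl _ gdj) ?mulr_ge0 ?fconst_ge0//.
rewrite {1}/fcoef bin0n !mul0r mulr0 add0r.
rewrite (@gsum_itg _ (- T) t fconst) //; last 3 first.
- exact: fconst_ge0.
- move=> n; apply: ucZ; apply: (@uc_eq _ _ _ (fun x => n`!%:R^-1 * bnum (k^~ x) x n)).
    by move=> *; rewrite mulrC.
  by apply: ucZ; exact: fnum_trace_uc.
- move=> x xP; have xT := itv_norm tP xP; apply: fgeo => n; apply: bnum_bound => //.
    exact: kl_uc.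
  by move=> y yT; exact: kM.
apply: eq_gsum => n.
have f0 m : m`!%:R != 0 :> R by rewrite pnatr_eq0 -lt0n fact_gt0.
rewrite (_ : itg _ _ _ = fcoef n j * (fnum n.+1 / n`!%:R)); last first.
  transitivity (itg (- T) t (fun x => (fcoef n j / n`!%:R) * bnum (k^~ x) x n)).
    by apply: itg_eq => x _; ring.
  by rewrite itgZ; [rewrite fnum_trace; ring|exact: fnum_trace_uc].
rewrite /fcoef subSS factS natrM.
have E : j.+1%:R * 'C(n.+1, j.+1)%:R = n.+1%:R * 'C(n, j)%:R :> R.
  by rewrite -!natrM -mul_bin_diag.
rewrite (_ : j.+1%:R * ('C(n.+1, j.+1)%:R * lam ^+ (n - j) * (fnum n.+1 / (n.+1%:R * n`!%:R))) =
  (j.+1%:R * 'C(n.+1, j.+1)%:R) * lam ^+ (n - j) * (fnum n.+1 / (n.+1%:R * n`!%:R))); last by ring.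
by rewrite E; field; rewrite f0 nat1r pnatr_eq0.
Qed.

Lemma gsum_sum J (F : nat -> nat -> R) : (forall j, geo fconst (F j)) ->
  gsum (fun n => \sum_(j < J) (- lam) ^+ j * F j n) = \sum_(j < J) (- lam) ^+ j * gsum (F j).
Proof.
move=> H; elim: J => [|J IH].
  rewrite big_ord0 (eq_gsum (g := fun=> 0 * 0)) => [|n]; last by rewrite big_ord0 mul0r.
  by rewrite (@gsumZ _ 0) ?mul0r// => n; rewrite normr0 mul0r.
rewrite big_ord_recr/= -IH (eq_gsum (fun n => big_ord_recr _ _)) /=.
have h1 i : geo fconst (fun n => (- lam) ^+ i * F i n).
  move=> n; rewrite normrM -[X in _ <= X]mul1r ler_pM//; last exact: H.
  by rewrite normrX normrN exprn_ile1.
have f0 := fconst_ge0.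
have hJ : geo (J%:R * fconst) (fun n => \sum_(j < J) (- lam) ^+ j * F j n).
  move=> n; elim: (J) => [|m IHm]; first by rewrite big_ord0 normr0 !mul0r.
  rewrite big_ord_recr/= (le_trans (ler_normD _ _))// -natr1 !mulrDl mul1r lerD//.
  exact: h1.
by rewrite (gsumD _ _ hJ (h1 J)) ?mulr_ge0// (gsumZ _ f0 (H J)).
Qed.

(* the Taylor series at lam of the Fredholm determinant, evaluated at 0 *)
Lemma dser_taylor J : (0 < J)%N ->
  `|\sum_(j < J) (- lam) ^+ j * dser j - 1| <= 2 * fconst * 2^-1 ^+ J.
Proof.
move=> J0; have f0 := fconst_ge0.
pose c n := fnum n / n`!%:R.
have hc n : `|c n| <= fconst * 4^-1 ^+ n := fnum_bound n.
have gc j : geo fconst (fun n => fcoef n j * c n) by apply: fgeo.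
rewrite /dser -(gsum_sum _ gc).
(* The Taylor polynomial of degree below [J] of [mu ^+ n] about [lam], taken at [mu = 0]. It equals
   [0 ^+ n] when [n < J], so the first [J] terms of the series add up to 1. *)
pose b n := \sum_(j < J) (- lam) ^+ j * fcoef n j.
rewrite (eq_gsum (g := fun n => b n * c n)) => [|n]; last first.
  by rewrite /b mulr_suml; apply: eq_bigr => j _; rewrite mulrA.
have binom n : \sum_(j < n.+1) (- lam) ^+ j * fcoef n j = 0 ^+ n.
  rewrite -[in RHS](subrr lam) exprDn; apply: eq_bigr => j _.
  by rewrite /fcoef -mulr_natl; ring.
have bsmall n : (n < J)%N -> b n = 0 ^+ n.
  move=> nJ; rewrite -binom /b (big_ord_widen J (fun j => (- lam) ^+ j * fcoef n j) nJ).
  rewrite [RHS]big_mkcond; apply: eq_bigr => j _; case: ltnP => // nj.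
  by rewrite /fcoef bin_small// mul0r mulr0.
have bbig n : `|b n| <= 2 ^+ n.
  have [nJ|Jn] := ltnP n J.
    by rewrite bsmall// expr0n; case: eqP => _; rewrite ?normr1 ?normr0 ?exprn_ege1 ?exprn_ge0// ler1n.
  apply: (@le_trans _ _ (\sum_(j < J) 'C(n, j)%:R)).
    apply: le_trans (ler_norm_sum _ _ _) _; apply: ler_sum => j _.
    rewrite normrM normrX normrN /fcoef normrM normrX [`|_%:R|]ger0_norm//.
    by rewrite mulrCA ler_piMr// mulr_ile1// exprn_ile1.
  rewrite -natr_sum -natrX ler_nat -[X in (_ <= X ^ n)%N]/(1 + 1)%N expnDn.
  rewrite (big_ord_widen n.+1 (fun j => 'C(n, j)) (leqW Jn)) big_mkcond.
  by apply: leq_sum => j _; rewrite !exp1n !muln1; case: ifP.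
have gh : geo fconst (fun n => b n * c n).
  move=> n; rewrite normrM (@le_trans _ _ (2 ^+ n * (fconst * 4^-1 ^+ n)))//.
    by rewrite ler_pM.
  rewrite mulrCA -exprMn (_ : 2 * 4^-1 = 2^-1 :> R)//; by field.
have E1 : series (fun n => b n * c n) J = 1.
  rewrite /series/= big_mkord -(prednK J0) big_ord_recl /= big1 => [|i _].
    rewrite bsmall// expr0 addr0 mul1r /c /fnum /= /fdet det_mx00 fact0.
    by rewrite divr1.
  have iJ : (bump 0 i < J)%N by rewrite /bump/= add1n -ltn_predRL ltn_ord.
  by rewrite bsmall// expr0n mul0r.
by have := gsum_tail f0 gh J; rewrite E1.
Qed.

Hypothesis inj : forall w, uc (- T) T w ->
  (forall x, `|x| <= T -> w x + lam * itg (- T) t (fun y => k x y * w y) = 0) ->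
  forall x, `|x| <= T -> w x = 0.

(** If the determinant vanishes, the bordered series solves the homogeneous equation, hence is 0 for
    every [g]; by [dser_trace] the next Taylor coefficient vanishes, which makes the next equation
    homogeneous, and so on. With all coefficients 0, [dser_taylor] would give [1 < 1]. *)
Lemma dser_neq0 : dser 0 != 0.
Proof.
apply/eqP => d0.
have step j : dser j = 0 -> (forall g x, uc (- T) T g -> (forall y, `|y| <= T -> `|g y| <= M) ->
     `|x| <= T -> (if j is j'.+1 then bser g j' x else 0) = 0) ->
   forall g x, uc (- T) T g -> (forall y, `|y| <= T -> `|g y| <= M) -> `|x| <= T -> bser g j x = 0.
  move=> dj0 prev g x gc gM; apply: inj; first exact: bser_uc.
  move=> {}x xT; rewrite bser_eq// dj0 mulr0 sub0r -itgZ; last first.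
    by apply: ucM; [apply: uc_sub (kr_uc xT)|apply: uc_sub (bser_uc j gc gM)].
  apply/eqP; rewrite addrC subr_eq0; apply/eqP; apply: itg_eq => y yP.
  by rewrite prev// ?addr0 1?mulrCA//; exact: itv_norm yP.
have H j : dser j = 0 /\ forall g x, uc (- T) T g -> (forall y, `|y| <= T -> `|g y| <= M) ->
    `|x| <= T -> bser g j x = 0.
  elim: j => [|j [dj IH]]; first by split=> //; exact: step.
  have dS : dser j.+1 = 0.
    apply/eqP; rewrite -(mulrI_eq0 _ (mulfI (_ : j.+1%:R != 0 :> R))) ?pnatr_eq0//.
    rewrite dser_trace; apply/eqP; rewrite -(itg0 (- T) t); apply: itg_eq => x xP.
    have xT := itv_norm tP xP; apply: IH => //; first exact: kl_uc.
    by move=> y yT; exact: kM.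
  by split=> //; apply: step.
have [J hJ] := half_small (2 * fconst) (ltr01 : 0 < (1 : R)).
have hJ' : 2 * fconst * 2^-1 ^+ J.+1 < 1.
  apply: le_lt_trans hJ; rewrite exprS mulrCA ler_piMl//.
    by rewrite !mulr_ge0 ?fconst_ge0// exprn_ge0// invr_ge0.
  by rewrite invf_le1// ler1n.
have := le_lt_trans (dser_taylor (ltn0Sn J)) hJ'.
rewrite big1 => [|j _]; last by have [-> _] := H j; rewrite mulr0.
by rewrite sub0r normrN normr1 ltxx.
Qed.

Lemma bser0_eq g x : uc (- T) T g -> (forall y, `|y| <= T -> `|g y| <= M) -> `|x| <= T ->
  bser g 0 x + lam * itg (- T) t (fun y => k x y * bser g 0 y) = g x * dser 0.
Proof.
move=> gc gM xT; rewrite {1}bser_eq// -itgZ; last first.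
  by apply: ucM; [apply: uc_sub (kr_uc xT)|apply: uc_sub (bser_uc 0 gc gM)].
rewrite (@itg_eq _ _ _ (fun y => lam * (k x y * bser g 0 y))
  (fun y => k x y * (lam * bser g 0 y + 0))); last by move=> y _; ring.
by rewrite subrK.
Qed.

End fixed_endpoint.
End fredholm_series.

(** * Resolvents of the truncated operators *)

Section one_sided_calculus.
Context {R : realType}.
Implicit Types (a b c d e s t x y z : R) (f g h : R -> R).

Lemma itg_osc a b h s t c e : uc a b h -> a <= s <= b -> a <= t <= b ->
  (forall y, Num.min s t <= y <= Num.max s t -> `|h y - c| <= e) ->
  `|itg a t h - itg a s h - (t - s) * c| <= e * `|t - s|.
Proof.
move=> hu; wlog st : s t / s <= t => [hw sP tP H|].
  have [st|/ltW ts] := leP s t; first exact: hw.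
  rewrite (distrC t) -[X in X <= _]normrN.
  rewrite (_ : - (_ - _ - _) = itg a s h - itg a t h - (s - t) * c); last by ring.
  by apply: hw => // y; rewrite minC maxC; apply: H.
move=> /andP[as_ sb] /andP[at_ tb]; rewrite min_l// max_r// => H.
have ust : uc s t h by exact: uc_sub hu.
rewrite (@itg_cat _ a s t)//; last exact: uc_sub hu.
rewrite (addrC (itg a s h)) addrK -itg_cst// -itgB//; last exact: uc_cst.
rewrite (ger0_norm (x := t - s)) ?subr_ge0// mulrC; apply: itg_bound => //.
by apply: ucB => //; exact: uc_cst.
Qed.

Lemma dw_lip a b f x l : dw a b f x l -> exists M d, [/\ 0 < M, 0 < d &
  forall y, a <= y <= b -> `|y - x| < d -> `|f y - f x| <= M * `|y - x|].
Proof.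
move=> /(_ 1 ltr01)[d d0 hd]; exists (1 + `|l|), d; split=> //.
move=> y yab yx; rewrite mulrDl -normrM (mulrC l).
rewrite (_ : f y - f x = (f y - f x - (y - x) * l) + (y - x) * l); last by ring.
by rewrite (le_trans (ler_normD _ _))// lerD// hd.
Qed.

Lemma dw_ext a b f g x l : (forall y, a <= y <= b -> f y = g y) -> a <= x <= b ->
  dw a b f x l -> dw a b g x l.
Proof.
by move=> E xab H e /H[d d0 hd]; exists d => // y yab yx; rewrite -!E//; exact: hd.
Qed.

Lemma dw_cst a b c x : dw a b (fun=> c) x 0.
Proof. by move=> e e0; exists 1 => // y _ _; rewrite subrr mulr0 subr0 normr0 mulr_ge0// ltW. Qed.

Lemma dwD a b f g x l k : dw a b f x l -> dw a b g x k -> dw a b (fun y => f y + g y) x (l + k).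
Proof.
move=> F G; have N : dw a b (fun y => - g y) x (- k).
  have := dwB (dw_cst a b 0 x) G; rewrite sub0r; congr dw.
  by apply/funext => y; rewrite sub0r.
have := dwB F N; rewrite opprK; congr dw.
by apply/funext => y; rewrite opprK.
Qed.

Lemma dwM a b f g x l k : dw a b f x l -> dw a b g x k ->
  dw a b (fun y => f y * g y) x (l * g x + f x * k).
Proof.
move=> hF hG e e0.
have [M [d3 [M0 d30 h3]]] := dw_lip hF.
have [N [d4 [N0 d40 h4]]] := dw_lip hG.
have eA (A : R) : 0 <= A -> 0 < e / 3 / (A + 1) by move=> ?; rewrite !divr_gt0// ltr_wpDl.
have [d1 d10 h1] := hF _ (eA _ (normr_ge0 (g x))).
have [d2 d20 h2] := hG _ (eA _ (normr_ge0 (f x))).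
exists (Num.min (Num.min d1 d2) (Num.min (Num.min d3 d4) (e / 3 / (M * N)))).
  by rewrite !lt_min d10 d20 d30 d40 !divr_gt0// mulr_gt0.
move=> y yab; rewrite !lt_min => /andP[/andP[hd1 hd2] /andP[/andP[hd3 hd4] hd5]].
rewrite (_ : _ - _ = (f y - f x - (y - x) * l) * g x + f x * (g y - g x - (y - x) * k) +
  (f y - f x) * (g y - g x)); last by ring.
have red (A : R) : 0 <= A -> e / 3 / (A + 1) * A <= e / 3.
  move=> A0; rewrite -mulrA ger_pMr ?divr_gt0// mulrC ler_pdivrMr ?mul1r ?lerDl//.
  by rewrite ltr_wpDl.
have b1 : `|f y - f x - (y - x) * l| * `|g x| <= e / 3 * `|y - x|.
  apply: (@le_trans _ _ (e / 3 / (`|g x| + 1) * `|y - x| * `|g x|)).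
    by rewrite ler_wpM2r// h1.
  by rewrite mulrAC ler_wpM2r ?red.
have b2 : `|f x| * `|g y - g x - (y - x) * k| <= e / 3 * `|y - x|.
  apply: (@le_trans _ _ (`|f x| * (e / 3 / (`|f x| + 1) * `|y - x|))).
    by rewrite ler_wpM2l// h2.
  by rewrite mulrA (mulrC `|f x|) ler_wpM2r ?red.
have b3 : `|f y - f x| * `|g y - g x| <= e / 3 * `|y - x|.
  apply: (@le_trans _ _ (M * `|y - x| * (N * `|y - x|))).
    by rewrite ler_pM ?h3 ?h4.
  rewrite mulrA ler_wpM2r// mulrAC mulrC -ler_pdivlMr ?mulr_gt0//.
  exact: ltW.
rewrite (le_trans (ler_normD _ _))// (le_trans (lerD (ler_normD _ _) (lexx _)))// !normrM.
lra.
Qed.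

Lemma dwZ a b f x l c : dw a b f x l -> dw a b (fun y => c * f y) x (c * l).
Proof. by move=> /(dwM (dw_cst a b c x)); rewrite mul0r add0r. Qed.

Lemma dw_expR a b f x l : dw a b f x l -> dw a b (fun y => expR (f y)) x (l * expR (f x)).
Proof.
move=> hF e e0; pose E := expR (f x); have E0 : 0 < E by exact: expR_gt0.
have [M [d3 [M0 d30 h3]]] := dw_lip hF.
have [d1 d10 h1] := hF (e / 2 / E) (divr_gt0 (divr_gt0 e0 (ltr0n _ 2)) E0).
exists (Num.min (Num.min d1 d3) (Num.min (2^-1 / M) (e / 2 / (E * 2 * M ^+ 2)))).
  by rewrite !lt_min d10 d30 !divr_gt0// ?invr_gt0// !mulr_gt0// exprn_gt0.
move=> y yab; rewrite !lt_min => /andP[/andP[hd1 hd3] /andP[hd4 hd5]].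
pose u := f y - f x.
have uM : `|u| <= M * `|y - x| by exact: h3.
have u2 : `|u| <= 2^-1 by rewrite (le_trans uM)// mulrC -ler_pdivlMr// ltW.
have -> : expR (f y) = E * expR u by rewrite /E /u -expRD subrKC.
rewrite -/E (_ : _ - _ = E * (expR u - 1 - u) + E * (u - (y - x) * l)); last by rewrite /u; ring.
rewrite (le_trans (ler_normD _ _))// !normrM (gtr0_norm E0).
rewrite (_ : e * _ = e / 2 * `|y - x| + e / 2 * `|y - x|); last by field.
apply: lerD.
  apply: (@le_trans _ _ (E * (2 * (M * `|y - x|) ^+ 2))).
    rewrite ler_pM2l// (le_trans (expR_taylor u2))// ler_pM2l//.
    by rewrite -real_normK ?num_real// lerXn2r ?nnegrE ?mulr_ge0// ltW.
  rewrite exprMn [`|y - x| ^+ 2]expr2 !mulrA ler_wpM2r//.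
  have := ltW hd5; rewrite ler_pdivlMr ?mulr_gt0 ?exprn_gt0//; apply: le_trans.
  by rewrite le_eqVlt; apply/orP; left; apply/eqP; ring.
rewrite (_ : e / 2 * _ = E * (e / 2 / E * `|y - x|)); last by field; rewrite gt_eqF.
by rewrite ler_pM2l// h1.
Qed.

End one_sided_calculus.

(** * The truncated operator on continuous functions *)

Section volterra.
Context {R : realType}.
Variables (T : R) (K : R -> R).
Hypotheses (T0 : 0 < T) (Kc : continuous K) (K0 : forall x, x <= 0 -> K x = 0).
Implicit Types (g h u w V : R -> R) (t x y G : R).

Let T0' : 0 <= T := ltW T0.
Notation k := (fun x y : R => K (x + y)).

Lemma k_uc2 : uc2 (- T) T (- T) T k.
Proof.
move=> e e0; have [d d0 hd] := uc_cont (- (2 * T)) (2 * T) Kc e0.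
exists (d / 2) => [|x x' y y' xP x'P yP y'P xx yy]; first by rewrite divr_gt0.
apply: hd; [lra|lra|].
rewrite (_ : _ - _ = (x - x') + (y - y')); last by ring.
by rewrite (le_lt_trans (ler_normD _ _))// (splitr d) ltrD.
Qed.

Lemma k_bounded : exists2 M, 1 <= M & forall x y, `|x| <= T -> `|y| <= T -> `|k x y| <= M.
Proof.
have [M M0 hM] := uc_bounded (uc_cont (- (2 * T)) (2 * T) Kc).
exists (M + 1); first by rewrite lerDr ltW.
move=> x y; rewrite !ler_norml => xP yP.
have : `|K (x + y)| <= M by apply: hM; lra.
by rewrite ler_norml; lra.
Qed.

Definition kop t u x := itg (- T) t (fun y => K (x + y) * u y).

(** The equation is imposed on all of [[-T, T]] though the operator integrates only up to [t]: the
    values beyond [t] are determined by those before it, and the domain of the unknown does not move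
    with [t]. *)
Definition kinj eps t := forall w, uc (- T) T w ->
  (forall x, `|x| <= T -> w x + eps * kop t w x = 0) -> forall x, `|x| <= T -> w x = 0.

Definition Kbound := s2val (cid2 k_bounded).
Lemma Kbound1 : 1 <= Kbound. Proof. exact: (s2valP (cid2 k_bounded)). Qed.
Lemma KboundP x y : `|x| <= T -> `|y| <= T -> `|K (x + y)| <= Kbound.
Proof. exact: (s2valP' (cid2 k_bounded)). Qed.

Let krow_uc x : `|x| <= T -> uc (- T) T (fun y => K (x + y)).
Proof. by rewrite ler_norml => xT; exact: uc2_r k_uc2 xT. Qed.

Lemma ku_uc x u : `|x| <= T -> uc (- T) T u -> uc (- T) T (fun y => K (x + y) * u y).
Proof. by move=> xT uu; apply: ucM => //; exact: krow_uc. Qed.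

Lemma ku_uct t x u : t <= T -> `|x| <= T -> uc (- T) T u -> uc (- T) t (fun y => K (x + y) * u y).
Proof. by move=> tT xT uu; apply: uc_sub (ku_uc xT uu). Qed.

Lemma ku_uc2 u : uc (- T) T u -> uc2 (- T) T (- T) T (fun x y => K (x + y) * u y).
Proof.
move=> uu; apply: (uc2Mr k_uc2 _ uu) => x y; rewrite -!ler_norml; exact: KboundP.
Qed.

Section fixed_t.
Variable t : R.
Hypothesis tP : - T <= t <= T.
Let tl : - T <= t. Proof. by case/andP: tP. Qed.
Let tr : t <= T. Proof. by case/andP: tP. Qed.

Lemma kop_uc u : uc (- T) T u -> uc (- T) T (kop t u).
Proof. by move=> uu; apply: (uc2_itg tl); apply: uc2_sub (ku_uc2 uu). Qed.

Lemma kopD u w x : uc (- T) T u -> uc (- T) T w -> `|x| <= T ->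
  kop t (fun y => u y + w y) x = kop t u x + kop t w x.
Proof.
move=> uu uw xT; rewrite /kop -itgD; [|exact: ku_uct..].
by apply: itg_eq => y _; rewrite mulrDr.
Qed.

Lemma kopZ c u x : uc (- T) T u -> `|x| <= T -> kop t (fun y => c * u y) x = c * kop t u x.
Proof.
move=> uu xT; rewrite /kop -itgZ; last exact: ku_uct.
by apply: itg_eq => y _; rewrite mulrCA.
Qed.

Lemma kopB u w x : uc (- T) T u -> uc (- T) T w -> `|x| <= T ->
  kop t (fun y => u y - w y) x = kop t u x - kop t w x.
Proof.
move=> uu uw xT; rewrite /kop -itgB; [|exact: ku_uct..].
by apply: itg_eq => y _; rewrite mulrBr.
Qed.

(* by parts: the boundary term at - T vanishes because K does on ]-oo, 0] *)
Lemma kop_primitive V c x : uc (- T) T V -> `|x| <= T ->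
  let u y := c + itg (- T) y V in
  kop t u x = itg (- T) x (fun s => K (s + t)) * u t - itg (- T) x (kop t V).
Proof.
move=> uV xT u; have /andP[xl xr] : - T <= x <= T by rewrite -ler_norml.
(* [x + y] ranges over [[-2T, 2T]]; this primitive of [K] vanishes on [[-2T, 0]] because [K]
   does. *)
pose P (v : R) := itg (- (2 * T)) v K.
pose L y := P (x + y).
have PK (w : R) : - (2 * T) <= w <= 2 * T -> dw (- (2 * T)) (2 * T) P w (K w).
  by move=> wP; apply: dw_itg wP; exact: uc_cont.
have Pneg (w : R) : - (2 * T) <= w <= 0 -> P w = 0.
  by move=> wP; rewrite -(itg0 (- (2 * T)) w); apply: itg_eq => y yP; apply: K0; lra.
have shift z a b : - T <= a -> b <= T -> `|z| <= T -> forall y, a <= y <= b ->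
    dw a b (fun y => P (z + y)) y (K (z + y)).
  rewrite ler_norml => al br zT y yP e e0.
  have [|d d0 hd] := PK (z + y) _ e e0; first by lra.
  exists d => // y' y'P y'y; have := hd (z + y').
  rewrite (_ : z + y' - (z + y) = y' - y); last by ring.
  by apply => //; lra.
have LE y : `|y| <= T -> L y = itg (- T) x (fun s => K (s + y)).
  rewrite ler_norml => yT.
  rewrite (@itg_eq _ _ _ (fun s => K (s + y)) (fun s => K (y + s))) => [|s _]; last by rewrite addrC.
  rewrite -(@ftc2 _ _ _ (fun s => P (y + s)) (fun s => K (y + s)) xl).
  - by rewrite (Pneg (y + - T)) ?subr0 1?addrC//; lra.
  - by apply: uc_sub (krow_uc _) => //; rewrite ler_norml.
  - by move=> s sP; apply: shift => //; rewrite ler_norml.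
have uu : uc (- T) T u.
  apply: (@dw_uc _ _ _ _ V) => y yP; rewrite -[V y]add0r; apply: dwD; first exact: dw_cst.
  exact: dw_itg.
have uL : uc (- T) T L.
  by apply: (@dw_uc _ _ _ _ (fun y => K (x + y))) => y yP; exact: shift.
have uLV : uc (- T) t (fun y => L y * V y) by apply: uc_sub (ucM uL uV).
have uKu : uc (- T) t (fun y => K (x + y) * u y) by exact: ku_uct.
have H : L t * u t = itg (- T) t (fun y => K (x + y) * u y + L y * V y).
  have := @ftc2 _ (- T) t (fun y => L y * u y) (fun y => K (x + y) * u y + L y * V y) tl.
  rewrite (_ : L (- T) = 0) ?mul0r ?subr0; last first.
    by apply: Pneg; rewrite subr_le0 xr mulr2n mulrDl !mul1r opprD lerD2r xl.
  apply; first exact: ucD.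
  move=> y yP; have yT : - T <= y <= T by case/andP: yP => -> /le_trans; apply.
  apply: dwM; first exact: shift.
  rewrite -[V y]add0r; apply: dwD; first exact: dw_cst.
  by apply: (dw_sub (lexx _) tr); exact: dw_itg.
(* Fubini: integrating [K(s + y)] in [s] up to [x] produces [L y]. *)
have -> : itg (- T) x (kop t V) = itg (- T) t (fun y => L y * V y).
  rewrite /kop itg_fubini//; last exact: uc2_sub (ku_uc2 uV).
  apply: itg_eq => y yP; have yT := itv_norm tP yP.
  rewrite LE// -(@itg_eq _ _ _ (fun s => V y * K (s + y))) => [|s _]; last by rewrite mulrC.
  rewrite itgZ 1?mulrC//; apply: (@uc_eq _ _ _ (fun s => K (y + s))) => [s _|].
    by rewrite addrC.
  by apply: uc_sub (krow_uc yT).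
by rewrite -LE ?ler_norml// H itgD// addrK.
Qed.

End fixed_t.
End volterra.

(** * Existence, uniqueness and uniform bounds for the resolvents *)

Section resolvent.
Context {R : realType}.
Variables (T : R) (K : R -> R).
Hypotheses (T0 : 0 < T) (Kc : continuous K).
Hypothesis inj : forall eps t, eps * eps = 1 -> - T <= t <= T -> kinj T K eps t.
Implicit Types (g h u v V : R -> R) (t s x y G eps : R).

Let T0' : 0 <= T. Proof. exact: ltW. Qed.
Notation k := (fun x y : R => K (x + y)).
Notation M := (Kbound T Kc).
Notation kop := (kop T K).
Notation D eps t := (dser T eps k t 0).
Let kc : uc2 (- T) T (- T) T k. Proof. exact: k_uc2. Qed.
Let M1 : 1 <= M. Proof. exact: Kbound1. Qed.
Let M0 : 0 < M. Proof. exact: lt_le_trans M1. Qed.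
Let kM x y : `|x| <= T -> `|y| <= T -> `|k x y| <= M. Proof. exact: KboundP. Qed.

Lemma sqr1_norm eps : eps * eps = 1 -> `|eps| = 1.
Proof.
move=> e2; have : `|eps| ^+ 2 = 1 by rewrite real_normK ?num_real// expr2.
by move=> /eqP; rewrite sqrp_eq1// => /eqP.
Qed.

Let e1 eps : eps * eps = 1 -> `|eps| <= 1. Proof. by move/sqr1_norm ->. Qed.

(** Each coefficient is Lipschitz in the endpoint and the domination does not depend on it, so the
    sum is a uniform limit. *)
Lemma dser_uct eps : eps * eps = 1 -> uc (- T) T (fun t => D eps t).
Proof.
move=> e2; have f0 := fconst_ge0 T0' M1.
apply: (gsum_uc (F := fun n t => fcoef eps n 0 * (fnum T k t n / n`!%:R)) f0) => [n|t tP].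
  apply: ucZ; apply: (@uc_eq _ _ _ (fun t => n`!%:R^-1 * fnum T k t n)) => [t _|].
    by rewrite mulrC.
  apply: ucZ => e e0; have H0 : 0 <= hadamard_const M n by exact: sqrtr_ge0.
  have [C C0 HC] := iint_lip T0' n H0.
  exists (e / (C + 1)) => [|t t' tP t'P]; first by rewrite divr_gt0// ltr_wpDl.
  rewrite ltr_pdivlMr ?ltr_wpDl// => tt.
  rewrite distrC; apply: le_lt_trans (HC (fdet k) t t' _ _ tP t'P) _.
  - exact: nice_fdet M1 kc kM n.
  - by move=> l; exact: fdet_bound kM n l.
  - by rewrite distrC (le_lt_trans _ tt)// mulrC ler_wpM2l// lerDl.
apply: (@fgeo _ _ _ eps T0' M1 (e1 e2) (fnum T k t) 0) => n; exact: (fnum_bound T0' M1 kc kM tP n).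
Qed.

Lemma D_neq0 eps t : eps * eps = 1 -> - T <= t <= T -> D eps t != 0.
Proof.
by move=> e2 tP; apply: (dser_neq0 T0' M1 (e1 e2) kc kM tP) => w uw H; exact: (inj e2 tP uw).
Qed.

Lemma D_away eps : eps * eps = 1 -> exists2 d, 0 < d & forall t, - T <= t <= T -> d <= `|D eps t|.
Proof.
move=> e2.
have H' : {within `[- T, T], continuous (fun t => `|D eps t|)}.
  have H := uc_within (dser_uct e2).
  by move=> x; apply: (cvg_comp _ _ (H x)); apply: norm_continuous.
have [|m mT hm] := EVT_min _ H'; first by rewrite (le_trans _ T0')// oppr_le0.
exists `|D eps m|; first by rewrite normr_gt0 D_neq0//; move: mT; rewrite in_itv.
by move=> t tP; apply: hm; rewrite in_itv.
Qed.

(** The bordered series divided by the determinant. [g] obeys the bound [M] of the kernel because it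
    fills a column of the determinants estimated by Hadamard; general data are rescaled in
    [sol_ex]. *)
Let sol_scaled eps t g : eps * eps = 1 -> - T <= t <= T -> uc (- T) T g ->
  (forall y, `|y| <= T -> `|g y| <= M) ->
  let u x := (D eps t)^-1 * bser T eps k t g 0 x in
  uc (- T) T u /\ forall x, `|x| <= T -> u x + eps * kop t u x = g x.
Proof.
move=> e2 tP gc gM u; have ub := bser_uc T0' M1 (e1 e2) kc kM tP 0 gc gM.
split; first exact: ucZ.
move=> x xT; rewrite (kopZ Kc tP)// /u mulrCA -mulrDr.
have -> := bser0_eq T0' M1 (e1 e2) kc kM tP gc gM xT.
by rewrite mulrCA mulVf ?D_neq0// mulr1.
Qed.

Lemma kop_sol_uniq eps t u v : eps * eps = 1 -> - T <= t <= T -> uc (- T) T u -> uc (- T) T v ->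
  (forall x, `|x| <= T -> u x + eps * kop t u x = v x + eps * kop t v x) ->
  forall x, `|x| <= T -> u x = v x.
Proof.
move=> e2 tP uu uv H x xT; apply/eqP; rewrite -subr_eq0; apply/eqP.
apply: (inj e2 tP (ucB uu uv)) => // y yT.
by rewrite (kopB Kc tP)// mulrBr addrACA -opprD H// subrr.
Qed.

Let sol_ex eps t g : eps * eps = 1 -> - T <= t <= T -> uc (- T) T g ->
  exists u, uc (- T) T u /\ forall x, `|x| <= T -> u x + eps * kop t u x = g x.
Proof.
move=> e2 tP gc; have [N N0 hN] := uc_bounded gc.
have [||uu uE] := @sol_scaled eps t (fun x => M / N * g x) e2 tP.
- exact: ucZ.
- move=> y; rewrite ler_norml => yT; rewrite normrM gtr0_norm ?divr_gt0// -mulrA.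
  by rewrite ger_pMr// mulrC ler_pdivrMr// mul1r hN.
set u := (X in uc _ _ X) in uu.
have {}uE x : `|x| <= T -> u x + eps * kop t u x = M / N * g x by exact: uE.
exists (fun x => N / M * u x); split; first exact: ucZ.
move=> x xT; rewrite (kopZ Kc tP)// [eps * _]mulrCA -mulrDr uE// mulrA.
by rewrite mulf_div (mulrC N) divff ?mul1r// mulf_neq0// gt_eqF.
Qed.

(** Outside [[-T, T]] the chosen solution is unspecified; the lemmas on it accordingly speak of
    [|x| <= T] only. *)
Definition res eps t g : R -> R := xget (fun=> 0)
  [set u | uc (- T) T u /\ forall x, `|x| <= T -> u x + eps * kop t u x = g x].

Section fixed_parameters.
Variables eps t : R.
Hypotheses (e2 : eps * eps = 1) (tP : - T <= t <= T).

Lemma resP g : uc (- T) T g -> uc (- T) T (res eps t g) /\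
  forall x, `|x| <= T -> res eps t g x + eps * kop t (res eps t g) x = g x.
Proof. by move=> gc; exact: (xgetPex (fun=> 0) (sol_ex e2 tP gc)). Qed.

Lemma res_uc g : uc (- T) T g -> uc (- T) T (res eps t g).
Proof. by case/resP. Qed.

Lemma resE g x : uc (- T) T g -> `|x| <= T ->
  res eps t g x + eps * kop t (res eps t g) x = g x.
Proof. by move=> /resP[_]; apply. Qed.

Lemma res_uniq g u : uc (- T) T u -> (forall x, `|x| <= T -> u x + eps * kop t u x = g x) ->
  forall x, `|x| <= T -> res eps t g x = u x.
Proof.
move=> uu uE x xT; have gc : uc (- T) T g.
  apply: (@uc_eq _ _ _ (fun x => u x + eps * kop t u x)).
    by move=> y yT; rewrite uE// ler_norml.
  by apply: ucD => //; apply: ucZ; exact: kop_uc.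
apply: (kop_sol_uniq e2 tP) xT => //; first exact: res_uc.
by move=> y yT; rewrite resE// uE.
Qed.

Lemma resZ c g x : uc (- T) T g -> `|x| <= T ->
  res eps t (fun y => c * g y) x = c * res eps t g x.
Proof.
move=> gc; move: x; apply: res_uniq; first by apply: ucZ; exact: res_uc.
move=> x xT; have ug := res_uc gc.
by rewrite (kopZ Kc tP)// mulrCA -mulrDr resE.
Qed.

End fixed_parameters.

(* the Fredholm determinant is continuous in t without zeros on [-T, T], hence
   bounded away from 0 *)
Lemma res_bound_ex : exists2 C, 0 < C & forall eps t u G, eps * eps = 1 -> - T <= t <= T ->
  uc (- T) T u -> (forall x, `|x| <= T -> `|u x + eps * kop t u x| <= G) ->
  forall x, `|x| <= T -> `|u x| <= C * G.
Proof.
have [d1 d10 h1] := D_away (mulr1 1); have [d2 d20 h2] := D_away (etrans (mulrNN 1 1) (mulr1 1)).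
pose d := Num.min d1 d2; have d0 : 0 < d by rewrite lt_min d10.
have f0 := fconst_ge0 T0' M1.
(* The solution for data of size [M] is at most [2 * fconst / d]; rescaling brings the factor
   [G / M], and the added 1 makes the constant positive. *)
exists (M^-1 * d^-1 * (2 * fconst T0' M1 + 1)).
  by rewrite !mulr_gt0 ?invr_gt0// ltr_wpDl// mulr_ge0.
move=> eps t u G e2 tP uu uG x xT.
have Dd : d <= `|D eps t|.
  have /eqP := e2; rewrite -expr2 sqrf_eq1 => /orP[]/eqP ->; rewrite /d ge_min.
    by rewrite h1.
  by rewrite h2// orbT.
have G0 : 0 <= G by apply: le_trans (uG 0 _); rewrite ?normr0.
(* [G = 0] is treated apart, as the data are about to be divided by [G]. *)
have [/eqP G0'|Gn0] := boolP (G == 0).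
  have -> : u x = 0.
    apply: (inj e2 tP uu) xT => y yT; apply/eqP; rewrite -normr_le0 -G0'; exact: uG.
  by rewrite normr0 G0' mulr0.
have {}G0 : 0 < G by rewrite lt_def Gn0.
pose g y := M / G * (u y + eps * kop t u y).
have gc : uc (- T) T g by apply: ucZ; apply: ucD => //; apply: ucZ; exact: kop_uc.
have gM y : `|y| <= T -> `|g y| <= M.
  move=> yT; rewrite normrM gtr0_norm ?divr_gt0// -mulrA.
  by rewrite ger_pMr// mulrC ler_pdivrMr// mul1r uG.
have [uu' uE'] := sol_scaled e2 tP gc gM.
have E : M / G * u x = (D eps t)^-1 * bser T eps k t g 0 x.
  apply: (@kop_sol_uniq eps t (fun y => M / G * u y) _ e2 tP (ucZ _ uu) uu' _ x xT) => y yT.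
  by rewrite uE'// (kopZ Kc tP)// mulrCA -mulrDr.
rewrite (_ : u x = G / M * (M / G * u x)); last by field; rewrite !gt_eqF.
rewrite E.
have := bser_bound T0' M1 (e1 e2) kc kM tP 0 gc gM xT; set b := bser _ _ _ _ _ _ _ => hb.
rewrite !normrM !normfV (gtr0_norm G0) (gtr0_norm M0).
rewrite [X in _ <= X](_ : _ = G / M * (d^-1 * (2 * fconst T0' M1 + 1))); last by ring.
rewrite ler_pM2l ?divr_gt0// ler_pM ?invr_ge0//.
  by rewrite lef_pV2 ?posrE// (lt_le_trans d0).
by rewrite (le_trans hb)// lerDl.
Qed.

Definition resC := s2val (cid2 res_bound_ex).
Lemma resC_gt0 : 0 < resC. Proof. exact: (s2valP (cid2 res_bound_ex)). Qed.
Lemma resCP eps t u G : eps * eps = 1 -> - T <= t <= T ->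
  uc (- T) T u -> (forall x, `|x| <= T -> `|u x + eps * kop t u x| <= G) ->
  forall x, `|x| <= T -> `|u x| <= resC * G.
Proof. exact: (s2valP' (cid2 res_bound_ex)). Qed.

Lemma res_bound eps t g G x : eps * eps = 1 -> - T <= t <= T -> uc (- T) T g ->
  (forall y, `|y| <= T -> `|g y| <= G) -> `|x| <= T -> `|res eps t g x| <= resC * G.
Proof.
move=> e2 tP gc gG; move: x; apply: (resCP e2 tP); first exact: res_uc.
by move=> x xT; rewrite resE// gG.
Qed.

Lemma kop_osc t s u x c e : - T <= t <= T -> - T <= s <= T -> uc (- T) T u -> `|x| <= T ->
  (forall y, Num.min s t <= y <= Num.max s t -> `|K (x + y) * u y - c| <= e) ->
  `|kop t u x - kop s u x - (t - s) * c| <= e * `|t - s|.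
Proof. by move=> tP sP uu xT; apply: itg_osc (ku_uc Kc xT uu) sP tP. Qed.

Lemma itv_minmax t s y : - T <= t <= T -> - T <= s <= T ->
  Num.min s t <= y <= Num.max s t -> `|y| <= T /\ `|y - s| <= `|t - s|.
Proof.
move=> tP sP; have [st|ts] := leP s t => yP; split; rewrite ?ler_norml; try lra.
- by rewrite !ger0_norm; lra.
- by rewrite !ler0_norm; lra.
Qed.

(** The difference solves the equation at [s] whose data are [g - h] and the effect of moving the
    endpoint, an integral over an interval of length [|t - s|]. *)
Lemma res_lip eps t s g h G G' : eps * eps = 1 -> - T <= t <= T -> - T <= s <= T ->
  uc (- T) T g -> uc (- T) T h ->
  (forall y, `|y| <= T -> `|g y - h y| <= G) -> (forall y, `|y| <= T -> `|g y| <= G') ->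
  forall x, `|x| <= T -> `|res eps t g x - res eps s h x| <= resC * (G + M * (resC * G') * `|t - s|).
Proof.
move=> e2 tP sP gc hc gG gG'; have ug := res_uc e2 tP gc; have uh := res_uc e2 sP hc.
apply: (resCP e2 sP); first exact: ucB.
move=> x xT; rewrite (kopB Kc sP)// mulrBr addrACA -opprD (resE e2 sP hc xT).
have -> : res eps t g x + eps * kop s (res eps t g) x - h x =
   (g x - h x) - eps * (kop t (res eps t g) x - kop s (res eps t g) x - (t - s) * 0).
  by rewrite -[in RHS](resE e2 tP gc xT); ring.
rewrite (le_trans (ler_normB _ _))// lerD ?gG// normrM (sqr1_norm e2) mul1r.
apply: kop_osc => // y yP; have [yT _] := itv_minmax tP sP yP.
by rewrite subr0 normrM ler_pM ?KboundP// (res_bound e2 tP gc gG').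
Qed.

Definition rphi eps t := res eps t (fun x => K (x + t)).

Lemma kt_uc t : - T <= t <= T -> uc (- T) T (fun x => K (x + t)).
Proof. by move=> tP; exact: uc2_l kc tP. Qed.

Lemma rphi_uc eps t : eps * eps = 1 -> - T <= t <= T -> uc (- T) T (rphi eps t).
Proof. by move=> e2 tP; apply: res_uc => //; exact: kt_uc. Qed.

Lemma rphiE eps t x : eps * eps = 1 -> - T <= t <= T -> `|x| <= T ->
  rphi eps t x + eps * kop t (rphi eps t) x = K (x + t).
Proof. by move=> e2 tP xT; apply: resE => //; exact: kt_uc. Qed.

Lemma rphi_bound eps t x : eps * eps = 1 -> - T <= t <= T -> `|x| <= T -> `|rphi eps t x| <= resC * M.
Proof.
move=> e2 tP xT; apply: res_bound => //; first exact: kt_uc.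
by move=> y yT; apply: KboundP => //; rewrite ler_norml.
Qed.

(** Continuity in [t] comes from [res_lip]; continuity in [x], uniformly in [t], from the equation,
    which expresses the solution by [K(. + t)] and an integral against [K]. *)
Lemma rphi_uc2 eps : eps * eps = 1 -> uc2 (- T) T (- T) T (rphi eps).
Proof.
move=> e2 e e0; have C0 := resC_gt0.
pose C := 2 * T * (resC * M) + 1.
have Cp : 0 < C by rewrite ltr_wpDl// !mulr_ge0// ltW.
have [d1 d10 h1] := kc (divr_gt0 (divr_gt0 e0 (ltr0n _ 2)) Cp).
pose N := resC * (1 + M * (resC * M)).
have [d2 d20 h2] := kc (divr_gt0 (divr_gt0 e0 (ltr0n _ 4)) C0).
pose B := resC * (M * (resC * M)).
have B0 : 0 < B by rewrite !mulr_gt0.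
exists (Num.min d1 (Num.min d2 (e / 4 / B))); first by rewrite !lt_min d10 d20 !divr_gt0.
move=> t t' x x' tP t'P; rewrite -!ler_norml => xT x'T.
rewrite !lt_min => /and3P[_ td2 tdB] /andP[xd1 _].
rewrite (_ : _ - _ = (rphi eps t x - rphi eps t' x) + (rphi eps t' x - rphi eps t' x')); last by ring.
rewrite (le_lt_trans (ler_normD _ _))// (splitr e); apply: ler_ltD.
  apply: (@le_trans _ _ (resC * (e / 4 / resC + M * (resC * M) * `|t - t'|))).
    apply: res_lip => //; [exact: kt_uc|exact: kt_uc| |].
      by move=> y; rewrite ler_norml => yT; rewrite ltW// h2// subrr normr0.
    by move=> y yT; apply: KboundP => //; rewrite ler_norml.
  rewrite mulrDr mulrCA divff ?gt_eqF// mulr1 mulrA.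
  move: tdB; rewrite ltr_pdivlMr// mulrC -/B => tdB.
  by rewrite (_ : e / 2 = e / 4 + e / 4); [rewrite lerD2l ltW|field].
have uf := rphi_uc e2 t'P.
have E y : `|y| <= T -> rphi eps t' y = K (y + t') - eps * kop t' (rphi eps t') y.
  by move=> yT; rewrite -(rphiE e2 t'P yT) addrK.
have xT' := xT; have x'T' := x'T; rewrite !ler_norml in xT' x'T'.
have /andP[t'l t'r] := t'P.
have kd y : `|y| <= T -> `|K (x + y) - K (x' + y)| <= e / 2 / C.
  by rewrite ler_norml => yT; rewrite ltW// h1// subrr normr0.
rewrite !E// (_ : _ - _ = (K (x + t') - K (x' + t')) -
  eps * (kop t' (rphi eps t') x - kop t' (rphi eps t') x')); last by ring.
rewrite (le_lt_trans (ler_normB _ _))// normrM (sqr1_norm e2) mul1r.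
have b1 : `|kop t' (rphi eps t') x - kop t' (rphi eps t') x'| <= (t' - - T) * (e / 2 / C * (resC * M)).
  rewrite -itgB; [|exact: ku_uct..]; apply: itg_bound => //; first by apply: ucB; exact: ku_uct.
  move=> y yP; have yT := itv_norm t'P yP.
  by rewrite -mulrBl normrM ler_pM ?kd ?rphi_bound.
have b2 : `|K (x + t') - K (x' + t')| < e / 2 / C.
  by rewrite h1// ?subrr ?normr0//.
have b3 : (t' - - T) * (e / 2 / C * (resC * M)) <= (2 * T) * (e / 2 / C * (resC * M)).
  have p0 : 0 <= e / 2 / C * (resC * M) by rewrite ltW// !mulr_gt0// ?divr_gt0// invr_gt0.
  by apply: ler_wpM2r => //; move: T0; lra.
apply: lt_le_trans (ltr_leD b2 (le_trans b1 b3)) _.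
apply: (@le_trans _ _ (e / 2 / C * C)); last by rewrite divfK ?gt_eqF.
move: (e / 2 / C) => q; rewrite le_eqVlt; apply/orP; left; apply/eqP; rewrite /C; ring.
Qed.

Lemma rphi_diag_uc eps : eps * eps = 1 -> uc (- T) T (fun t => rphi eps t t).
Proof. by move=> e2 e /(rphi_uc2 e2)[d d0 hd]; exists d => // t s tP sP ts; exact: hd. Qed.

End resolvent.

(** * Derivatives of the resolvents and of the determinant *)

Section resolvent_calculus.
Context {R : realType}.
Variables (T : R) (K : R -> R).
Hypotheses (T0 : 0 < T) (Kc : continuous K) (K0 : forall x : R, x <= 0 -> K x = 0).
Hypothesis inj : forall eps t : R, eps * eps = 1 -> - T <= t <= T -> kinj T K eps t.
Implicit Types (g h u v V : R -> R) (t s x y G eps : R).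

Let T0' : 0 <= T. Proof. exact: ltW. Qed.
Notation k := (fun x y : R => K (x + y)).
Notation M := (Kbound T Kc).
Notation kop := (kop T K).
Notation D eps t := (dser T eps k t 0).
Notation res := (res T K).
Notation rphi := (rphi T K).
Notation C := (resC T0 Kc inj).
Let kc : uc2 (- T) T (- T) T k. Proof. exact: k_uc2. Qed.
Let M1 : 1 <= M. Proof. exact: Kbound1. Qed.
Let M0 : 0 < M. Proof. exact: lt_le_trans M1. Qed.
Let C0 : 0 < C. Proof. exact: resC_gt0. Qed.
Let kM x y : `|x| <= T -> `|y| <= T -> `|k x y| <= M. Proof. exact: KboundP. Qed.
Let TT : - T <= T. Proof. by rewrite (le_trans _ T0')// oppr_le0. Qed.
Let e1 eps : eps * eps = 1 -> `|eps| <= 1. Proof. by move/sqr1_norm ->. Qed.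
Let urphi := rphi_uc T0 Kc inj.
Let ures := res_uc T0 Kc inj.

Lemma sqrN1 eps : eps * eps = 1 -> - eps * - eps = 1.
Proof. by rewrite mulrNN. Qed.

(** Differentiating [u + eps K_t u = g] in [t] gives for [u'] the data [- eps K(. + t) u(t)], so
    [u' = - eps u(t) phi^eps(t, .)]. The radius [d] is uniform in [x] because the diagonal point
    [x = t] moves with [t]. *)
Lemma res_dt eps g t0 : eps * eps = 1 -> uc (- T) T g -> - T <= t0 <= T ->
  forall e, 0 < e -> exists2 d, 0 < d & forall t x, - T <= t <= T -> `|t - t0| < d -> `|x| <= T ->
  `|res eps t g x - res eps t0 g x + (t - t0) * (eps * res eps t0 g t0 * rphi eps t0 x)|
    <= e * `|t - t0|.
Proof.
move=> e2 gc t0P e e0.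
have t0T : `|t0| <= T by rewrite ler_norml.
have [N N0 gN] := uc_bounded gc.
pose u0 := res eps t0 g; have uu0 : uc (- T) T u0 by exact: ures.
have uf : uc (- T) T (rphi eps t0) by exact: urphi.
have [d1 d10 h1] := ku_uc2 Kc uu0 (divr_gt0 (divr_gt0 e0 (ltr0n _ 2)) C0).
pose B := M * (C * (M * (C * N))) + 1.
have B0 : 0 < B by rewrite ltr_wpDl// !mulr_ge0// ltW.
exists (Num.min d1 (e / 2 / C / B)); first by rewrite lt_min d10 !divr_gt0.
move=> t x tP; rewrite lt_min => /andP[td1 tB] xT.
pose u := res eps t g; have uu : uc (- T) T u by exact: ures.
have ulip y : `|y| <= T -> `|u y - u0 y| <= C * (M * (C * N) * `|t - t0|).
  move=> yT; have := @res_lip _ T K T0 Kc inj eps t t0 g g 0 N e2 tP t0P gc gc _ _ y yT.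
  by rewrite add0r; apply=> z; rewrite ?subrr ?normr0// ler_norml; exact: gN.
pose c := eps * u0 t0.
(* The quantity to be bounded; its data are the error in the first-order expansion of [K_t u] in the
   endpoint, and [resCP] carries the smallness over to [w]. *)
pose w y := (u y - u0 y) + (t - t0) * c * rphi eps t0 y.
have uw : uc (- T) T w by apply: ucD; [exact: ucB|exact: ucZ].
have kw y : `|y| <= T -> w y + eps * kop t0 w y =
    - eps * (kop t u y - kop t0 u y - (t - t0) * (K (y + t0) * u0 t0)).
  move=> yT; rewrite (kopD Kc t0P)//; [|exact: ucB|exact: ucZ].
  rewrite (kopB Kc t0P)// (kopZ Kc t0P)//.
  have E1 := resE T0 Kc inj e2 tP gc yT.
  have E2 := resE T0 Kc inj e2 t0P gc yT.
  have E3 := rphiE T0 Kc inj e2 t0P yT.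
  rewrite -[K (y + t0)]E3 /w -/u -/u0 in E1 E2 *.
  have -> : u y = g y - eps * kop t u y by rewrite -E1 addrK.
  have -> : u0 y = g y - eps * kop t0 u0 y by rewrite -E2 addrK.
  by rewrite /c; move: (kop t u y) (kop t0 u y) (kop t0 u0 y) (kop t0 (rphi eps t0) y) (rphi eps t0 y) (u0 t0) (g y) => *; ring.
rewrite (_ : _ + _ = w x); last by rewrite /w /c /u /u0 !mulrA.
have -> : e * `|t - t0| = C * (e / C * `|t - t0|) by rewrite mulrA mulrCA divff ?mulr1// gt_eqF.
apply: (resCP T0 Kc inj e2 t0P uw) xT => y yT; rewrite kw// normrM normrN (sqr1_norm e2) mul1r.
apply: kop_osc => // z /(itv_minmax tP t0P)[zT zt].
rewrite (_ : _ - _ = K (y + z) * (u z - u0 z) + (K (y + z) * u0 z - K (y + t0) * u0 t0)); last by ring.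
rewrite (le_trans (ler_normD _ _))// (_ : e / C = e / 2 / C + e / 2 / C); last by field; rewrite gt_eqF.
apply: lerD; last first.
  by apply/ltW/h1; rewrite -?ler_norml ?subrr ?normr0// (le_lt_trans zt).
rewrite normrM (le_trans (ler_pM (normr_ge0 _) (normr_ge0 _) (kM yT zT) (ulip z zT)))//.
rewrite !mulrA (le_trans (_ : _ <= B * `|t - t0|))//.
  by rewrite ler_wpM2r// /B !mulrA lerDl.
by move: tB; rewrite ltr_pdivlMr// mulrC => /ltW.
Qed.

(** Otherwise the primitive of [eps * rphi eps t] would take the value 1 at [t] and, by parts, solve
    the homogeneous equation at [- eps], against [inj]. *)
Lemma rphi_mean eps t : eps * eps = 1 -> - T <= t <= T ->
  1 - eps * itg (- T) t (rphi eps t) != 0.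
Proof.
move=> e2 tP; have tT : `|t| <= T by rewrite ler_norml.
have uf := urphi e2 tP.
apply/eqP => /eqP; rewrite subr_eq0 eq_sym => /eqP I1.
pose V y := eps * rphi eps t y; have uV : uc (- T) T V by exact: ucZ.
pose u y := 0 + itg (- T) y V.
have uu : uc (- T) T u.
  apply: (@dw_uc _ _ _ _ V) => y yP; rewrite -[V y]add0r; apply: dwD; first exact: dw_cst.
  exact: dw_itg.
have ut : u t = 1.
  by rewrite /u add0r /V itgZ//; case/andP: tP => *; apply: uc_sub uf.
suff /(_ t tT)/eqP : forall x, `|x| <= T -> u x = 0 by rewrite ut oner_eq0.
apply: (inj (sqrN1 e2) tP uu) => x xT.
have /andP[xl xr] : - T <= x <= T by rewrite -ler_norml.
have uk : uc (- T) x (fun s => K (s + t)) by apply: uc_sub (kt_uc Kc tP).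
have kE : kop t u x = itg (- T) x (fun s => K (s + t)) * u t - itg (- T) x (kop t V).
  exact: kop_primitive.
rewrite kE ut mulr1.
rewrite /u add0r mulNr mulrBr -!itgZ//; last first.
  by apply: uc_sub (kop_uc Kc tP uV).
have uVx : uc (- T) x V by apply: uc_sub uV.
rewrite -itgB; [|exact: ucZ|by apply: ucZ; apply: uc_sub (kop_uc Kc tP uV)].
rewrite -itgB//; last first.
  by apply: ucB; [exact: ucZ|apply: ucZ; apply: uc_sub (kop_uc Kc tP uV)].
rewrite -(itg0 (- T) x); apply: itg_eq => y yP.
have yT : `|y| <= T by apply: itv_norm yP; rewrite xl.
by rewrite (kopZ Kc tP)// /V -(rphiE T0 Kc inj e2 tP yT); ring.
Qed.

(* Integration by parts turns the equation of index - eps for a function into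
   the one of index eps for its derivative. *)
Lemma res_dx eps t g g' : eps * eps = 1 -> - T <= t <= T -> uc (- T) T g' ->
  (forall x, - T <= x <= T -> dw (- T) T g x (g' x)) ->
  forall x, - T <= x <= T -> dw (- T) T (res (- eps) t g) x
    (res eps t g' x + eps * res (- eps) t g t * rphi eps t x).
Proof.
move=> e2 tP gc' gd x xP; have tT : `|t| <= T by rewrite ler_norml.
have [tl tr] := andP tP.
have gc : uc (- T) T g := dw_uc gd.
have uf := urphi e2 tP; have ur : uc (- T) T (res eps t g') by exact: ures.
have uft : uc (- T) t (rphi eps t) by apply: uc_sub uf.
have urt : uc (- T) t (res eps t g') by apply: uc_sub ur.
pose c := g (- T); pose I := 1 - eps * itg (- T) t (rphi eps t).
(* The value at [t] imposed on the candidate by [q = c + int res eps t g' + eps q int rphi eps t],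
   solvable thanks to [rphi_mean]. *)
pose q := (c + itg (- T) t (res eps t g')) / I.
pose V y := res eps t g' y + eps * q * rphi eps t y.
have uV : uc (- T) T V by apply: ucD => //; exact: ucZ.
pose u y := c + itg (- T) y V.
have du y : - T <= y <= T -> dw (- T) T u y (V y).
  move=> yP; rewrite -[V y]add0r; apply: dwD; first exact: dw_cst.
  exact: dw_itg.
have uu : uc (- T) T u by exact: dw_uc du.
have ut : u t = q.
  rewrite /u /V itgD//; last exact: ucZ.
  rewrite itgZ//; have I0 : I != 0 by exact: rphi_mean.
  have E : q * I = c + itg (- T) t (res eps t g') by rewrite divfK.
  by rewrite addrA -E /I; ring.
have uE y : `|y| <= T -> u y + - eps * kop t u y = g y.
  move=> yT; have /andP[yl yr] : - T <= y <= T by rewrite -ler_norml.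
  have uk : uc (- T) y (fun s => K (s + t)) by apply: uc_sub (kt_uc Kc tP).
  have ukV : uc (- T) y (kop t V) by apply: uc_sub (kop_uc Kc tP uV).
  have uVy : uc (- T) y V by apply: uc_sub uV.
  have kE : kop t u y = itg (- T) y (fun s => K (s + t)) * u t - itg (- T) y (kop t V).
    exact: kop_primitive.
  rewrite kE ut.
  have -> : u y + - eps * (itg (- T) y (fun s => K (s + t)) * q - itg (- T) y (kop t V)) =
    c + (itg (- T) y V - (eps * q * itg (- T) y (fun s => K (s + t)) - eps * itg (- T) y (kop t V))).
    by rewrite /u; ring.
  rewrite -!itgZ// -itgB; [|exact: ucZ..].
  rewrite -itgB//; last by apply: ucB; exact: ucZ.
  have := @ftc2 _ (- T) y g g' yl _ _; rewrite -/c => G.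
  rewrite -[RHS](subrK c) addrC G; last 2 first.
  - exact: uc_sub gc'.
  - move=> z /andP[zl zr]; apply: (dw_sub (lexx _) yr); apply: gd.
    by rewrite zl (le_trans zr).
  congr (_ + _); apply: itg_eq => z /andP[zl zr].
  have zT : `|z| <= T by rewrite ler_norml zl (le_trans zr).
  rewrite /V (kopD Kc tP)//; last exact: ucZ.
  rewrite (kopZ Kc tP)// -(rphiE T0 Kc inj e2 tP zT) -[RHS](resE T0 Kc inj e2 tP gc' zT).
  by ring.
have rE y : - T <= y <= T -> u y = res (- eps) t g y.
  by rewrite -ler_norml => yT; rewrite (res_uniq T0 Kc inj (sqrN1 e2) tP uu uE).
rewrite -(rE t tP) ut; apply: (dw_ext rE xP); exact: du.
Qed.

Definition rdiag eps g t := res eps t g t.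
Definition rmu t := rphi 1 t t + rphi (- 1) t t.

Lemma rmuE eps t : eps * eps = 1 -> rphi eps t t + rphi (- eps) t t = rmu t.
Proof.
by rewrite -expr2 => /eqP; rewrite sqrf_eq1 => /orP[]/eqP -> //; rewrite opprK addrC.
Qed.

(** Chain rule along the diagonal: [res_dt] at [- eps] and [res_dx] contribute [eps u(t, t)] times
    [phi^{-eps}(t, t)] and [phi^eps(t, t)] respectively, and the two add up to [rmu]. *)
Lemma rdiag_dw eps g g' : eps * eps = 1 -> uc (- T) T g' ->
  (forall x, - T <= x <= T -> dw (- T) T g x (g' x)) ->
  forall t, - T <= t <= T -> dw (- T) T (rdiag (- eps) g) t
    (rdiag eps g' t + eps * rdiag (- eps) g t * rmu t).
Proof.
move=> e2 gc' gd t0 t0P e e0; have e30 : 0 < e / 3 by rewrite divr_gt0.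
have gc : uc (- T) T g := dw_uc gd.
have [d1 d10 h1] := res_dt (sqrN1 e2) gc t0P e30.
have [d2 d20 h2] := res_dx e2 t0P gc' gd t0P e30.
pose a := res (- eps) t0 g t0.
have e4 : 0 < e / 3 / (`|a| + 1) by rewrite divr_gt0// ltr_wpDl.
have [d3 d30 h3] := urphi (sqrN1 e2) t0P e4.
exists (Num.min d1 (Num.min d2 d3)); first by rewrite !lt_min d10 d20.
move=> t tP; rewrite !lt_min => /and3P[td1 td2 td3].
have {}h1 := h1 t t tP td1; have {}h2 := h2 t tP td2.
have {}h3 := h3 t t0 tP t0P td3.
rewrite -(rmuE t0 e2) /rdiag -/a.
set p := rphi (- eps) t0 in h1 h3 *; set q := rphi eps t0 in h2 *.
(* [h1] evaluates [p] at the moving point [t]; the last summand corrects this to [t0] by continuity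
   of [p]. *)
rewrite (_ : _ - _ = (res (- eps) t g t - res (- eps) t0 g t + (t - t0) * (- eps * a * p t)) +
  (res (- eps) t0 g t - a - (t - t0) * (res eps t0 g' t0 + eps * a * q t0)) +
  (t - t0) * eps * a * (p t - p t0)); last by rewrite /q/p; ring.
rewrite (le_trans (ler_normD _ _))// (_ : e * _ = e / 3 * `|t - t0| + e / 3 * `|t - t0| + e / 3 * `|t - t0|); last by field.
apply: lerD.
  by rewrite (le_trans (ler_normD _ _))// lerD// h1// ler_norml.
rewrite !normrM (sqr1_norm e2) mulr1 -mulrA mulrC ler_wpM2r//.
apply: (@le_trans _ _ (`|a| * (e / 3 / (`|a| + 1)))); first by rewrite ler_wpM2l// ltW.
by rewrite mulrCA ger_pMr// ler_pdivrMr ?ltr_wpDl// mul1r lerDl.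
Qed.

(** The kernel is symmetric, so the resolvent moves to the other factor of the integral. For
    [g = e^{izx}] the right-hand side is [a] when [eps = 1] and [b] when [eps = -1]. *)
Lemma rdiag_adjoint eps g t : eps * eps = 1 -> uc (- T) T g -> - T <= t <= T ->
  rdiag eps g t = g t - eps * itg (- T) t (fun y => rphi eps t y * g y).
Proof.
move=> e2 gc tP; have tT : `|t| <= T by rewrite ler_norml.
have [tl tr] := andP tP.
rewrite /rdiag -[in RHS](resE T0 Kc inj e2 tP gc tT) -addrA; apply/eqP.
rewrite -subr_eq0 opprD addNKr oppr_eq0 -mulrBr; apply/eqP.
suff -> : kop t (res eps t g) t = itg (- T) t (fun y => rphi eps t y * g y) by rewrite subrr mulr0.
set u := res eps t g; have uu : uc (- T) T u by exact: ures.
have uf := urphi e2 tP.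
have uft : uc (- T) t (rphi eps t) by apply: uc_sub uf.
have uut : uc (- T) t u by apply: uc_sub uu.
have ukf : uc (- T) t (kop t (rphi eps t)) by apply: uc_sub (kop_uc Kc tP uf).
have uku : uc (- T) t (kop t u) by apply: uc_sub (kop_uc Kc tP uu).
transitivity (itg (- T) t (fun y => rphi eps t y * u y + eps * (kop t (rphi eps t) y * u y))).
  apply: itg_eq => y yP; have yT := itv_norm tP yP.
  by rewrite addrC -(rphiE T0 Kc inj e2 tP yT) mulrDl mulrA.
transitivity (itg (- T) t (fun y => rphi eps t y * u y + eps * (rphi eps t y * kop t u y))); last first.
  apply: itg_eq => y yP; have yT := itv_norm tP yP.
  by rewrite -(resE T0 Kc inj e2 tP gc yT) mulrDr mulrCA.
rewrite !itgD//; [|exact: ucM|by apply: ucZ; exact: ucM|exact: ucM|by apply: ucZ; exact: ucM].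
rewrite !itgZ//; [|exact: ucM..]; congr (_ + eps * _).
pose f x y := K (x + y) * rphi eps t y * u x.
have uk : uc2 (- T) T (- T) T (fun x y => K (x + y) * rphi eps t y) by exact: ku_uc2.
transitivity (itg (- T) t (fun x => itg (- T) t (f x))).
  apply: itg_eq => x xP; have xT := itv_norm tP xP.
  rewrite mulrC -itgZ; last exact: ku_uct.
  by apply: itg_eq => y _; rewrite /f mulrC.
have uf2 : uc2 (- T) T (- T) T f.
  apply: (uc2Ml (M := M * (C * M)) uk _ uu) => x y; rewrite -!ler_norml => xT yT.
  by rewrite normrM ler_pM ?kM ?(rphi_bound _ _ inj).
rewrite itg_fubini//; last exact: uc2_sub uf2.
apply: itg_eq => y yP; have yT := itv_norm tP yP.
rewrite /kop -itgZ; last exact: ku_uct.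
by apply: itg_eq => x _; rewrite /f (addrC y); ring.
Qed.

(** Both sides solve the equation with data [D * K(. + t)]. *)
Lemma rdiag_res_bser eps t x : eps * eps = 1 -> - T <= t <= T -> `|x| <= T ->
  bser T eps k t (k^~ t) 0 x = D eps t * rphi eps t x.
Proof.
move=> e2 tP xT; have tT : `|t| <= T by rewrite ler_norml.
have kt := kt_uc Kc tP.
have ktM y : `|y| <= T -> `|k y t| <= M by move=> yT; exact: kM.
have ub := bser_uc T0' M1 (e1 e2) kc kM tP 0 kt ktM.
rewrite -[RHS](resZ T0 Kc inj e2 tP _ kt xT); symmetry.
move: x xT; apply: (res_uniq T0 Kc inj e2 tP ub) => x xT.
by rewrite (bser0_eq T0' M1 (e1 e2) kc kM tP kt ktM xT) mulrC.
Qed.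

(** By symmetry of the determinants, [iint_deriv] without parameters gives the derivative in the
    endpoint: one variable is set to [r], with multiplicity [n + 1]. *)
Lemma fnum_ftc n t : - T <= t <= T ->
  uc (- T) T (fun r => bnum T k r (k^~ r) r n) /\
  fnum T k t n.+1 = n.+1%:R * itg (- T) t (fun r => bnum T k r (k^~ r) r n).
Proof.
move=> tP; have [tl tr] := andP tP; have nf m := nice_fdet M1 kc kM m.
have pf l l' : perm_eq l l' -> fdet k l = fdet k l' by exact: fdet_perm.
have bE r m : bnum T k r (k^~ r) r m = iint T r m (fun l => fdet k (r :: l)).
  by apply: eq_iint => l _; rewrite fdet_cons.
have nT r : - T <= r <= T -> `|r| <= T by rewrite ler_norml.
have ub : uc (- T) T (fun r => bnum T k r (k^~ r) r n).
  have [B B0 HB] := iint_lip T0' n (sqrtr_ge0 _ : 0 <= hadamard_const M n.+1).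
  move=> e e0; have B1 : 0 < B + 1 by rewrite ltr_wpDl.
  have [d d0 hd] := (nf n.+1).2 (e / 2 / ((2 * T) ^+ n + 1)) (divr_gt0 (divr_gt0 e0 (ltr0n _ 2))
    (ltr_wpDl (exprn_ge0 n (mulr_ge0 (ler0n _ 2) T0')) ltr01)).
  exists (Num.min d (e / 2 / (B + 1))); first by rewrite lt_min d0 !divr_gt0.
  move=> r s rP sP; rewrite lt_min !bE => /andP[rs1 rs2].
  have rT := nT r rP; have sT := nT s sP.
  have nr := nice_cons rT (nf n.+1); have ns := nice_cons sT (nf n.+1).
  rewrite (_ : _ - _ = (iint T r n (fun l => fdet k (r :: l)) - iint T r n (fun l => fdet k (s :: l))) +
    (iint T r n (fun l => fdet k (s :: l)) - iint T s n (fun l => fdet k (s :: l)))); last by ring.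
  rewrite (le_lt_trans (ler_normD _ _))// (splitr e); apply: ler_ltD.
    rewrite -iintB//.
    apply: (@le_trans _ _ ((2 * T) ^+ n * (e / 2 / ((2 * T) ^+ n + 1)))).
      apply: iint_bound => //.
        by apply: niceD => //; under eq_fun do rewrite -mulN1r; exact: niceZ.
      move=> l ln lT; apply/ltW/hd; rewrite /= ?ln//; [exact: boxed_cons|exact: boxed_cons|].
      by apply: near_seq_cons => //; exact: near_seq_refl.
    rewrite mulrCA ger_pMr ?divr_gt0// ler_pdivrMr ?mul1r ?lerDl//.
    by rewrite ltr_wpDl// exprn_ge0// mulr_ge0.
  apply: (@le_lt_trans _ _ (B * `|r - s|)).
    apply: HB => // l ln lT; apply: (fdet_bound kM); first by rewrite /= ln.
    exact: boxed_cons.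
  rewrite (le_lt_trans (_ : _ <= (B + 1) * `|r - s|))//; first by rewrite ler_wpM2r// lerDl.
  by rewrite mulrC -ltr_pdivlMr.
split=> //; rewrite -itgZ; last by apply: uc_sub ub.
rewrite -(@ftc2 _ (- T) t (fun r => fnum T k r n.+1)) //.
- by rewrite (_ : fnum T k (- T) n.+1 = 0) ?subr0// /fnum /= itg_pt.
- by apply: uc_sub (ucZ _ ub).
move=> r rP; apply: (dw_sub (lexx _) tr) => e e0.
have [d d0 hd] := iint_deriv T0' (m := 0) (nf n.+1) pf e0.
have rP' : - T <= r <= T by case/andP: rP => -> /le_trans; apply.
exists d => // s sP sr; have := hd [::] r s erefl (boxed_nil T0') rP' sP sr.
by rewrite /= -bE.
Qed.

(** Integrated form of [D' = eps phi^eps(t, t) D], term by term: the derivative of a coefficient of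
    [D] is a coefficient of the bordered series for [K(. + r)] at [r], whose sum is [D * rphi]. *)
Lemma dser_ftc eps t : eps * eps = 1 -> - T <= t <= T ->
  D eps t = 1 + itg (- T) t (fun r => eps * rphi eps r r * D eps r).
Proof.
move=> e2 tP; have [tl tr] := andP tP; have f0 := fconst_ge0 T0' M1.
have ge := @fgeo _ _ _ eps T0' M1 (e1 e2) (fnum T k t) 0 (fnum_bound T0' M1 kc kM tP).
have fE n : fcoef eps n 0 = eps ^+ n by rewrite /fcoef bin0 mul1r subn0.
rewrite /dser (gsum_recl f0 ge) fE expr0 mul1r fact0 divr1.
congr (_ + _); first by rewrite /fnum /= /fdet det_mx00.
have nT r : - T <= r <= t -> - T <= r <= T by case/andP=> -> /le_trans; apply.
pose F n r := eps * (fcoef eps n 0 * (bnum T k r (k^~ r) r n / n`!%:R)).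
have uF n : uc (- T) t (F n).
  apply: ucZ; apply: ucZ; apply: (@uc_eq _ _ _ (fun r => n`!%:R^-1 * bnum T k r (k^~ r) r n)).
    by move=> r _; rewrite mulrC.
  by apply: ucZ; apply: uc_sub (fnum_ftc n tP).1.
have gF r : - T <= r <= t -> geo (fconst T0' M1) (fun n => fcoef eps n 0 * (bnum T k r (k^~ r) r n / n`!%:R)).
  move=> rP; have rT : `|r| <= T by exact: itv_norm rP.
  apply: (@fgeo _ _ _ eps T0' M1 (e1 e2) (fun n => bnum T k r (k^~ r) r n)) => n.
  have kr := kt_uc Kc (nT r rP).
  by apply: (bnum_bound T0' M1 kc kM (nT r rP) n kr) => // y yT; exact: kM.
transitivity (gsum (fun n => itg (- T) t (F n))); last first.
  rewrite -(@gsum_itg _ _ _ (fconst T0' M1))//; last first.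
    by move=> r rP n; rewrite /F normrM (sqr1_norm e2) mul1r; exact: gF.
  apply: itg_eq => r rP; have rT : `|r| <= T by exact: itv_norm rP.
  rewrite /F (gsumZ _ f0 (gF r rP)) -mulrA; congr (_ * _).
  by have := rdiag_res_bser e2 (nT r rP) rT; rewrite /bser mulrC => ->.
apply: eq_gsum => n; rewrite /F fE.
have [ub ->] := fnum_ftc n tP.
have ubt : uc (- T) t (fun r => bnum T k r (k^~ r) r n) by apply: uc_sub ub.
have -> : (fun r => eps * (fcoef eps n 0 * (bnum T k r (k^~ r) r n / n`!%:R))) =
    (fun r => eps ^+ n.+1 / n`!%:R * bnum T k r (k^~ r) r n).
  by apply/funext => r; rewrite fE exprS; ring.
rewrite itgZ// factS natrM; field.
by rewrite pnatr_eq0 -lt0n fact_gt0 nat1r pnatr_eq0.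
Qed.

(** [D] times the inverse of the claimed exponential has derivative 0; at [- T], where the domain of
    integration is a point, it equals 1. *)
Lemma dser_exp eps t : eps * eps = 1 -> - T <= t <= T ->
  D eps t = expR (eps * itg (- T) t (fun r => rphi eps r r)).
Proof.
move=> e2 tP; have [tl tr] := andP tP.
have uD := dser_uct T0 Kc e2.
have up : uc (- T) T (fun r => rphi eps r r) := rphi_diag_uc T0 Kc inj e2.
pose P r := eps * itg (- T) r (fun r => rphi eps r r).
have dP r : - T <= r <= T -> dw (- T) T P r (eps * rphi eps r r).
  by move=> rP; apply: dwZ; exact: dw_itg.
have dD r : - T <= r <= T -> dw (- T) T (fun r => D eps r) r (eps * rphi eps r r * D eps r).
  move=> rP.
  apply: (@dw_ext _ _ _ (fun r => 1 + itg (- T) r (fun r => eps * rphi eps r r * D eps r))) => //.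
    by move=> y yP; rewrite -dser_ftc.
  rewrite -[eps * _ * _]add0r; apply: dwD; first exact: dw_cst.
  by apply: dw_itg => //; apply: ucM => //; exact: ucZ.
have := @dw0_cst _ (- T) t (fun r => D eps r * expR (- 1 * P r)) tl.
have P0 : P (- T) = 0 by rewrite /P itg_pt mulr0.
have D0 : D eps (- T) = 1 by rewrite dser_ftc ?lexx// itg_pt addr0.
rewrite P0 D0 mulr0 expR0 mulr1 => H.
rewrite -[LHS]mulr1 -[X in _ * X](expRxMexpNx_1 (P t)) [X in _ * X]mulrC mulrA.
rewrite -[- P t]mulN1r H ?mul1r//.
move=> r rP; apply: (dw_sub (lexx _) tr).
have rP' : - T <= r <= T by case/andP: rP => -> /le_trans; apply.
have := dwM (dD r rP') (dw_expR (dwZ (- 1) (dP r rP'))).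
by rewrite (_ : _ + _ = 0)//; ring.
Qed.

End resolvent_calculus.

(** * The truncated operators on the half-line *)

Section restriction.
Context {R : realType}.
Notation mu := (@lebesgue_measure R).
Implicit Types (f g h w X : R -> R) (a b t x y : R).

Lemma Rintegral0 (D : set R) f : (forall x, D x -> f x = 0) -> \int[mu]_(x in D) f x = 0.
Proof.
move=> f0; rewrite /Rintegral (eq_integral (fun=> 0%E)) ?integral0// => x.
by rewrite inE => /f0 ->.
Qed.

Lemma restrictE f (B : set R) x : (f \_ B) x = if x \in B then f x else 0.
Proof. by rewrite patchE. Qed.

Lemma sqr_Lfun2 f : measurable_fun setT f -> mu.-integrable setT (EFin \o (fun x => f x ^+ 2)) ->
  f \in Lfun mu 2%:E.
Proof.
move=> mf /integrableP[_ fi].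
rewrite inE; apply/andP; split; rewrite inE//=.
rewrite /finite_norm unlock; apply: poweR_lty; apply: le_lt_trans fi.
rewrite le_eqVlt; apply/orP; left; apply/eqP; apply: eq_integral => x _ /=.
rewrite powR_mulrn// real_normK ?num_real// ger0_norm ?sqr_ge0//.
Qed.

Lemma Lfun20 : (fun=> 0 : R) \in Lfun mu 2%:E.
Proof.
apply: sqr_Lfun2 => //; rewrite (_ : _ \o _ = cst 0%E); first exact: integrable0.
by apply/funext => x; rewrite /= expr0n.
Qed.

Lemma uc_int_co a b h : uc a b h -> mu.-integrable `[a, b[ (EFin \o h).
Proof.
move=> /uc_int; apply: integrableS => //; apply: subset_itvl.
by rewrite bnd_simp.
Qed.

Lemma uc_Lfun2 a b h : uc a b h -> h \_ `[a, b[ \in Lfun mu 2%:E.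
Proof.
move=> uh; apply: sqr_Lfun2.
  apply/(measurable_restrictT _ _).1 => //; apply/measurable_EFinP.
  by have /integrableP[] := uc_int_co uh.
rewrite (_ : _ \o _ = (EFin \o (fun x => h x * h x)) \_ `[a, b[).
  rewrite -integrable_restrict// setTI; apply: uc_int_co; exact: ucM.
by apply/funext => x; rewrite /= !patchE; case: ifP; rewrite /= ?expr2 ?mulr0.
Qed.

Lemma tail_itg a t h : a <= t -> uc a t h ->
  \int[mu]_(y in `]-oo, t[) (h \_ `[a, t[) y = itg a t h.
Proof.
move=> at_ uh; rewrite /itg -Rintegral_itv_bndo_bndc; last exact: uc_int_co.
rewrite Rintegral_mkcond [RHS]Rintegral_mkcond; apply: eq_Rintegral => y _.
rewrite !restrictE; case: ifP => [|/negbT yt]; case: ifP => // /set_mem/=; rewrite in_itv/= => /andP[_ yt'].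
by move: yt; rewrite notin_setE/= in_itv/= yt'.
Qed.

Lemma ae_onS t (P Q : R -> Prop) : (forall x, x < t -> P x -> Q x) -> ae_on t P -> ae_on t Q.
Proof.
move=> PQ [N [mN N0 PN]]; exists N; split=> // x nQ; apply: PN => Px; apply: nQ => xA.
by apply: PQ; [move: xA; rewrite /= in_itv|exact: Px].
Qed.

Lemma ae_onW t (P : R -> Prop) : (forall x, x < t -> P x) -> ae_on t P.
Proof.
move=> H; exists set0; split=> // x /= nP; apply: nP; rewrite in_itv/=; exact: H.
Qed.

Lemma Lfun2_measurable t X : (X \_ `]-oo, t[) \in Lfun mu 2%:E -> measurable_fun `]-oo, t[ X.
Proof.
by move=> /sub_Lfun_mfun; rewrite inE/= => mX; apply/(measurable_restrictT _ _).2.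
Qed.

End restriction.

(** * Operators on the half-line compared with those on the box *)

Section bridge.
Context {R : realType}.
Notation mu := (@lebesgue_measure R).
Variables (T : R) (K : R -> R).
Hypotheses (T0 : 0 < T) (Kc : continuous K) (K0 : forall x : R, x <= 0 -> K x = 0).
Implicit Types (g h u v w X : R -> R) (t s x y eps : R).

Let T0' : 0 <= T. Proof. exact: ltW. Qed.
Notation k := (fun x y : R => K (x + y)).

Lemma ku_out x y : x < - T -> y <= T -> K (x + y) = 0.
Proof. by move=> xT yT; apply: K0; lra. Qed.

Lemma real_KopE t X x : x <= t ->
  Kop K t (fun y => (X y)%:C) x = (\int[mu]_(y in `]-oo, t[) (K (x + y) * X y))%:C.
Proof.
move=> xt; rewrite /Kop /Cintegral indicE mem_set; last by rewrite /= in_itv.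
rewrite mul1r; congr (_ +i* _).
  by apply: eq_Rintegral => y _ /=; rewrite mul0r subr0.
by apply: Rintegral0 => y _ /=; rewrite mulr0 mul0r addr0.
Qed.

Section fixed_t.
Variable t : R.
Hypothesis tP : - T <= t <= T.
Let tl : - T <= t. Proof. by case/andP: tP. Qed.
Let tr : t <= T. Proof. by case/andP: tP. Qed.
Notation A := (`]-oo, t[%classic).
Notation B := (`[- T, t[%classic).

Let BA : B `<=` A. Proof. by apply: subset_itvr. Qed.

Lemma real_in_L2 X : in_L2 t (fun x => (X x)%:C) <-> (X \_ A) \in Lfun mu 2%:E.
Proof.
split=> [[]//|h]; split=> //.
rewrite (_ : _ \_ _ = (fun=> 0)); first exact: Lfun20.
by apply/funext => x; rewrite restrictE; case: ifP.
Qed.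

Lemma restrict_AB X : (X \_ B) \_ A = X \_ B.
Proof.
apply/funext => x; rewrite !restrictE; case: ifP => // /negbT; case: ifP => //.
by rewrite !inE => /BA xA; rewrite notin_setE.
Qed.

Lemma in_L2_cut w : uc (- T) T w -> in_L2 t (fun x => ((w \_ B) x)%:C).
Proof.
move=> uw; apply/real_in_L2; rewrite restrict_AB; apply: uc_Lfun2; exact: uc_sub uw.
Qed.

Lemma Kcut_itg w x : uc (- T) T w -> uc (- T) T (fun y => K (x + y)) ->
  \int[mu]_(y in A) (K (x + y) * (w \_ B) y) = itg (- T) t (fun y => K (x + y) * w y).
Proof.
move=> uw uk; rewrite -tail_itg//; last by apply: uc_sub (ucM uk uw).
by apply: eq_Rintegral => y _; rewrite !restrictE; case: ifP; rewrite ?mulr0.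
Qed.

Lemma kshift_continuous x : continuous (fun y => K (x + y)).
Proof.
move=> y; apply: (@continuous_comp _ _ _ (fun y => x + y) K); last exact: Kc.
by apply: cvgD; [exact: cvg_cst|exact: cvg_id].
Qed.

Lemma kshift_uc x : uc (- T) T (fun y => K (x + y)).
Proof. by apply: uc_cont; exact: kshift_continuous. Qed.

(** Passage from a class in L^2 to its continuous representative: the integral does not see the null
    set. *)
Lemma ae_on_K_int X w x : in_L2 t (fun x => (X x)%:C) -> uc (- T) T w ->
  ae_on t (fun y => X y = (w \_ B) y) ->
  \int[mu]_(y in A) (K (x + y) * X y) = itg (- T) t (fun y => K (x + y) * w y).
Proof.
move=> /real_in_L2/Lfun2_measurable mX uw XE; rewrite -Kcut_itg//; last exact: kshift_uc.
have mK : measurable_fun A (fun y => K (x + y)).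
  by apply: measurable_funTS; apply: continuous_measurable_fun; exact: kshift_continuous.
rewrite /Rintegral; congr fine; apply: ae_eq_integral => //.
- by apply/measurable_EFinP; apply: measurable_funM.
- apply/measurable_EFinP; apply: measurable_funM => //.
  by apply: Lfun2_measurable; apply/real_in_L2; exact: in_L2_cut.
- apply: ae_onS XE => y _ E; by rewrite E.
Qed.

Hypothesis noeig : ~ Kop_eigenvalue K t 1 /\ ~ Kop_eigenvalue K t (-1).

(** A nonzero continuous solution, cut to [[-T, t[], is an eigenvector in L^2. The eigenvalue is
    [- eps] as [eps] is its own inverse; below [- T] both sides vanish because [K] does. *)
Lemma noeig_kinj eps : eps * eps = 1 -> kinj T K eps t.
Proof.
move=> e2 w uw wE x xT; apply/eqP/negPn/negP => wx0.
have : Kop_eigenvalue K t ((- eps)%:C).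
  exists (fun y => ((w \_ B) y)%:C); split.
  - exact: in_L2_cut.
  (* [x] may lie beyond [t], where the cut does not see [w]; but if the cut is null then so is the
     integral, and the equation gives [w x = 0]. *)
  - move=> w0; move: wx0.
    have -> : w x = 0.
      have := wE x xT; rewrite /kop -(@ae_on_K_int (fun=> 0) w x)//.
      + rewrite (_ : Rintegral _ _ _ = 0) ?mulr0 ?addr0//.
        by apply: Rintegral0 => y _; rewrite mulr0.
      + apply/real_in_L2; rewrite (_ : _ \_ _ = (fun=> 0)); first exact: Lfun20.
        by apply/funext => y; rewrite restrictE; case: ifP.
      + apply: ae_onS w0 => y _ /eqP.
        by rewrite eq_complex/= eqxx andbT => /eqP ->.
    by rewrite eqxx.
  - apply: ae_onW => y yA.
    rewrite real_KopE ?ltW// Kcut_itg//; last exact: kshift_uc.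
    rewrite -rmorphM/=; congr (_%:C); rewrite restrictE.
    have [yT|yT] := leP (- T) y.
      have yT' : `|y| <= T by rewrite ler_norml yT (le_trans (ltW yA)).
      rewrite mem_set/=; last by rewrite in_itv/= yT yA.
      have -> : w y = - (eps * itg (- T) t (fun z => K (y + z) * w z)).
        by apply/eqP; rewrite -addr_eq0; apply/eqP; exact: wE.
      by rewrite mulrN mulNr opprK mulrA e2 mul1r.
    rewrite memNset/=; last by rewrite in_itv/= leNgt yT.
    rewrite mulr0 -(itg0 (- T) t); apply: itg_eq => z /andP[_ zt].
    by rewrite ku_out ?mul0r// (le_trans zt).
case: noeig => n1 n2; move: e2; rewrite -expr2 => /eqP; rewrite sqrf_eq1 => /orP[]/eqP ->.
  by rewrite rmorphN.
by rewrite opprK.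
Qed.


Variable eps : R.
Hypothesis e2 : eps * eps = 1.
Hypothesis inj : forall eps t : R, eps * eps = 1 -> - T <= t <= T -> kinj T K eps t.
Notation rphi := (rphi T K).

Lemma rphi_sol : is_phi_sol K eps t (rphi eps t \_ B).
Proof.
have uf := rphi_uc T0 Kc inj e2 tP.
split; first exact: in_L2_cut.
apply: ae_onW => y yA.
rewrite real_KopE ?ltW// Kcut_itg//; last exact: kshift_uc.
rewrite -rmorphM/= -rmorphD/= indicE mem_set ?mul1r; last by rewrite /= in_itv/= ltW.
congr (_%:C); rewrite restrictE.
have [yT|yT] := leP (- T) y.
  rewrite mem_set/=; last by rewrite in_itv/= yT yA.
  by rewrite -(rphiE T0 Kc inj e2 tP)// ler_norml yT (le_trans (ltW yA)).
rewrite memNset/=; last by rewrite in_itv/= leNgt yT.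
rewrite add0r ku_out//; rewrite (_ : itg _ _ _ = 0) ?mulr0//.
rewrite -(itg0 (- T) t); apply: itg_eq => z /andP[_ zt].
by rewrite ku_out ?mul0r// (le_trans zt).
Qed.

(** The equation expresses [X] almost everywhere by [u x = K(x + t) - eps * I x], continuous since
    [X] is integrable on the bounded interval [B]. Hence [u] solves the equation at every point of
    [[-T, T]], where uniqueness is known. *)
Lemma phi_sol_uniq X : is_phi_sol K eps t X -> ae_on t (fun y => X y = (rphi eps t \_ B) y).
Proof.
move=> [X2 XE]; have XA := (real_in_L2 X).1 X2.
have uf := rphi_uc T0 Kc inj e2 tP.
pose I x := \int[mu]_(y in A) (K (x + y) * X y).
pose u x := K (x + t) - eps * I x.
have intB h : uc (- T) t h -> mu.-integrable B (EFin \o (fun y => h y * X y)).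
  move=> uh; have /Lfun1_integrable := Lfun2_mul_Lfun1 (uc_Lfun2 uh) XA.
  move=> H; have HB : mu.-integrable B (EFin \o (h \_ B \* X \_ A)) by apply: integrableS H.
  apply: eq_integrable HB => //.
  move=> y yB /=; rewrite !restrictE yB mem_set//; apply: BA; exact: set_mem.
have IB x : - T <= x <= T -> I x = \int[mu]_(y in B) (K (x + y) * X y).
  move=> xT; rewrite /I Rintegral_mkcond [RHS]Rintegral_mkcond.
  apply: eq_Rintegral => y _; rewrite !restrictE; case: ifP => [yA|yA]; case: ifP => // yB.
    rewrite addrC ku_out ?mul0r//; last by case/andP: xT.
    rewrite ltNge; apply/negP => yT; move: yB; rewrite mem_set//= in_itv/= yT/=.
    by move: yA; rewrite inE/= in_itv.
  by move/set_mem/BA/mem_set: yB; rewrite yA.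
(* Square integrability on a bounded interval gives integrability: [intB] with the constant 1. *)
have iX : mu.-integrable B (EFin \o X).
  by apply: eq_integrable (intB _ (uc_cst _ _ 1)) => // y _ /=; rewrite mul1r.
have uI : uc (- T) T I.
  pose N := \int[mu]_(y in B) `|X y|.
  have N0 : 0 <= N by apply: Rintegral_ge0.
  move=> e e0; have N1 : 0 < N + 1 by rewrite ltr_wpDl.
  have [d d0 hd] := @k_uc2 _ T _ Kc _ (divr_gt0 e0 N1).
  exists d => // x x' xT x'T xx; rewrite !IB//.
  rewrite -RintegralB//; [|exact: intB (uc_sub _ tr (kshift_uc x))|exact: intB (uc_sub _ tr (kshift_uc x'))].
  have uD : uc (- T) t (fun y => K (x + y) - K (x' + y)).
    by apply: ucB; apply: uc_sub (kshift_uc _).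
  have iD : mu.-integrable B (EFin \o (fun y => K (x + y) * X y - K (x' + y) * X y)).
    by apply: eq_integrable (intB _ uD) => // y _ /=; rewrite mulrBl.
  apply: le_lt_trans (le_normr_Rintegral _ iD) _ => //.
  apply: (@le_lt_trans _ _ (\int[mu]_(y in B) (e / (N + 1) * `|X y|))).
    apply: le_Rintegral => //.
    - exact: integrable_norm iD.
    - have := integrable_norm (intB _ (uc_cst (- T) t (e / (N + 1)))).
      by apply: eq_integrable => // y _ /=; rewrite normrM gtr0_norm ?divr_gt0.
    - move=> y /=; rewrite in_itv/= => /andP[yl yt].
      rewrite -mulrBl normrM ler_wpM2r// ltW// hd ?subrr ?normr0//.
      + by rewrite yl (le_trans (ltW yt)).
      + by rewrite yl (le_trans (ltW yt)).
  rewrite RintegralZl//; last exact: integrable_norm iX.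
  by rewrite -/N mulrAC ltr_pdivrMr// ltr_pM2l// ltrDl.
have uu : uc (- T) T u by apply: ucB; [exact: kt_uc|exact: ucZ].
have Xu : ae_on t (fun y => X y = (u \_ B) y).
  apply: ae_onS XE => y yt.
  rewrite real_KopE ?ltW// -rmorphM/= -rmorphD/= indicE mem_set ?mul1r; last by rewrite /= in_itv/= ltW.
  move=> /eqP; rewrite eq_complex/= eqxx andbT => /eqP /(canRL (addrK _)) ->.
  rewrite -/(I y) restrictE; have [yT|yT] := leP (- T) y.
    by rewrite mem_set//= in_itv/= yT yt.
  rewrite memNset/=; last by rewrite in_itv/= leNgt yT.
  rewrite ku_out// /I Rintegral0 ?mulr0 ?subr0// => z /=; rewrite in_itv/= => zt.
  by rewrite ku_out ?mul0r// (le_trans (ltW zt)).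
have uE x : `|x| <= T -> u x + eps * kop T K t u x = K (x + t).
  by move=> xT; rewrite /u /kop -(ae_on_K_int x X2 uu Xu) -/(I x) subrK.
apply: ae_onS Xu => y _ ->.
rewrite !restrictE; case: ifP => // /set_mem/=; rewrite in_itv/= => /andP[yl yt].
by rewrite -(res_uniq T0 Kc inj e2 tP uu uE)// ler_norml yl (le_trans (ltW yt)).
Qed.

(** The integral defining [phi] depends only on the class of the solution selected by [phi_sol]. *)
Lemma phi_itg x : phi K eps t x =
  K (x + t) - eps * itg (- T) t (fun y => K (x + y) * rphi eps t y).
Proof.
have XP : is_phi_sol K eps t (phi_sol K eps t).
  exact: (xgetPex (fun=> 0) (ex_intro _ _ rphi_sol)).
rewrite /phi (ae_on_K_int x XP.1 (rphi_uc T0 Kc inj e2 tP))//; exact: phi_sol_uniq.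
Qed.

Lemma phi_rphi x : `|x| <= T -> phi K eps t x = rphi eps t x.
Proof. by move=> xT; rewrite phi_itg -(rphiE T0 Kc inj e2 tP xT) addrK. Qed.

End fixed_t.


Lemma det_row0 n (M : 'M[R]_n) i : (forall j, M i j = 0) -> \det M = 0.
Proof.
by move=> M0; rewrite (expand_det_row _ i) big1// => j _; rewrite M0 mul0r.
Qed.

(** A point below [- T] gives a zero row, as its sum with any point up to [T] is negative. *)
Lemma fredholm_int0 t n (s : seq R) x : t <= T -> (forall y, y \in s -> y <= T) -> x \in s -> x < - T ->
  fredholm_int k `]-oo, t[ n s = 0.
Proof.
move=> tT; elim: n s => [|n IH] s sT xs xT /=.
  have ix : (index x s < size s)%N by rewrite index_mem.
  apply: (@det_row0 _ _ (Ordinal ix)) => j; rewrite mxE /= nth_index//.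
  by rewrite ku_out// sT// mem_nth.
apply: Rintegral0 => y /=; rewrite in_itv/= => yt; apply: IH => //.
  move=> z; rewrite inE => /orP[/eqP ->|/sT//]; exact: le_trans (ltW yt) tT.
by rewrite inE xs orbT.
Qed.

(** Points below [- T] contribute nothing, and the determinant does not depend on whether new points
    are put in front of [s] or behind it. *)
Lemma fredholm_intE t n (s : seq R) : - T <= t <= T -> boxed T s ->
  fredholm_int k `]-oo, t[ n s = iint T t n (fun l => fdet k (s ++ l)).
Proof.
move=> tP; have [tl tr] := andP tP.
elim: n s => [|n IH] s sT /=; first by rewrite cats0.
have nf := nice_fdet (Kbound1 T Kc) (@k_uc2 _ T _ Kc) (@KboundP _ T K Kc).
pose F x := iint T t n (fun l => fdet k (s ++ x :: l)).
have uF : uc (- T) T F.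
  by have := uc_iint T0' tP (nice_cat sT (erefl (size s)) (nf (size s + n.+1)%N)).
rewrite -/(itg (- T) t F) -tail_itg//; last exact: uc_sub uF.
apply: eq_Rintegral => x; rewrite inE/= in_itv/= restrictE => xt.
have [xT|xT] := leP (- T) x.
  rewrite mem_set/=; last by rewrite in_itv/= xT.
  have xT' : `|x| <= T by rewrite ler_norml xT (le_trans (ltW xt)).
  rewrite IH; last exact: boxed_cons.
  apply: eq_iint => l _; apply: fdet_perm.
  by rewrite -cat_rcons perm_cat2r perm_sym perm_rcons.
rewrite memNset/=; last by rewrite in_itv/= leNgt xT.
apply: (@fredholm_int0 _ _ _ x) => //; last by rewrite inE eqxx.
move=> y; rewrite inE => /orP[/eqP ->|/(nthP 0)[i _ <-]]; first by rewrite (le_trans (ltW xt)).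
exact: le_trans (ler_norm _) (sT i).
Qed.

Lemma detK_dser t lam : - T <= t <= T -> detK K t lam = dser T lam k t 0.
Proof.
move=> tP; rewrite /detK /fredholm_det /dser /gsum; congr (limn (series _)).
apply/funext => n; rewrite fredholm_intE//; last exact: boxed_nil.
by rewrite /fcoef bin0 mul1r subn0 mulrAC mulrA.
Qed.

Hypothesis noeig : forall t, - T <= t <= T -> ~ Kop_eigenvalue K t 1 /\ ~ Kop_eigenvalue K t (-1).

Lemma noeig_inj eps t : eps * eps = 1 -> - T <= t <= T -> kinj T K eps t.
Proof. by move=> e2 tP; apply: noeig_kinj e2 => //; exact: noeig. Qed.

Notation rmu := (rmu T K).

Lemma mufun_rmu t : - T <= t <= T -> mufun K t = rmu t.
Proof.
move=> tP; rewrite /mufun /rmu; have tT : `|t| <= T by rewrite ler_norml.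
congr (_ + _); apply: phi_rphi => //; by [exact: noeig_inj|rewrite ?mulrNN mulr1|exact: noeig].
Qed.

Lemma mfun_rmu t : 0 <= t <= T -> mfun_of K t = expR (itg 0 t rmu).
Proof.
move=> tP; congr expR; apply: eq_Rintegral => s; rewrite inE/= in_itv/= => sP.
by apply: mufun_rmu; move: T0; lra.
Qed.

Lemma rmu_uc : uc (- T) T rmu.
Proof.
by apply: ucD; apply: (rphi_diag_uc T0 Kc noeig_inj); rewrite ?mulrNN mulr1.
Qed.

Lemma rphi_diag0 eps t : eps * eps = 1 -> - T <= t <= 0 -> rphi T K eps t t = 0.
Proof.
move=> e2 tP; have tP' : - T <= t <= T by move: T0; lra.
have tT : `|t| <= T by rewrite ler_norml.
have := rphiE T0 Kc noeig_inj e2 tP' tT; rewrite /kop (K0 (x := t + t)); last by move: tP; lra.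
rewrite (_ : itg _ _ _ = 0) ?mulr0 ?addr0// -(itg0 (- T) t).
by apply: itg_eq => y yP; rewrite K0 ?mul0r//; move: tP; lra.
Qed.

(** The exponents of the two determinants are integrals from [- T]; the part over [[-T, 0]] is 0 by
    [rphi_diag0], which leaves the integral from 0 defining [m]. *)
Lemma mfun_detK t : 0 <= t <= T -> mfun_of K t = detK K t 1 / detK K t (-1).
Proof.
move=> tP; have tP' : - T <= t <= T by move: T0; lra.
have [t0 tT] := andP tP; have [tl tr] := andP tP'.
have m11 : (-1 : R) * -1 = 1 by rewrite mulrNN mulr1.
have u1 := rphi_diag_uc T0 Kc noeig_inj (mulr1 1).
have u2 := rphi_diag_uc T0 Kc noeig_inj m11.
rewrite mfun_rmu// !detK_dser// !(dser_exp T0 Kc noeig_inj)//; last exact: mulr1.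
rewrite -expRN -expRD; congr expR; rewrite mul1r mulN1r opprK.
rewrite -itgD; [|exact: uc_sub u1|exact: uc_sub u2].
rewrite -/rmu [RHS](@itg_cat _ _ 0 _)//; last first.
- exact: uc_sub rmu_uc.
- by rewrite oppr_le0.
rewrite [X in _ = X + _](_ : _ = 0) ?add0r//.
transitivity (itg (- T) 0 (fun=> 0 : R)); last exact: itg0.
apply: itg_eq => s sP.
by rewrite /rmu !rphi_diag0 ?addr0// ?mulr1.
Qed.

End bridge.

(** * Fourier transforms on half-lines *)

Section exponential_tails.
Context {R : realType}.
Notation mu := (@lebesgue_measure R).
Implicit Types (h : R -> R) (a b d x y M N : R).

Lemma cvg_expRN_pinfty d : 0 < d -> expR (- (d * x)) @[x --> +oo] --> (0 : R).
Proof.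
move=> d0; apply/cvgrPdist_lt => e e0; near=> x.
rewrite sub0r normrN ger0_norm ?expR_ge0//.
have x1 : ln e^-1 / d < x by near: x; apply: nbhs_pinfty_gt; rewrite num_real.
rewrite expRN -[X in _ < X]invrK ltf_pV2 ?posrE ?expR_gt0 ?invr_gt0//.
rewrite -(@lnK _ e^-1) ?posrE ?invr_gt0// ltr_expR.
by rewrite mulrC -ltr_pdivrMr.
Unshelve. all: by end_near. Qed.

Lemma exp_tail d a : 0 < d ->
  (\int[mu]_(x in `[a, +oo[) (expR (- (d * x)))%:E)%E = (expR (- (d * a)) / d)%:E.
Proof.
move=> d0.
have D x : is_derive x 1 (fun x => - d^-1 * expR (- (d * x))) (expR (- (d * x))).
  apply: (@dw_is_derive _ (x - 1) (x + 1)); first by rewrite ltrBlDr !ltrDl ltr01.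
  have did : dw (x - 1) (x + 1) (fun y => - (d * y)) x (- d).
    move=> e e0; exists 1 => // y _ _.
    have E : - (d * y) - - (d * x) - (y - x) * - d = 0 by ring.
    by rewrite E normr0 mulr_ge0// ltW.
  have := dwZ (- d^-1) (dw_expR did).
  by rewrite mulrA mulrNN mulVf ?mul1r// gt_eqF.
have cexp : continuous (fun x => expR (- (d * x))).
  move=> x; apply: (@continuous_comp _ _ _ (fun x => - (d * x)) expR); last exact: continuous_expR.
  by apply: cvgN; apply: cvgM; [exact: cvg_cst|exact: cvg_id].
rewrite (@ge0_continuous_FTC2y _ _ (fun x => - d^-1 * expR (- (d * x))) _ 0).
- by rewrite -EFinB; congr _%:E; rewrite mulNr sub0r opprK mulrC.
- by move=> x _; exact: expR_ge0.
- exact: continuous_subspaceT.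
- rewrite -[X in _ --> X](mulr0 (- d^-1)); apply: cvgM; first exact: cvg_cst.
  exact: cvg_expRN_pinfty.
- by move=> x _; have [] := D x.
- by apply: cvg_at_right_filter; apply: cvgM; [exact: cvg_cst|exact: cexp].
- by move=> x _; rewrite derive1E; have [_ ->] := D x.
Qed.

Lemma exp_tail_integrable d a : 0 < d -> mu.-integrable `[a, +oo[ (EFin \o (fun x => expR (- (d * x)))).
Proof.
move=> d0; apply/integrableP; split.
  apply/measurable_EFinP; apply: measurable_funTS; apply: continuous_measurable_fun => x.
  apply: (@continuous_comp _ _ _ (fun x => - (d * x)) expR); last exact: continuous_expR.
  by apply: cvgN; apply: cvgM; [exact: cvg_cst|exact: cvg_id].
have -> : (\int[mu]_(x in `[a, +oo[) `|(EFin \o (fun x => expR (- (d * x)))) x| =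
    \int[mu]_(x in `[a, +oo[) (expR (- (d * x)))%:E)%E.
  by apply: eq_integral => x _ /=; rewrite ger0_norm ?expR_ge0.
by rewrite exp_tail// ltry.
Qed.

Lemma integrable_scale (D : set R) k h : measurable D -> mu.-integrable D (EFin \o h) ->
  mu.-integrable D (EFin \o (fun x => k * h x)).
Proof.
move=> mD ih; have ikh : mu.-integrable D (fun x => (k%:E * (EFin \o h) x)%E) by apply: integrableZl.
by apply: eq_integrable ikh => // x _ /=; rewrite EFinM.
Qed.

Lemma tail_integrable h d M a : continuous h -> 0 < d ->
  (forall x, a <= x -> `|h x| <= M * expR (- (d * x))) -> mu.-integrable `[a, +oo[ (EFin \o h).
Proof.
move=> hc d0 hM.
apply: (le_integrable _ _ _ (integrable_scale M (measurable_itv _) (exp_tail_integrable a d0))) => //.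
- by apply/measurable_EFinP; apply: measurable_funTS; exact: continuous_measurable_fun.
- move=> x /=; rewrite in_itv/= andbT => ax.
  by rewrite lee_fin (le_trans (hM x ax))// ler_norm.
Qed.

(** The remainder is dominated by that of the exponential; this explicit rate serves in place of
    limits over half-lines below. *)
Lemma tail_lim h d M a N : continuous h -> 0 < d -> a <= N ->
  (forall x, a <= x -> `|h x| <= M * expR (- (d * x))) ->
  `|\int[mu]_(x in `]a, +oo[) h x - itg a N h| <= M * (expR (- (d * N)) / d).
Proof.
move=> hc d0 aN hM; have ih := tail_integrable hc d0 hM.
have mh (D : set R) : measurable_fun D h.
  by apply: measurable_funTS; exact: continuous_measurable_fun.
have hMN x : N <= x -> `|h x| <= M * expR (- (d * x)) by move=> Nx; apply: hM; exact: le_trans Nx.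
have ihN := tail_integrable hc d0 hMN.
have ihN' : mu.-integrable `]N, +oo[ (EFin \o h).
  by apply: integrableS ihN => //; apply: subset_itvr; rewrite bnd_simp.
rewrite Rintegral_itv_obnd_cbnd; last first.
  by apply: integrableS ih => //; apply: subset_itvr; rewrite bnd_simp.
rewrite (Rintegral_itvB (x := N) ih) ?bnd_simp// Rintegral_itv_obnd_cbnd//.
apply: le_trans (le_normr_Rintegral _ ihN) _ => //.
have iE := exp_tail_integrable N d0.
apply: (@le_trans _ _ (\int[mu]_(x in `[N, +oo[) (M * expR (- (d * x))))).
  apply: le_Rintegral => //.
  - exact: integrable_norm ihN.
  - exact: integrable_scale.
  - by move=> x /=; rewrite in_itv/= andbT; exact: hMN.
by rewrite RintegralZl// /Rintegral exp_tail.
Qed.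

Lemma uc_continuous h : (forall N, 0 < N -> uc (- N) N h) -> continuous h.
Proof.
move=> H x; apply/cvgrPdist_lt => e e0.
have N0 : 0 < `|x| + 1 by rewrite ltr_wpDl.
have [d d0 hd] := H _ N0 e e0; apply/nbhs_ballP; exists (Num.min d 1).
  by rewrite /= lt_min d0 ltr01.
move=> y /=; rewrite /ball/= lt_min => /andP[xyd xy1].
apply: hd => //; rewrite -ler_norml; first by rewrite lerDl.
by rewrite -[y](subKr x) (le_trans (ler_normB _ _))// lerD2l ltW.
Qed.

End exponential_tails.

(** * Integrals of complex-valued functions and the exponentials [e^{izx}] *)

Section complex_integral.
Context {R : realType}.
Implicit Types (a b x y : R) (f g : R -> R[i]) (h : R -> R) (z w : R[i]).

Definition cuc a b f := uc a b (fun x => complex.Re (f x)) /\ uc a b (fun x => complex.Im (f x)).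

Definition citg a b f : R[i] :=
  itg a b (fun x => complex.Re (f x)) +i* itg a b (fun x => complex.Im (f x)).

Lemma cuc_sub a b a' b' f : a' <= a -> b <= b' -> cuc a' b' f -> cuc a b f.
Proof. by move=> aa bb [fr fi]; split; [apply: uc_sub fr|apply: uc_sub fi]. Qed.

Lemma cuc_cst a b w : cuc a b (fun=> w).
Proof. by split; exact: uc_cst. Qed.

Lemma cuc_real a b h : uc a b h -> cuc a b (fun x => (h x)%:C).
Proof. by move=> uh; split=> //; exact: uc_cst. Qed.

Lemma cucM a b f g : cuc a b f -> cuc a b g -> cuc a b (fun x => f x * g x).
Proof.
move=> [fr fi] [gr gi]; split.
  apply: (uc_eq (g := fun x => complex.Re (f x) * complex.Re (g x) - complex.Im (f x) * complex.Im (g x))).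
    by move=> x _; rewrite ReM.
  by apply: ucB; exact: ucM.
apply: (uc_eq (g := fun x => complex.Re (f x) * complex.Im (g x) + complex.Im (f x) * complex.Re (g x))).
  by move=> x _; rewrite ImM.
by apply: ucD; exact: ucM.
Qed.

Lemma cucD a b f g : cuc a b f -> cuc a b g -> cuc a b (fun x => f x + g x).
Proof.
move=> [fr fi] [gr gi]; split.
  by apply: uc_eq (ucD fr gr) => x _; rewrite ReD.
by apply: uc_eq (ucD fi gi) => x _; rewrite ImD.
Qed.

Lemma cucZ a b w f : cuc a b f -> cuc a b (fun x => w * f x).
Proof. by apply: cucM; exact: cuc_cst. Qed.

Lemma cucB a b f g : cuc a b f -> cuc a b g -> cuc a b (fun x => f x - g x).
Proof.
move=> uf ug; apply: cucD => //.
have -> : (fun x => - g x) = (fun x => -1 * g x) by apply/funext => x; rewrite mulN1r.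
exact: cucZ.
Qed.

Lemma citg_eq a b f g : (forall x, a <= x <= b -> f x = g x) -> citg a b f = citg a b g.
Proof. by move=> E; congr (_ +i* _); apply: itg_eq => x xP; rewrite E. Qed.

Lemma citgD a b f g : cuc a b f -> cuc a b g ->
  citg a b (fun x => f x + g x) = citg a b f + citg a b g.
Proof.
move=> [fr fi] [gr gi]; apply: complex_ext; rewrite ?ReD ?ImD /= -itgD//; apply: itg_eq => x _.
  by rewrite ReD.
by rewrite ImD.
Qed.

Lemma citgZ a b w f : cuc a b f -> citg a b (fun x => w * f x) = w * citg a b f.
Proof.
move=> [fr fi]; apply: complex_ext; rewrite ?ReM ?ImM /= -!itgZ// -?itgB -?itgD; try exact: ucZ.
  by apply: itg_eq => x _; rewrite ReM.
by apply: itg_eq => x _; rewrite ImM.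
Qed.

Lemma citgB a b f g : cuc a b f -> cuc a b g ->
  citg a b (fun x => f x - g x) = citg a b f - citg a b g.
Proof.
move=> uf ug; have := citgD uf (cucZ (-1) ug); rewrite citgZ// mulN1r => <-.
by apply: citg_eq => x _; rewrite mulN1r.
Qed.

Lemma citg0 a b : citg a b (fun=> 0) = 0.
Proof. by rewrite /citg /= itg0. Qed.

Lemma citg_bound a b f (M : R) : a <= b -> cuc a b f ->
  (forall x, a <= x <= b -> cn (f x) <= M) -> cn (citg a b f) <= 2 * ((b - a) * M).
Proof.
move=> ab [fr fi] fM; apply: le_trans (cn_ReIm _) _; rewrite mulr2n mulrDl !mul1r.
apply: lerD; apply: itg_bound => // x xP; apply: le_trans (fM x xP).
  exact: cn_Re.
exact: cn_Im.
Qed.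

Lemma citg_cat a b x f : a <= b -> b <= x -> cuc a x f -> citg a x f = citg a b f + citg b x f.
Proof. by move=> ab bx [fr fi]; apply: complex_ext; rewrite ?ReD ?ImD /= -itg_cat. Qed.

Lemma citg_fubini a b x y (f : R -> R -> R[i]) : a <= b -> x <= y ->
  uc2 a b x y (fun s r => complex.Re (f s r)) -> uc2 a b x y (fun s r => complex.Im (f s r)) ->
  citg a b (fun s => citg x y (f s)) = citg x y (fun r => citg a b (f^~ r)).
Proof. by move=> ab xy fr fi; apply: complex_ext; rewrite /= itg_fubini. Qed.

Lemma itg_shift a b y h : a <= b -> continuous h ->
  itg a b (fun x => h (x + y)) = itg (a + y) (b + y) h.
Proof.
move=> ab hc; have uh (p q : R) : uc p q h by exact: uc_cont.
have us : uc a b (fun x => h (x + y)).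
  move=> e /(uh (a + y) (b + y))[d d0 hd]; exists d => // p q pP qP pq.
  by apply: hd; rewrite ?lerD2r// opprD addrACA subrr addr0.
rewrite -(@ftc2 _ a b (fun x => itg (a + y) (x + y) h) _ ab us).
  by rewrite itg_pt subr0.
move=> x xP e e0.
have [|d d0 hd] := dw_itg (uh (a + y) (b + y)) (x := x + y) _ e0; first by rewrite !lerD2r.
exists d => // p pP px; have := hd (p + y).
rewrite !lerD2r (_ : p + y - (x + y) = p - x); last by ring.
exact.
Qed.

Lemma citg_shift a b y f : a <= b -> continuous (fun x => complex.Re (f x)) ->
  continuous (fun x => complex.Im (f x)) ->
  citg a b (fun x => f (x + y)) = citg (a + y) (b + y) f.
Proof.
move=> ab fr fi; congr (_ +i* _).
  exact: (itg_shift y ab fr).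
exact: (itg_shift y ab fi).
Qed.

Lemma eizD z x y : eiz z (x + y) = eiz z x * eiz z y.
Proof. by rewrite /eiz -expCD rmorphD/= mulrDr. Qed.

Lemma eiz0 z : eiz z 0 = 1.
Proof. by rewrite /eiz mulr0 expC0. Qed.

Lemma eizNl z x : eiz (- z) x = eiz z (- x).
Proof. by rewrite /eiz rmorphN/= !mulrN mulNr. Qed.

Lemma cn_eiz z x : cn (eiz z x) = expR (- (complex.Im z * x)).
Proof.
rewrite /eiz cn_expC; congr expR; case: z => p q /=.
by rewrite !(mul0r, mulr0, mul1r, subr0, sub0r, addr0, add0r) mulNr.
Qed.

Lemma Re_realM x w : complex.Re (x%:C * w) = x * complex.Re w.
Proof. by rewrite ReM /= mul0r subr0. Qed.

Lemma Im_realM x w : complex.Im (x%:C * w) = x * complex.Im w.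
Proof. by rewrite ImM /= mul0r addr0. Qed.

Lemma eiz_taylor z x y : cn ('i%C * z) * `|y - x| <= 2^-1 ->
  cn (eiz z y - eiz z x - (y - x)%:C * ('i%C * z * eiz z x)) <=
    expR (- (complex.Im z * x)) * (16 * (cn ('i%C * z) * `|y - x|) ^+ 2).
Proof.
move=> h; have := @expC_taylor _ ('i%C * z * (y - x)%:C); rewrite cnM cnR => /(_ h) H.
have -> : eiz z y = eiz z x * expC ('i%C * z * (y - x)%:C) by rewrite -/(eiz z (y - x)) -eizD subrKC.
rewrite (_ : _ - _ = eiz z x * (expC ('i%C * z * (y - x)%:C) - 1 - 'i%C * z * (y - x)%:C)); last by ring.
by rewrite cnM cn_eiz ler_pM2l ?expR_gt0.
Qed.

Lemma eiz_dw z a b x : dw a b (fun x => complex.Re (eiz z x)) x (complex.Re ('i%C * z * eiz z x)) /\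
  dw a b (fun x => complex.Im (eiz z x)) x (complex.Im ('i%C * z * eiz z x)).
Proof.
pose N := cn ('i%C * z) + 1; have N0 : 0 < N by rewrite ltr_wpDl ?cn_ge0.
pose B := expR (- (complex.Im z * x)) * (16 * N ^+ 2).
have B0 : 0 < B by rewrite mulr_gt0 ?expR_gt0// mulr_gt0// exprn_gt0.
have key e : 0 < e -> exists2 d, 0 < d & forall y, a <= y <= b -> `|y - x| < d ->
    cn (eiz z y - eiz z x - (y - x)%:C * ('i%C * z * eiz z x)) <= e * `|y - x|.
  move=> e0; exists (Num.min (2^-1 / N) (e / B)).
    by rewrite lt_min !divr_gt0// invr_gt0.
  move=> y _; rewrite lt_min !ltr_pdivlMr// => /andP[/ltW h1 /ltW h2].
  have NN : cn ('i%C * z) <= N by rewrite lerDl.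
  apply: le_trans (eiz_taylor _) _.
    by rewrite (le_trans _ h1)// mulrC ler_wpM2l.
  apply: (@le_trans _ _ (B * `|y - x| ^+ 2)).
    rewrite /B -[X in _ <= X]mulrA ler_pM2l ?expR_gt0// -[X in _ <= X]mulrA ler_pM2l//.
    rewrite -[X in _ <= X]exprMn.
    by rewrite lerXn2r ?nnegrE ?mulr_ge0 ?cn_ge0 ?(ltW N0)// ler_wpM2r.
  by rewrite expr2 mulrA ler_wpM2r// mulrC.
by split=> e /key[d d0 hd]; exists d => // y yP yx; apply: le_trans (hd y yP yx);
  [apply: le_trans (cn_Re _)|apply: le_trans (cn_Im _)];
  rewrite ?(ReD, ReN, Re_realM, ImD, ImN, Im_realM).
Qed.

Lemma dw_continuous h (l : R -> R) : (forall a b x, dw a b h x (l x)) -> continuous h.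
Proof. by move=> H; apply: uc_continuous => N _; apply: (@dw_uc _ _ _ _ l) => x _; exact: H. Qed.

Lemma eiz_continuous z : continuous (fun x => complex.Re (eiz z x)) /\
  continuous (fun x => complex.Im (eiz z x)).
Proof.
by split; apply: dw_continuous => a b x; have [] := eiz_dw z a b x; [move=> + _|move=> _]; exact.
Qed.

Lemma eiz_cuc z a b : cuc a b (eiz z).
Proof. by have [cr ci] := eiz_continuous z; split; exact: uc_cont. Qed.

End complex_integral.

Section fourier_tail.
Context {R : realType}.
Notation mu := (@lebesgue_measure R).
Implicit Types (h : R -> R) (a b d x y M N : R) (z : R[i]).

Lemma realC_continuous h z : continuous h ->
  continuous (fun x => complex.Re ((h x)%:C * eiz z x)) /\
  continuous (fun x => complex.Im ((h x)%:C * eiz z x)).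
Proof.
move=> hc; have [cr ci] := eiz_continuous z; split.
  have -> : (fun x => complex.Re ((h x)%:C * eiz z x)) = (fun x => h x * complex.Re (eiz z x)).
    by apply/funext => x; rewrite Re_realM.
  by move=> x; apply: cvgM; [exact: hc|exact: cr].
have -> : (fun x => complex.Im ((h x)%:C * eiz z x)) = (fun x => h x * complex.Im (eiz z x)).
  by apply/funext => x; rewrite Im_realM.
by move=> x; apply: cvgM; [exact: hc|exact: ci].
Qed.

Lemma shift_continuous h y : continuous h -> continuous (fun x => h (x + y)).
Proof.
move=> hc x; apply: (@continuous_comp _ _ _ (fun x => x + y) h); last exact: hc.
by apply: cvgD; [exact: cvg_id|exact: cvg_cst].
Qed.

Lemma ctail_lim h z d M a N : continuous h -> 0 < d -> a <= N ->
  (forall x, a <= x -> cn ((h x)%:C * eiz z x) <= M * expR (- (d * x))) ->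
  cn (Cintegral `]a, +oo[ (fun x => (h x)%:C * eiz z x) - citg a N (fun x => (h x)%:C * eiz z x))
    <= 2 * (M * (expR (- (d * N)) / d)).
Proof.
move=> hc d0 aN hM; have [cr ci] := realC_continuous z hc.
apply: le_trans (cn_ReIm _) _; rewrite mulr2n mulrDl !mul1r ReD ImD ReN ImN.
apply: lerD.
  by apply: (@tail_lim _ (fun x => complex.Re ((h x)%:C * eiz z x))) => // x ax; apply: le_trans (cn_Re _) (hM x ax).
by apply: (@tail_lim _ (fun x => complex.Im ((h x)%:C * eiz z x))) => // x ax; apply: le_trans (cn_Im _) (hM x ax).
Qed.

Lemma fourier_half h z : (forall x, x <= 0 -> h x = 0) ->
  fourier h z = Cintegral `]0, +oo[ (fun x => (h x)%:C * eiz z x).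
Proof.
move=> h0; rewrite /fourier /Cintegral; congr (_ +i* _);
  rewrite Rintegral_mkcond [RHS]Rintegral_mkcond; apply: eq_Rintegral => x _;
  rewrite !restrictE mem_set//; case: ifPn => //; rewrite notin_setE/= in_itv/= andbT => /negP;
  by rewrite -leNgt => /h0 ->; rewrite !mul0r ?subrr ?addr0.
Qed.

End fourier_tail.

(** * The Fourier transform of the extended solution *)

Section transform.
Context {R : realType}.
Notation mu := (@lebesgue_measure R).
Variables (T : R) (K : R -> R) (c M : R).
Hypotheses (T0 : 0 < T) (Kc : continuous K) (K0 : forall x : R, x <= 0 -> K x = 0).
Hypotheses (c0 : 0 <= c) (KM : forall x, `|K x| <= M * expR (c * `|x|)).
Implicit Types (x y N t s eps : R).

Let TT : - T <= T. Proof. by move: T0; lra. Qed.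

Let M0 : 0 <= M.
Proof. by have := KM 0; rewrite normr0 mulr0 expR0 mulr1; exact: le_trans. Qed.

Lemma K_growth x : 0 <= x -> `|K x| <= M * expR (c * x).
Proof. by move=> x0; have := KM x; rewrite (ger0_norm x0). Qed.

Section fixed_z.
Variable z : R[i].
Hypothesis zc : c < complex.Im z.
Notation d := (complex.Im z - c).
Notation e := (eiz z).
Notation FK := (fourier K z).
Notation P S := (citg 0 S (fun x => (K x)%:C * e x)).

Let d0 : 0 < d. Proof. by rewrite subr_gt0. Qed.

Lemma expR_growth x : expR (c * x) * expR (- (complex.Im z * x)) = expR (- (d * x)).
Proof. by rewrite -expRD; congr expR; ring. Qed.

Lemma Ke_growth x : 0 <= x -> cn ((K x)%:C * e x) <= M * expR (- (d * x)).
Proof.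
move=> x0; rewrite cnM cnR cn_eiz -expR_growth mulrA.
by apply: ler_wpM2r; [exact: expR_ge0|exact: K_growth].
Qed.

Lemma P_tail S : 0 <= S -> cn (FK - P S) <= 2 * (M * (expR (- (d * S)) / d)).
Proof. by move=> S0; rewrite fourier_half//; apply: ctail_lim => // x; exact: Ke_growth. Qed.

Lemma fourier_bound : cn FK <= 2 * (M / d).
Proof.
have := P_tail (lexx 0); rewrite (_ : P 0 = 0); last by rewrite /citg !itg_pt.
by rewrite subr0 mulr0 oppr0 expR0 div1r.
Qed.

(** After the shift by [y] the integral starts at [- T + y <= 0], and [K] vanishes from there to
    0. *)
Lemma K_conv N y : T <= N -> `|y| <= T ->
  citg (- T) N (fun x => (K (x + y))%:C * e x) = e (- y) * P (N + y).
Proof.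
move=> TN; rewrite ler_norml => /andP[yl yr].
have [cr ci] := realC_continuous z Kc.
have cK (p q : R) : cuc p q (fun x => (K x)%:C * e x) by split; exact: uc_cont.
have TN' : - T <= N by exact: le_trans TT TN.
transitivity (citg (- T) N (fun x => e (- y) * ((K (x + y))%:C * e (x + y)))).
  apply: citg_eq => x _; rewrite (eizD z x) mulrCA; congr (_ * _).
  by rewrite mulrCA -eizD addNr eiz0 mulr1.
have us : cuc (- T) N (fun x => (K (x + y))%:C * e (x + y)).
  by split; apply: uc_cont; [exact: (@shift_continuous _ (fun x => complex.Re ((K x)%:C * e x)) y cr)|
    exact: (@shift_continuous _ (fun x => complex.Im ((K x)%:C * e x)) y ci)].
rewrite citgZ//; congr (_ * _).
rewrite (citg_shift y TN' cr ci) (@citg_cat _ _ 0)//; [|by move: yr; lra|by move: yl TN; lra].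
rewrite [X in X + _](_ : _ = 0) ?add0r// -(citg0 (- T + y) 0).
by apply: citg_eq => x /andP[_ x0]; rewrite K0// mul0r.
Qed.

End fixed_z.

Lemma citg_real a b (h : R -> R) : citg a b (fun x => (h x)%:C) = (itg a b h)%:C.
Proof. by rewrite /citg /= itg0. Qed.

Variables (t eps B : R) (f : R -> R).
Hypotheses (tP : - T <= t <= T) (uf : uc (- T) T f) (fB : forall y, `|y| <= T -> `|f y| <= B).

Let tl : - T <= t. Proof. by case/andP: tP. Qed.
Let tr : t <= T. Proof. by case/andP: tP. Qed.
Let tT : `|t| <= T. Proof. by rewrite ler_norml. Qed.
Let B0 : 0 <= B. Proof. exact: le_trans (normr_ge0 _) (fB tT). Qed.
Let uft : uc (- T) t f. Proof. exact: uc_sub uf. Qed.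
Let yT y : - T <= y <= t -> `|y| <= T. Proof. exact: itv_norm. Qed.

(** The formula extending a solution to the whole line, for an abstract [f]; its growth is that of
    [K], so its transform converges for [Im z > c]. *)
Definition pext x := K (x + t) - eps * itg (- T) t (fun y => K (x + y) * f y).

Lemma K_uc2 N : uc2 (- N) N (- T) T (fun x y => K (x + y)).
Proof.
move=> e e0; have [d d0 hd] := uc_cont (- (N + T)) (N + T) Kc e0.
exists (d / 2) => [|x x' y y' xP x'P yP y'P xx yy]; first by rewrite divr_gt0.
apply: hd; [lra|lra|].
rewrite (_ : _ - _ = (x - x') + (y - y')); last by ring.
by rewrite (le_lt_trans (ler_normD _ _))// (splitr d) ltrD.
Qed.

Lemma K_rect_bound N : exists L, forall x y, - N <= x <= N -> - T <= y <= T -> `|K (x + y)| <= L.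
Proof.
have [L L0 hL] := uc_bounded (uc_cont (- (N + T)) (N + T) Kc).
by exists L => x y xP yP; apply: hL; lra.
Qed.

Lemma Kf_uc2 N : uc2 (- N) N (- T) T (fun x y => K (x + y) * f y).
Proof. by have [L hL] := K_rect_bound N; exact: (uc2Mr (@K_uc2 N) hL uf). Qed.

Lemma pext_continuous : continuous pext.
Proof.
apply: uc_continuous => N N0; apply: ucB.
  by apply: uc_cont; exact: shift_continuous.
by apply: ucZ; apply: uc2_itg => //; apply: uc2_sub (@Kf_uc2 N).
Qed.

Lemma K_shift_growth x y : `|y| <= T -> `|K (x + y)| <= M * expR (c * T) * expR (c * x).
Proof.
rewrite ler_norml => /andP[_ yr]; have [xy|xy] := leP (x + y) 0.
  by rewrite K0// normr0 !mulr_ge0 ?expR_ge0.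
apply: le_trans (K_growth (ltW xy)) _; rewrite -mulrA -expRD -mulrDr.
by apply: ler_wpM2l => //; rewrite ler_expR; apply: ler_wpM2l => //; rewrite [T + x]addrC lerD2l.
Qed.

Definition pextC := M * expR (c * T) * (1 + `|eps| * ((t - - T) * B)).

Lemma pext_growth x : `|pext x| <= pextC * expR (c * x).
Proof.
rewrite /pext (le_trans (ler_normB _ _))// /pextC mulrDr mulr1 [X in _ <= X]mulrDl.
apply: lerD; first exact: K_shift_growth.
rewrite normrM mulrCA -[X in _ <= X]mulrA; apply: ler_wpM2l => //.
have -> : M * expR (c * T) * ((t - - T) * B) * expR (c * x) =
  (t - - T) * ((M * expR (c * T) * expR (c * x)) * B) by ring.
apply: itg_bound => //.
  apply: ucM => //; apply: uc_cont => y; rewrite (_ : (fun y => K (x + y)) = (fun y => K (y + x))).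
    exact: shift_continuous.
  by apply/funext => s; rewrite addrC.
by move=> y yP; rewrite normrM ler_pM// ?K_shift_growth ?fB// yT.
Qed.

(** For [f = rphi eps t] this is [a(t, z)] when [eps = 1] and [b(t, z)] when [eps = -1]. *)
Definition wfun (z : R[i]) : R[i] :=
  eiz z t - eps%:C * citg (- T) t (fun y => (f y)%:C * eiz z y).

Section fixed_z.
Variable z : R[i].
Hypothesis zc : c < complex.Im z.
Notation d := (complex.Im z - c).
Notation e := (eiz z).
Notation FK := (fourier K z).
Notation P S := (citg 0 S (fun x => (K x)%:C * e x)).
Let Q N y := citg (- T) N (fun x => (K (x + y))%:C * e x).

Let d0 : 0 < d. Proof. by rewrite subr_gt0. Qed.

Lemma Kfe_uc2 N : T <= N ->
  uc2 (- T) N (- T) T (fun x y => K (x + y) * f y * complex.Re (e x)) /\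
  uc2 (- T) N (- T) T (fun x y => K (x + y) * f y * complex.Im (e x)).
Proof.
move=> TN; have [L hL] := K_rect_bound N.
have hLB x y : - N <= x <= N -> - T <= y <= T -> `|K (x + y) * f y| <= L * B.
  by move=> xP yP; rewrite normrM ler_pM ?hL// fB// ler_norml.
have [cr ci] := eiz_cuc z (- N) N.
by split; apply: (@uc2_sub _ _ _ _ _ (- N) N (- T) T); rewrite ?lerN2//; apply: (uc2Ml (@Kf_uc2 N) hLB).
Qed.

Lemma Ke_uc2 N : T <= N ->
  uc2 (- T) N (- T) T (fun x y => K (x + y) * complex.Re (e x)) /\
  uc2 (- T) N (- T) T (fun x y => K (x + y) * complex.Im (e x)).
Proof.
move=> TN; have [L hL] := K_rect_bound N.
have [cr ci] := eiz_cuc z (- N) N.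
by split; apply: (@uc2_sub _ _ _ _ _ (- N) N (- T) T); rewrite ?lerN2//; apply: (uc2Ml (@K_uc2 N) hL).
Qed.

Lemma Q_cuc N : T <= N -> cuc (- T) T (Q N).
Proof.
move=> TN; have [kr ki] := Ke_uc2 TN; have TN' : - T <= N by exact: le_trans TT TN.
split.
  apply: (uc_eq (g := fun y => itg (- T) N (fun x => K (x + y) * complex.Re (e x)))).
    by move=> y _; apply: itg_eq => x _; rewrite Re_realM.
  exact: (uc2_itg TN' (uc2_sym kr)).
apply: (uc_eq (g := fun y => itg (- T) N (fun x => K (x + y) * complex.Im (e x)))).
  by move=> y _; apply: itg_eq => x _; rewrite Im_realM.
exact: (uc2_itg TN' (uc2_sym ki)).
Qed.

Lemma pext_citg N : T <= N -> citg (- T) N (fun x => (pext x)%:C * e x) =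
  Q N t - eps%:C * citg (- T) t (fun y => (f y)%:C * Q N y).
Proof.
move=> TN; have TN' : - T <= N by exact: le_trans TT TN.
pose F x y := (K (x + y) * f y)%:C * e x.
have [fr fi] := Kfe_uc2 TN.
have uK y (p q : R) : cuc p q (fun x => (K (x + y))%:C * e x).
  apply: cucM; last exact: eiz_cuc.
  by apply: cuc_real; apply: uc_cont; exact: shift_continuous.
have uKf x : uc (- T) t (fun y => K (x + y) * f y).
  apply: ucM => //; apply: uc_cont => y; rewrite (_ : (fun y => K (x + y)) = (fun y => K (y + x))).
    exact: shift_continuous.
  by apply/funext => s; rewrite addrC.
have FE x : (itg (- T) t (fun y => K (x + y) * f y))%:C * e x = citg (- T) t (F x).
  rewrite mulrC -citg_real -citgZ; last exact: cuc_real.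
  by apply: citg_eq => y _; rewrite mulrC.
have uI : cuc (- T) N (fun x => (itg (- T) t (fun y => K (x + y) * f y))%:C * e x).
  apply: cucM; last exact: eiz_cuc.
  apply: cuc_real; apply: uc2_itg => //; apply: uc2_sub (@Kf_uc2 N) => //.
  by rewrite lerN2.
transitivity (citg (- T) N (fun x => (K (x + t))%:C * e x -
    eps%:C * ((itg (- T) t (fun y => K (x + y) * f y))%:C * e x))).
  by apply: citg_eq => x _; rewrite /pext rmorphB/= rmorphM/= mulrBl mulrA.
rewrite citgB//; last exact: cucZ.
congr (_ - _); rewrite citgZ//; congr (_ * _).
transitivity (citg (- T) N (fun x => citg (- T) t (F x))); first by apply: citg_eq => x _; rewrite FE.
rewrite citg_fubini//.
- apply: citg_eq => y _; rewrite /Q -citgZ//; apply: citg_eq => x _.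
  by rewrite /F rmorphM/= mulrAC mulrC mulrA [_%:C * _%:C]mulrC; ring.
- by apply: (uc2_sub (lexx _) (lexx _) (lexx _) tr) => e' /fr[r r0 hr]; exists r => // *; rewrite !Re_realM hr.
- by apply: (uc2_sub (lexx _) (lexx _) (lexx _) tr) => e' /fi[r r0 hr]; exists r => // *; rewrite !Im_realM hr.
Qed.

Let Imz0 : 0 < complex.Im z. Proof. exact: le_lt_trans zc. Qed.

(** The rate in [N] is uniform in [y], so it survives integration against [f]. *)
Lemma Q_lim N y : T <= N -> `|y| <= T -> cn (FK * e (- y) - Q N y) <=
  expR (complex.Im z * T) * (2 * (M * (expR (d * T) / d))) * expR (- (d * N)).
Proof.
move=> TN yT'; rewrite /Q K_conv// (mulrC FK) -mulrBr cnM cn_eiz mulrN opprK -mulrA.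
have /andP[yl yr] : - T <= y <= T by rewrite -ler_norml.
apply: ler_pM; rewrite ?expR_ge0 ?cn_ge0//.
  by rewrite ler_expR ler_pM2l.
apply: le_trans (P_tail _ _) _ => //; first by move: yl TN; lra.
rewrite -[X in _ <= X]mulrA ler_pM2l// -[X in _ <= X]mulrA; apply: ler_wpM2l => //.
rewrite [X in _ <= X]mulrAC ler_pM2r ?invr_gt0// -expRD ler_expR.
rewrite mulrDr opprD addrC lerD2r -mulrN ler_pM2l//.
by rewrite lerNl.
Qed.

(** Formally the transform of [K(. + y)] over [[-T, oo[] is [FK e^{-izy}], and integration against
    [f] produces [FK wfun(- z)]. Both sides are compared on [[-T, N]], where Fubini applies, with an
    error [C e^{-dN}] tending to 0. *)
Lemma pext_fourier : Cintegral `]t, +oo[ (fun x => (pext x)%:C * e x) =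
  FK * wfun (- z) - citg (- T) t (fun x => (pext x)%:C * e x).
Proof.
pose X := Cintegral `]t, +oo[ (fun x => (pext x)%:C * e x).
pose Y := citg (- T) t (fun x => (pext x)%:C * e x).
pose E := expR (complex.Im z * T) * (2 * (M * (expR (d * T) / d))).
have E0 : 0 <= E by rewrite !mulr_ge0 ?expR_ge0 ?invr_ge0 ?(ltW d0).
(* The three summands bound the tails of [pext], of [K(. + t)], and of [K(. + y)] integrated against
   [f]. *)
pose C := 2 * (pextC * d^-1) + (E + `|eps| * (2 * ((t - - T) * (B * E)))).
have up (p q : R) : cuc p q (fun x => (pext x)%:C * e x).
  apply: cucM; last exact: eiz_cuc.
  by apply: cuc_real; apply: uc_cont; exact: pext_continuous.
have key N : T <= N -> cn (X - (FK * wfun (- z) - Y)) <= C * expR (- (d * N)).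
  move=> TN; have tN : t <= N by exact: le_trans TN.
  pose I := citg t N (fun x => (pext x)%:C * e x).
  have YI : Y + I = Q N t - eps%:C * citg (- T) t (fun y => (f y)%:C * Q N y).
    by rewrite -pext_citg// -citg_cat.
  have uef : cuc (- T) t (fun y => (f y)%:C * eiz (- z) y).
    by apply: cucM; [exact: cuc_real|exact: eiz_cuc].
  have uQ : cuc (- T) t (Q N) by apply: cuc_sub (Q_cuc TN).
  have ufQ : cuc (- T) t (fun y => (f y)%:C * Q N y) by apply: cucM => //; exact: cuc_real.
  have -> : X - (FK * wfun (- z) - Y) = (X - I) -
      ((FK * e (- t) - Q N t) - eps%:C * citg (- T) t (fun y => (f y)%:C * (FK * e (- y) - Q N y))).
    rewrite -[X in _ - (_ - _ * X)](_ : FK * citg (- T) t (fun y => (f y)%:C * eiz (- z) y) -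
        citg (- T) t (fun y => (f y)%:C * Q N y) = _); last first.
      rewrite -citgZ// -citgB//; last exact: cucZ.
      by apply: citg_eq => y _; rewrite eizNl; ring.
    have -> : I = Q N t - eps%:C * citg (- T) t (fun y => (f y)%:C * Q N y) - Y by rewrite -YI; ring.
    by rewrite /wfun eizNl; ring.
  apply: le_trans (cnB _ _) _; rewrite /C mulrDl; apply: lerD.
    have -> : 2 * (pextC / d) * expR (- (d * N)) = 2 * (pextC * (expR (- (d * N)) / d)) by ring.
    apply: ctail_lim => //; first exact: pext_continuous.
    move=> x _; rewrite cnM cnR cn_eiz -expR_growth mulrA.
    by apply: ler_wpM2r; [exact: expR_ge0|exact: pext_growth].
  apply: le_trans (cnB _ _) _; rewrite mulrDl; apply: lerD; first exact: Q_lim.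
  rewrite cnM cnR -[X in _ <= X]mulrA; apply: ler_wpM2l => //.
  have -> : 2 * ((t - - T) * (B * E)) * expR (- (d * N)) = 2 * ((t - - T) * (B * (E * expR (- (d * N))))) by ring.
  apply: citg_bound => //.
    apply: cucM; first exact: cuc_real.
    apply: cucB => //; apply: cucZ.
    rewrite (_ : (fun y => e (- y)) = eiz (- z)); first exact: eiz_cuc.
    by apply/funext => y; rewrite eizNl.
  move=> y yP; rewrite cnM cnR; apply: ler_pM; rewrite ?cn_ge0//; first by rewrite fB// yT.
  by apply: Q_lim => //; exact: yT.
have C0 : 0 <= C.
  by rewrite -(pmulr_lge0 _ (expR_gt0 (- (d * T)))); apply: le_trans (cn_ge0 _) (key T (lexx _)).
apply/eqP; rewrite -subr_eq0 -cn_eq0 eq_le cn_ge0 andbT; apply/ler_addgt0Pr => r r0.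
rewrite add0r; have /cvgrPdist_lt/(_ _ (divr_gt0 r0 (ltr_wpDl C0 ltr01))) := cvg_expRN_pinfty d0.
move=> near_r; have [N [TN hN]] : exists N, T <= N /\ `|0 - expR (- (d * N))| < r / (C + 1).
  have /filter_ex[N [H1 H2]] : \forall N \near +oo, T <= N /\ `|0 - expR (- (d * N))| < r / (C + 1).
    by apply: filterI => //; apply: nbhs_pinfty_ge; rewrite num_real.
  by exists N.
apply: le_trans (key N TN) _; move: hN; rewrite sub0r normrN ger0_norm ?expR_ge0//.
rewrite ltr_pdivlMr ?ltr_wpDl// => /ltW; apply: le_trans; rewrite mulrC ler_wpM2l ?expR_ge0//.
by rewrite lerDl.
Qed.

End fixed_z.
End transform.

(** * The canonical system *)

Section sharp_fourier.
Context {R : realType}.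
Notation mu := (@lebesgue_measure R).
Implicit Types (E : R[i] -> R[i]) (rho K : R -> R) (c x : R) (z w : R[i]).

(* valid without integrability: the integral of a nonintegrable function is 0
   once made finite *)
Lemma Rintegral_opp (D : set R) (f : R -> R) :
  \int[mu]_(x in D) (- f x) = - \int[mu]_(x in D) f x.
Proof.
rewrite /Rintegral.
have -> : (\int[mu]_(x in D) (- f x)%:E = \int[mu]_(x in D) (\- (EFin \o f)) x)%E.
  by apply: eq_integral => x _; rewrite /= EFinN.
rewrite (integralE mu D (\- (EFin \o f))%E) funeposN funenegN.
rewrite [X in _ = - fine X](integralE mu D (EFin \o f)).
move: (integral _ _ _) (integral _ _ _) => [a| |] [b| |] //=; rewrite ?oppr0//.
by rewrite opprB.
Qed.

Lemma conjcB z w : conjc (z - w) = conjc z - conjc w.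
Proof. exact: (rmorphB (@conjc R)). Qed.

Lemma conjcM z w : conjc (z * w) = conjc z * conjc w.
Proof. exact: (rmorphM (@conjc R)). Qed.

Lemma conjcR x : conjc x%:C = x%:C :> R[i].
Proof. by apply: complex_ext; rewrite /= ?oppr0. Qed.

Lemma conj_eiz z x : conjc (eiz z x) = eiz (- conjc z) x.
Proof.
rewrite /eiz /expC; case: z => p q; apply: complex_ext => /=.
  by congr (expR _ * _); [ring|rewrite -cosN; congr cos; ring].
by rewrite -mulrN; congr (expR _ * _); [ring|rewrite -sinN; congr sin; ring].
Qed.

Lemma Re_conj z : complex.Re (conjc z) = complex.Re z. Proof. by case: z. Qed.
Lemma Im_conj z : complex.Im (conjc z) = - complex.Im z. Proof. by case: z. Qed.

Lemma conj_citg a b (f : R -> R[i]) : cuc a b f -> conjc (citg a b f) = citg a b (fun x => conjc (f x)).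
Proof.
move=> [fr fi]; apply: complex_ext; rewrite ?Re_conj ?Im_conj /citg /=.
  by apply: itg_eq => x _; rewrite Re_conj.
by rewrite -[LHS]mulN1r -itgZ//; apply: itg_eq => x _; rewrite Im_conj mulN1r.
Qed.

(** As [rho] is real, conjugation acts on the exponential alone. *)
Lemma K1_sharp E rho z : K1 E rho -> sharp E z = E (- z).
Proof.
case=> _ _ _ Efour; rewrite /sharp !Efour /fourier.
have ReC g : complex.Re (Cintegral setT g) = \int[mu]_x complex.Re (g x) by [].
have ImC g : complex.Im (Cintegral setT g) = \int[mu]_x complex.Im (g x) by [].
have eE x : eiz (- z) x = conjc (eiz (conjc z) x) by rewrite conj_eiz conjcK.
apply: complex_ext; rewrite ?Re_conj ?Im_conj ?ReC ?ImC.
  by apply: eq_Rintegral => x _; rewrite !Re_realM eE Re_conj.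
by rewrite -Rintegral_opp; apply: eq_Rintegral => x _; rewrite !Im_realM eE Im_conj mulrN.
Qed.

Lemma entire_lip E z : entire E -> exists M d, [/\ 0 < M, 0 < d &
  forall h, cn h < d -> cn (E (z + h) - E z) <= M * cn h].
Proof. by move=> /entireP/(_ z)[l /cdiff_lip]. Qed.

(* at a zero of E the identity is obtained from nearby points, where the Fourier
   transform of K stays bounded *)
Lemma sharp_fourierE E rho K c z : entire E -> K1 E rho -> K2 E K c ->
  (forall x, x <= 0 -> K x = 0) -> c < complex.Im z -> E (- z) = E z * fourier K z.
Proof.
move=> eE hK1 [Kc c0 [M KM] [z1 Ez1] ThE] K0 zc.
have nz w : c < complex.Im w -> E w != 0 -> E (- w) = E w * fourier K w.
  by move=> wc Ew; rewrite -ThE// /Theta (K1_sharp _ hK1) mulrC divfK.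
have [Ez0|] := eqVneq (E z) 0; last exact: nz.
rewrite Ez0 mul0r; apply/eqP/negPn/negP => Enz.
have [M1 [d1 [M10 d10 h1]]] := entire_lip z eE.
have [M2 [d2 [M20 d20 h2]]] := entire_lip (- z) eE.
pose d := complex.Im z - c; have d0 : 0 < d by rewrite subr_gt0.
have M0 : 0 <= M by have := KM 0; rewrite normr0 mulr0 expR0 mulr1; exact: le_trans.
pose B := M2 + M1 * (2 * (M / (d / 2))).
have B0 : 0 < B by rewrite ltr_wpDr// !mulr_ge0// ?invr_ge0 ?divr_ge0// ltW.
have a0 : 0 < cn (E (- z)) by rewrite cn_gt0.
(* Within [r] of [z] both Lipschitz estimates hold, [Im w - c] stays above [d / 2], and
   [B * cn h < cn (E (- z))], which is the contradiction sought. *)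
pose r := Num.min (Num.min d1 d2) (Num.min (d / 2) (cn (E (- z)) / B)).
have r0 : 0 < r by rewrite !lt_min d10 d20 !divr_gt0.
(* The zeros of [E] fill no disc, as [E] is not identically 0. *)
have [w [wr Ew]] : exists w, cn (w - z) < r /\ E w != 0.
  apply: contrapT => H; move: Ez1; rewrite (@identity_theorem _ E z r eE r0) ?eqxx// => w wr.
  by apply/eqP/negPn/negP => Ew; apply: H; exists w.
pose h := w - z; have wE : w = z + h by rewrite /h addrC subrK.
move: wr; rewrite !lt_min => /andP[/andP[hd1 hd2] /andP[hd3 hd4]].
have Imw : d / 2 < complex.Im w - c.
  rewrite wE ImD; have := le_lt_trans (cn_Im h) hd3; rewrite ltr_norml /d; lra.
have wc : c < complex.Im w by rewrite -subr_gt0 (lt_trans _ Imw)// divr_gt0.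
have := nz w wc Ew => Ewn.
have b1 : cn (E w) <= M1 * cn h by have := h1 h hd1; rewrite Ez0 subr0 -wE.
have b2 : cn (E (- w) - E (- z)) <= M2 * cn h.
  by have := h2 (- h); rewrite !cnN -opprD -wE; exact.
have b3 : cn (fourier K w) <= 2 * (M / (d / 2)).
  apply: le_trans (fourier_bound Kc K0 KM wc) _; rewrite ler_pM2l//.
  by apply: ler_wpM2l => //; rewrite lef_pV2 ?posrE ?divr_gt0 ?subr_gt0// ltW.
have : cn (E (- z)) <= B * cn h.
  have := cnB (E (- w)) (E (- w) - E (- z)); rewrite subKr => /le_trans; apply.
  rewrite addrC mulrDl; apply: lerD => //.
  by rewrite Ewn cnM mulrAC; apply: ler_pM; rewrite ?cn_ge0.
by rewrite leNgt mulrC -ltr_pdivlMr// hd4.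
Qed.

End sharp_fourier.

(** * The functions [a] and [b] in the variable [z] *)

Section wfun_calculus.
Context {R : realType}.
Implicit Types (z w h : R[i]) (x y t eps : R).

Lemma entire_eiz x : entire (fun z : R[i] => eiz z x).
Proof.
apply: (@entire_comp _ (fun z => 'i%C * z * x%:C) expC); last exact: entire_expC.
apply: (@entireM _ (fun z => 'i%C * z) (fun=> x%:C)); last exact: entire_cst.
by apply: (@entireM _ (fun=> 'i%C) id); [exact: entire_cst|exact: entire_id].
Qed.

Lemma eiz_shift z h x : eiz (z + h) x = eiz z x * expC ('i%C * h * x%:C).
Proof. by rewrite /eiz -expCD; congr expC; ring. Qed.

Variables (T t : R) (f : R -> R).
Hypotheses (T0 : 0 < T) (tP : - T <= t <= T) (uf : uc (- T) T f).
Let tl : - T <= t. Proof. by case/andP: tP. Qed.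
Let tr : t <= T. Proof. by case/andP: tP. Qed.

Lemma cuc_f : cuc (- T) t (fun y => (f y)%:C).
Proof. by apply: cuc_real; apply: uc_sub uf. Qed.

Lemma cuc_fe z : cuc (- T) t (fun y => (f y)%:C * eiz z y).
Proof. by apply: cucM; [exact: cuc_f|exact: eiz_cuc]. Qed.

(** Differentiation under the integral sign: the second-order error of the exponential is
    [O((cn h)^2)] uniformly in [y]. *)
Lemma entire_citg : entire (fun z => citg (- T) t (fun y => (f y)%:C * eiz z y)).
Proof.
apply/entireP => z.
have cy : cuc (- T) t (fun y => ('i%C * y%:C : R[i])).
  by apply: cucZ; apply: cuc_real; exact: uc_id.
exists (citg (- T) t (fun y => 'i%C * y%:C * ((f y)%:C * eiz z y))) => e e0.
have [F F0 hF] := uc_bounded uf.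
pose B := 2 * ((t - - T) * (F * (expR (`|complex.Im z| * T) * (16 * T ^+ 2)))).
have B0 : 0 <= B.
  have h0 : 0 <= t - - T by rewrite subr_ge0.
  rewrite /B; apply: mulr_ge0 => //; apply: mulr_ge0 => //; apply: mulr_ge0; first exact: ltW.
  by apply: mulr_ge0; [exact: expR_ge0|rewrite mulr_ge0 ?sqr_ge0].
exists (Num.min (2^-1 / T) (e / (B + 1))).
  by rewrite lt_min !divr_gt0// ?invr_gt0// ltr_wpDl.
move=> h; rewrite lt_min !ltr_pdivlMr ?ltr_wpDl// => /andP[/ltW hT /ltW hB].
rewrite (mulrC (citg _ _ _)) -citgZ; last by apply: cucM => //; exact: cuc_fe.
rewrite -citgB; [|exact: cuc_fe..].
rewrite -citgB; last 2 first.
- by apply: cucB; exact: cuc_fe.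
- by apply: cucZ; apply: cucM => //; exact: cuc_fe.
apply: (@le_trans _ _ (2 * ((t - - T) * (F * (expR (`|complex.Im z| * T) * (16 * (cn h * T) ^+ 2)))))).
  apply: citg_bound => //.
    apply: cucB; first by apply: cucB; exact: cuc_fe.
    by apply: cucZ; apply: cucM => //; exact: cuc_fe.
  move=> y yP; have yT : `|y| <= T by exact: itv_norm yP.
  rewrite (_ : _ - _ = (f y)%:C * (eiz z y * (expC ('i%C * h * y%:C) - 1 - 'i%C * h * y%:C))); last first.
    by rewrite eiz_shift; ring.
  rewrite !cnM cnR cn_eiz; apply: ler_pM; rewrite ?mulr_ge0 ?expR_ge0 ?cn_ge0//.
    by apply: hF; rewrite -ler_norml.
  apply: ler_pM; rewrite ?expR_ge0 ?cn_ge0//.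
    rewrite ler_expR (le_trans (ler_norm _))// normrN normrM ler_wpM2l//.
  have cT : cn ('i%C * h * y%:C) <= cn h * T.
    by rewrite !cnM cni mul1r cnR; apply: ler_wpM2l => //; exact: cn_ge0.
  apply: le_trans (expC_taylor (le_trans cT hT)) _; rewrite ler_pM2l//.
  by rewrite lerXn2r ?nnegrE ?cn_ge0// mulr_ge0 ?cn_ge0// ltW.
rewrite (_ : 2 * _ = cn h * B * cn h); last by rewrite /B exprMn !expr2; ring.
apply: ler_wpM2r; first exact: cn_ge0.
by apply: le_trans hB; apply: ler_wpM2l; rewrite ?cn_ge0// lerDl.
Qed.

Lemma entire_wfun eps : entire (wfun T t eps f).
Proof.
apply: (@entireB _ (fun z => eiz z t)); first exact: entire_eiz.
by apply: (@entireM _ (fun=> eps%:C)); [exact: entire_cst|exact: entire_citg].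
Qed.

Lemma conj_wfun eps z : conjc (wfun T t eps f z) = wfun T t eps f (- conjc z).
Proof.
rewrite /wfun conjcB conj_eiz conjcM conjcR conj_citg; last exact: cuc_fe.
congr (_ - _ * _); apply: citg_eq => x _.
by rewrite conjcM conj_eiz conjcR.
Qed.

Lemma Re_wfun eps z : complex.Re (wfun T t eps f z) =
  complex.Re (eiz z t) - eps * itg (- T) t (fun y => f y * complex.Re (eiz z y)).
Proof.
rewrite ReD ReN Re_realM; congr (_ - _ * _).
by apply: itg_eq => y _; rewrite Re_realM.
Qed.

Lemma Im_wfun eps z : complex.Im (wfun T t eps f z) =
  complex.Im (eiz z t) - eps * itg (- T) t (fun y => f y * complex.Im (eiz z y)).
Proof.
rewrite ImD ImN Im_realM; congr (_ - _ * _).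
by apply: itg_eq => y _; rewrite Im_realM.
Qed.

Lemma wfunM eps z w : w * wfun T t eps f z =
  w * eiz z t - eps%:C * citg (- T) t (fun y => (f y)%:C * (w * eiz z y)).
Proof.
rewrite mulrBr [w * (_ * _)]mulrCA -(citgZ w); last exact: cuc_fe.
by congr (_ - _ * _); apply: citg_eq => y _; rewrite mulrCA.
Qed.

End wfun_calculus.

(** * One-sided derivatives of complex functions of a real variable *)

Section complex_dw.
Context {R : realType}.
Implicit Types (F G : R -> R[i]) (a b x : R) (l k : R[i]).

Definition cdw a b F x l :=
  dw a b (fun y => complex.Re (F y)) x (complex.Re l) /\
  dw a b (fun y => complex.Im (F y)) x (complex.Im l).

Lemma cdw_ext a b F G x l : (forall y, a <= y <= b -> F y = G y) -> a <= x <= b ->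
  cdw a b F x l -> cdw a b G x l.
Proof.
by move=> FG xP [fr fi]; split; [apply: dw_ext fr|apply: dw_ext fi] => // y yP; rewrite FG.
Qed.

Lemma cdw_cst a b k x : cdw a b (fun=> k) x 0.
Proof. by split; exact: dw_cst. Qed.

Lemma cdw_real a b (h : R -> R) x (l : R) : dw a b h x l -> cdw a b (fun y => (h y)%:C) x l%:C.
Proof. by split=> //; exact: dw_cst. Qed.

Lemma cdwD a b F G x l k : cdw a b F x l -> cdw a b G x k -> cdw a b (fun y => F y + G y) x (l + k).
Proof.
move=> [fr fi] [gr gi]; split; rewrite ?ReD ?ImD.
  by have := dwD fr gr; congr dw; apply/funext => y; rewrite ReD.
by have := dwD fi gi; congr dw; apply/funext => y; rewrite ImD.
Qed.

Lemma cdwM a b F G x l k : cdw a b F x l -> cdw a b G x k ->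
  cdw a b (fun y => F y * G y) x (l * G x + F x * k).
Proof.
move=> [fr fi] [gr gi]; split.
  have := dwB (dwM fr gr) (dwM fi gi); congr dw.
    by apply/funext => y; rewrite ReM.
  by rewrite ReD !ReM; ring.
have := dwD (dwM fr gi) (dwM fi gr); congr dw.
  by apply/funext => y; rewrite ImM.
by rewrite ImD !ImM; ring.
Qed.

Lemma cdwZ a b F x l k : cdw a b F x l -> cdw a b (fun y => k * F y) x (k * l).
Proof. by move=> /(cdwM (cdw_cst a b k x)); rewrite mul0r add0r. Qed.

Lemma cdw_sub a b a' b' F x l : a' <= a -> b <= b' -> cdw a' b' F x l -> cdw a b F x l.
Proof. by move=> aa bb [fr fi]; split; [apply: dw_sub fr|apply: dw_sub fi]. Qed.

End complex_dw.

Section one_sided_topology.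
Context {R : realType}.
Implicit Types (I : set R) (T t s : R) (F G : R -> R[i]) (l k : R[i]).

Lemma cdw_cn a b F t l : cdw a b F t l -> forall e, 0 < e -> exists2 d, 0 < d &
  forall s, a <= s <= b -> `|s - t| < d -> cn (F s - F t - (s - t)%:C * l) <= e * `|s - t|.
Proof.
move=> [fr fi] e e0; have e20 : 0 < e / 2 by rewrite divr_gt0.
have [d1 d10 h1] := fr _ e20; have [d2 d20 h2] := fi _ e20.
exists (Num.min d1 d2); first by rewrite lt_min d10.
move=> s sP; rewrite lt_min => /andP[s1 s2].
apply: le_trans (cn_ReIm _) _; rewrite (splitr e) mulrDl; apply: lerD.
  by rewrite ReD ReN ReD ReN Re_realM; exact: h1.
by rewrite ImD ImN ImD ImN Im_realM; exact: h2.
Qed.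

(** Points of [I] are nonnegative and [t < T], so near [t] they lie in [[0, T]], where [cdw] gives
    information. *)
Lemma cdw_quotient I T t F l : (forall s, I s -> 0 <= s) -> t < T -> cdw 0 T F t l ->
  forall e : R, 0 < e -> \forall s \near t^', I s -> cn (l - ((s - t)^-1)%:C * (F s - F t)) <= e.
Proof.
move=> I0 tT /cdw_cn H e e0; have [d d0 hd] := H e e0.
apply/nbhs_ballP; exists (Num.min d (T - t)); first by rewrite /= lt_min d0 subr_gt0.
move=> s; rewrite /ball/= distrC lt_min => /andP[sd sT] st Is.
have st0 : 0 < `|s - t| by rewrite normr_gt0 subr_eq0.
rewrite -(ler_pM2r st0); apply: le_trans (hd s _ sd); last first.
  by rewrite I0//= -(lerD2r (- t)) (le_trans (ler_norm _))// ltW.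
rewrite -cnR -cnM -cnN le_eqVlt; apply/orP; left; apply/eqP; congr cn.
rewrite mulrBl mulrAC -rmorphM/= mulVf ?subr_eq0// mul1r opprB.
by rewrite (mulrC l).
Qed.

Lemma cdw_has_derivative I T t F l : (forall s, I s -> 0 <= s) -> t < T -> cdw 0 T F t l ->
  has_derivative_in I (F : R -> R[i]^o) t l.
Proof.
move=> I0 tT H; apply/cvgrPdist_le => e e0; have [eE e0'] := pos_complex e0.
rewrite eE; have := cdw_quotient I0 tT H e0'; apply: filterS => s h Is.
by rewrite cnE lecR; exact: h.
Qed.

Lemma mx_norm_le (M : 'cV[R[i]]_2) (e : R[i]) : 0 <= e -> (forall i j, `|M i j| <= e) -> `|M| <= e.
Proof.
move=> e0 H; change (mx_norm M <= e).
by have [->//|/mx_norm_neq0[i ->]] := eqVneq (mx_norm M) 0.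
Qed.

Lemma cdw_col2_derivative I T t F G l k : (forall s, I s -> 0 <= s) -> t < T ->
  cdw 0 T F t l -> cdw 0 T G t k ->
  has_derivative_in I (fun s => col2 (F s) (G s)) t (col2 l k).
Proof.
move=> I0 tT HF HG; apply/cvgrPdist_le => e e0; have [eE e0'] := pos_complex e0.
apply: filterS2 (cdw_quotient I0 tT HF e0') (cdw_quotient I0 tT HG e0').
move=> s hF hG Is; apply: mx_norm_le; first exact: ltW.
move=> i j; rewrite !mxE eE; case: ifP => _; rewrite cnE lecR; [exact: hF|exact: hG].
Qed.

Lemma cdw_continuous I T t F l : (forall s, I s -> 0 <= s) -> t < T -> cdw 0 T F t l ->
  (F s : R[i]^o) @[s --> within I (nbhs t)] --> (F t : R[i]^o).
Proof.
move=> I0 tT /cdw_cn H; apply/cvgrPdist_le => e e0; have [eE e0'] := pos_complex e0.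
have [d d0 hd] := H 1 ltr01; pose N := 1 + cn l; have N0 : 0 < N by rewrite ltr_wpDr ?cn_ge0.
apply/nbhs_ballP; exists (Num.min (Num.min d (T - t)) (cn e / N)).
  by rewrite /= !lt_min d0 subr_gt0 tT divr_gt0.
move=> s; rewrite /ball/= distrC !lt_min => /andP[/andP[sd sT] sN] Is.
rewrite eE cnE lecR cn_dist.
have sP : 0 <= s <= T by rewrite I0//= -(lerD2r (- t)) (le_trans (ler_norm _))// ltW.
have := hd s sP sd; rewrite mul1r => h.
rewrite (_ : F s - F t = (F s - F t - (s - t)%:C * l) + (s - t)%:C * l); last by ring.
apply: le_trans (cnD _ _) _; apply: (@le_trans _ _ (N * `|s - t|)).
  by rewrite /N mulrDl mul1r lerD// cnM cnR mulrC.
by rewrite mulrC -ler_pdivlMr// ltW.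
Qed.

Lemma limit_point_set0 (X : topologicalType) : limit_point (set0 : set X) = set0.
Proof.
apply/seteqP; split=> // x /(_ setT filterT) [y [_ []]].
Qed.

(** The derivative [F'] is itself differentiable along the domain, hence continuous: the set of
    break points is empty, and both one-sided limits of [F'] at [t] are [F' t]. *)
Lemma cdw_piecewise_C1 (tau : \bar R) F F' :
  (forall t, dom tau t -> exists T, t < T /\ cdw 0 T F t (F' t)) ->
  (forall t, dom tau t -> exists T l, t < T /\ cdw 0 T F' t l) ->
  piecewise_C1 (dom tau) F.
Proof.
have I0 s : dom tau s -> 0 <= s by case.
move=> HF HF'; exists set0, F'; split.
- by rewrite limit_point_set0 set0I.
- move=> t td _; have [T [tT h]] := HF t td; have [T' [l [tT' h']]] := HF' t td; split.
    exact: cdw_has_derivative tT h.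
  exact: cdw_continuous tT' h'.
- move=> t td; have [T' [l [tT' h']]] := HF' t td.
  have H := cdw_continuous I0 tT' h'.
  split; exists (F' t); apply: cvg_trans H; apply: cvg_app => P h.
    by apply: (@filterS _ (nbhs t) _ _ _ _ h) => s Ps _ Is; exact: Ps.
  by apply: (@filterS _ (nbhs t) _ _ _ _ h) => s Ps _ Is; exact: Ps.
Qed.

End one_sided_topology.

Section conjugation.
Context {R : realType}.
Implicit Types (z w : R[i]).

Lemma conjcD z w : conjc (z + w) = conjc z + conjc w.
Proof. exact: (rmorphD (@conjc R)). Qed.

Lemma conjcN z : conjc (- z) = - conjc z.
Proof. exact: (rmorphN (@conjc R)). Qed.

Lemma conjc2V : conjc (2^-1 : R[i]) = 2^-1.
Proof.
have -> : (2^-1 : R[i]) = (2^-1 : R)%:C by rewrite fmorphV rmorph_nat.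
exact: conjcR.
Qed.

Lemma conjci : conjc ('i%C : R[i]) = - 'i%C.
Proof. by apply: complex_ext; rewrite /= ?oppr0. Qed.

End conjugation.

Section entire_extensions.
Context {R : realType}.
Implicit Types (F G : R[i] -> R[i]) (z : R[i]) (c : R).

(** The half-plane determines an entire function, so any entire candidate is the one selected by
    [xget]. *)
Lemma entire_extensionE c F G z : entire G ->
  (forall z, c < complex.Im z -> G z = F z) -> entire_extension c F z = G z.
Proof.
move=> eG GF.
have ex : exists G', [set G' | entire G' /\ forall z, c < complex.Im z -> G' z = F z] G' by exists G.
have [eH HF] := xgetPex (fun=> 0) ex.
apply: (entire_extension_unique (c := c) eH eG) => w wc; rewrite GF//; exact: HF.
Qed.

Lemma entire_opp F : entire F -> entire (fun z => F (- z)).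
Proof.
move=> eF; apply: (@entire_comp _ (fun z => - z) F _ eF).
have := @entireB _ (fun=> 0) id (entire_cst (k := 0)) (@entire_id R).
by congr entire; apply/funext => z; rewrite sub0r.
Qed.

End entire_extensions.

(** * The canonical system over a fixed box *)

Section fixed_box.
Context {R : realType}.
Variables (E : R[i] -> R[i]) (rho K : R -> R) (c : R).
Hypotheses (eE : entire E) (hK1 : K1 E rho) (hK2 : K2 E K c) (hK3 : K3 K).
Variable T : R.
Hypothesis T0 : 0 < T.
Hypothesis noeig : forall t, - T <= t <= T -> ~ Kop_eigenvalue K t 1 /\ ~ Kop_eigenvalue K t (-1).
Implicit Types (t x eps : R) (z : R[i]).

Let Kc : continuous K. Proof. by case: hK2. Qed.
Let c0 : 0 <= c. Proof. by case: hK2. Qed.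

(** [hK3] concerns [x < 0]; continuity supplies the point 0. *)
Lemma K_nonpos x : x <= 0 -> K x = 0.
Proof.
rewrite le_eqVlt => /predU1P[->|]; last exact: hK3.
apply/eqP/negPn/negP => K00; have e0 : 0 < `|K 0| by rewrite normr_gt0.
have [d d0 hd] := uc_cont (- 1) 1 Kc e0.
have m0 : 0 < Num.min 1 (d / 2) by rewrite lt_min ltr01 divr_gt0.
have m1 : Num.min 1 (d / 2) <= 1 by rewrite ge_min lexx.
have m2 : Num.min 1 (d / 2) <= d / 2 by rewrite ge_min lexx orbT.
move: (Num.min _ _) m0 m1 m2 => m m0 m1 m2.
have Km : K (- m) = 0 by apply: hK3; rewrite oppr_lt0.
have := hd 0 (- m); rewrite Km subr0 sub0r opprK ltxx (gtr0_norm m0) => H.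
by suff : false by []; apply: H; lra.
Qed.

Let inj : forall eps t, eps * eps = 1 -> - T <= t <= T -> kinj T K eps t.
Proof. by apply: noeig_inj => //; exact: K_nonpos. Qed.

Let m1 : (1 : R) * 1 = 1. Proof. exact: mulr1. Qed.
Let m11 : (-1 : R) * -1 = 1. Proof. by rewrite mulrNN mulr1. Qed.

Notation rphi := (rphi T K).
Notation rmu := (rmu T K).

Definition W eps t z := wfun T t eps (rphi eps t) z.

Lemma conj_W eps t z : eps * eps = 1 -> - T <= t <= T -> conjc (W eps t z) = W eps t (- conjc z).
Proof. by move=> e2 tP; apply: conj_wfun => //; exact: rphi_uc. Qed.

Lemma entire_W eps t : eps * eps = 1 -> - T <= t <= T -> entire (W eps t).
Proof. by move=> e2 tP; apply: entire_wfun => //; exact: rphi_uc. Qed.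

(** [E(- z) = E(z) FK] is inserted in [pext_fourier]; on [[-T, t]] the extension is [rphi] itself,
    and its transform there completes [e^{izt}] to [W]. *)
Lemma W_phi eps t z : eps * eps = 1 -> - T <= t <= T -> c < complex.Im z ->
  E z * (eiz z t + eps%:C * Cintegral `]t, +oo[ (fun x => (phi K eps t x)%:C * eiz z x)) =
  E z * W eps t z + eps%:C * (E (- z) * W eps t (- z)).
Proof.
move=> e2 tP zc; have [_ _ [M KM] _ _] := hK2.
have uf := rphi_uc T0 Kc inj e2 tP.
have [B B0 fB] := uc_bounded uf.
have fB' y : `|y| <= T -> `|rphi eps t y| <= B by rewrite ler_norml; exact: fB.
have -> : (fun x => (phi K eps t x)%:C * eiz z x) = (fun x => (pext T K t eps (rphi eps t) x)%:C * eiz z x).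
  by apply/funext => x; rewrite (phi_itg T0 Kc K_nonpos tP e2 inj).
rewrite (pext_fourier T0 Kc K_nonpos c0 KM eps tP uf fB' zc).
rewrite (sharp_fourierE eE hK1 hK2 K_nonpos zc).
have -> : citg (- T) t (fun x => (pext T K t eps (rphi eps t) x)%:C * eiz z x) =
    citg (- T) t (fun x => (rphi eps t x)%:C * eiz z x).
  apply: citg_eq => x xP; have xT : `|x| <= T by exact: itv_norm xP.
  by rewrite /pext -(rphiE T0 Kc inj e2 tP xT) addrK.
by rewrite -/(W eps t (- z)) /W /wfun; ring.
Qed.

(** The right-hand side is entire and agrees with the defining formula on [Im z > c] by [W_phi]. *)
Lemma frakAE t z : - T <= t <= T ->
  frakA E K c t z = 2^-1 * (E z * W 1 t z + E (- z) * W 1 t (- z)).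
Proof.
move=> tP; have eW := entire_W m1 tP.
apply: (@entire_extensionE _ _ _ (fun z => 2^-1 * (E z * W 1 t z + E (- z) * W 1 t (- z)))).
  apply: (@entireM _ (fun=> 2^-1)); first exact: entire_cst.
  apply: (entireD (F := fun z => E z * W 1 t z)); first exact: entireM.
  exact: (entireM (entire_opp eE) (entire_opp eW)).
move=> w wc; have := W_phi m1 tP wc; rewrite !mul1r => <-.
by rewrite mulrA.
Qed.

Lemma frakBE t z : - T <= t <= T ->
  frakB E K c t z = 'i%C * (2^-1 * (E z * W (-1) t z - E (- z) * W (-1) t (- z))).
Proof.
move=> tP; have eW := entire_W m11 tP.
apply: (@entire_extensionE _ _ _ (fun z => 'i%C * (2^-1 * (E z * W (-1) t z - E (- z) * W (-1) t (- z))))).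
  apply: (@entireM _ (fun=> 'i%C)); first exact: entire_cst.
  apply: (@entireM _ (fun=> 2^-1)); first exact: entire_cst.
  apply: (entireB (F := fun z => E z * W (-1) t z)); first exact: entireM.
  exact: (entireM (entire_opp eE) (entire_opp eW)).
move=> w wc; have := W_phi m11 tP wc; rewrite rmorphN1 !mulN1r => <-.
by congr (_ * _); exact: mulrA.
Qed.

(** [rdiag_dw] for the real and imaginary parts of [e^{izx}], whose derivative is [iz e^{izx}], read
    through [rdiag_adjoint]. For [eps = -1] and [eps = 1] these are the equations for [a'] and
    [b']. *)
Lemma W_dw eps t z : eps * eps = 1 -> - T <= t <= T ->
  cdw (- T) T (fun s => W (- eps) s z) t
    ('i%C * z * W eps t z + (eps * rmu t)%:C * W (- eps) t z).
Proof.
move=> e2 tP; have en2 := sqrN1 e2.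
have [cr ci] := eiz_cuc z (- T) T.
have [gr gi] : cuc (- T) T (fun x => 'i%C * z * eiz z x) by apply: cucZ; exact: eiz_cuc.
have uf s e : e * e = 1 -> - T <= s <= T -> uc (- T) T (rphi e s) by move=> *; exact: rphi_uc.
have RW e s : e * e = 1 -> - T <= s <= T ->
    rdiag T K e (fun x => complex.Re (eiz z x)) s = complex.Re (W e s z).
  by move=> ee sP; rewrite (rdiag_adjoint T0 Kc inj ee cr sP) -Re_wfun.
have IW e s : e * e = 1 -> - T <= s <= T ->
    rdiag T K e (fun x => complex.Im (eiz z x)) s = complex.Im (W e s z).
  by move=> ee sP; rewrite (rdiag_adjoint T0 Kc inj ee ci sP) -Im_wfun.
have WM := wfunM tP (uf t eps e2 tP) eps z ('i%C * z); rewrite -/(W eps t z) in WM.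
split.
  have := rdiag_dw T0 Kc K_nonpos inj e2 gr (fun x _ => (eiz_dw z (- T) T x).1) tP.
  rewrite (rdiag_adjoint T0 Kc inj e2 gr tP) RW// => H.
  apply: (dw_ext _ tP); last first.
    rewrite ReD Re_realM WM ReD ReN Re_realM.
    rewrite (_ : complex.Re (citg _ _ _) = itg (- T) t (fun y => rphi eps t y * complex.Re ('i%C * z * eiz z y))).
      by rewrite [eps * rmu t * _]mulrAC; exact: H.
    by apply: itg_eq => y _; rewrite Re_realM.
  by move=> s sP; rewrite RW.
have := rdiag_dw T0 Kc K_nonpos inj e2 gi (fun x _ => (eiz_dw z (- T) T x).2) tP.
rewrite (rdiag_adjoint T0 Kc inj e2 gi tP) IW// => H.
apply: (dw_ext _ tP); last first.
  rewrite ImD Im_realM WM ImD ImN Im_realM.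
  rewrite (_ : complex.Im (citg _ _ _) = itg (- T) t (fun y => rphi eps t y * complex.Im ('i%C * z * eiz z y))).
    by rewrite [eps * rmu t * _]mulrAC; exact: H.
  by apply: itg_eq => y _; rewrite Im_realM.
by move=> s sP; rewrite IW.
Qed.

Lemma box_half t : 0 <= t <= T -> - T <= t <= T.
Proof. by move: T0; lra. Qed.

Lemma m_gt0 t : 0 < mfun_of K t. Proof. exact: expR_gt0. Qed.

Lemma rmu_dw s t : - T <= s -> s <= t <= T -> dw s T (fun r => itg s r rmu) t (rmu t).
Proof. by move=> sT tP; apply: dw_itg tP; apply: uc_sub (rmu_uc T0 Kc K_nonpos noeig). Qed.

Lemma m_dw t : 0 <= t <= T -> dw 0 T (mfun_of K) t (rmu t * mfun_of K t).
Proof.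
move=> tP; apply: (@dw_ext _ _ _ (fun s => expR (itg 0 s rmu)) _ _ _ _ tP); last first.
  rewrite (mfun_rmu T0 Kc K_nonpos noeig tP).
  by apply: dw_expR; apply: rmu_dw => //; rewrite oppr_le0 ltW.
by move=> s sP; rewrite (mfun_rmu T0 Kc K_nonpos noeig sP).
Qed.

Lemma mV_dw t : 0 <= t <= T -> dw 0 T (fun s => (mfun_of K s)^-1) t (- rmu t * (mfun_of K t)^-1).
Proof.
move=> tP; apply: (@dw_ext _ _ _ (fun s => expR (-1 * itg 0 s rmu)) _ _ _ _ tP); last first.
  have -> : - rmu t / mfun_of K t = -1 * rmu t * expR (-1 * itg 0 t rmu).
    by rewrite (mfun_rmu T0 Kc K_nonpos noeig tP) -expRN !mulN1r.
  have T'0 : - T <= 0 by rewrite oppr_le0 ltW.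
  exact: (dw_expR (dwZ (-1) (rmu_dw T'0 tP))).
by move=> s sP; rewrite (mfun_rmu T0 Kc K_nonpos noeig sP) mulN1r expRN.
Qed.

(** [m' = mu m] cancels the term [- mu a]; what is left is [m] times the terms [iz b] at [z] and at
    [- z], that is [z m frakB = z gamma B]. *)
Lemma At_dw t z : 0 <= t <= T ->
  cdw 0 T (fun s => At E K c s z) t (z * ((gamma K t)%:C * Bt E K c t z)).
Proof.
move=> tP; have tP' := box_half tP; have T'0 : - T <= 0 by rewrite oppr_le0 ltW.
have W1 := cdw_sub T'0 (lexx _) (W_dw z m11 tP').
have W2 := cdw_sub T'0 (lexx _) (W_dw (- z) m11 tP').
rewrite opprK in W1 W2.
have := cdwM (cdw_real (m_dw tP)) (cdwZ (2^-1) (cdwD (cdwZ (E z) W1) (cdwZ (E (- z)) W2))).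
move=> H; apply: (@cdw_ext _ _ _ (fun y => (mfun_of K y)%:C * (2^-1 * (E z * W 1 y z + E (- z) * W 1 y (- z)))) _ _ _ _ tP); last first.
  rewrite /Bt frakBE//; set l := (X in cdw _ _ _ _ X).
  set l' := (X in cdw _ _ _ _ X) in H.
  suff -> : l = l' by exact: H.
  rewrite /l /l' /gamma rmorphXn rmorphM rmorphM rmorphN1 fmorphV /=.
  have : (mfun_of K t)%:C != 0 :> R[i] by rewrite fmorph_eq0 gt_eqF// m_gt0.
  move: (mfun_of K t)%:C (rmu t)%:C => m r m0.
  by field.
by move=> s sP; rewrite /At frakAE ?box_half.
Qed.

(** [(1/m)' = - mu / m] cancels the term [mu b]; the minus sign is the product of the [i] of [frakB]
    with that of [iz a]. *)
Lemma Bt_dw t z : 0 <= t <= T ->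
  cdw 0 T (fun s => Bt E K c s z) t (- (z * (((gamma K t)^-1)%:C * At E K c t z))).
Proof.
move=> tP; have tP' := box_half tP; have T'0 : - T <= 0 by rewrite oppr_le0 ltW.
have W1 := cdw_sub T'0 (lexx _) (W_dw z m1 tP').
have W2 := cdwZ (-1) (cdw_sub T'0 (lexx _) (W_dw (- z) m1 tP')).
have := cdwM (cdw_real (mV_dw tP)) (cdwZ 'i%C (cdwZ (2^-1) (cdwD (cdwZ (E z) W1) (cdwZ (E (- z)) W2)))).
move=> H; apply: (@cdw_ext _ _ _ (fun y => ((mfun_of K y)^-1)%:C * ('i%C * (2^-1 * (E z * W (-1) y z + E (- z) * (-1 * W (-1) y (- z)))))) _ _ _ _ tP); last first.
  rewrite /At frakAE//; set l := (X in cdw _ _ _ _ X).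
  set l' := (X in cdw _ _ _ _ X) in H.
  suff -> : l = l' by exact: H.
  rewrite /l /l' /gamma !fmorphV rmorphXn mul1r rmorphM rmorphN !fmorphV /=.
  have : (mfun_of K t)%:C != 0 :> R[i] by rewrite fmorph_eq0 gt_eqF// m_gt0.
  have : 'i%C * 'i%C = -1 :> R[i] by rewrite -expr2 sqr_i.
  (* The unit [i] becomes a variable [j] for [field], and [j * j = -1] is used once at the end. *)
  move: (mfun_of K t)%:C (rmu t)%:C 'i%C => m r j jj m0.
  rewrite (_ : (m ^+ 2)^-1 * (m * _) = m^-1 * (2^-1 * (E z * W 1 t z + E (- z) * W 1 t (- z)))); last by field.
  rewrite [RHS](_ : _ = m^-1 * (j * j) * z * (2^-1 * (E z * W 1 t z + E (- z) * W 1 t (- z)))); last by field.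
  by rewrite jj; ring.
move=> s sP; rewrite /Bt frakBE ?box_half//; congr (_ * (_ * (_ * (_ + _)))).
by rewrite mulrCA mulN1r.
Qed.

(** Conjugation at the conjugate point turns [E(z) W(z)] into [E(- z) W(- z)], so the two summands
    are exchanged. *)
Lemma real_entire_At t : 0 <= t <= T -> real_entire (At E K c t).
Proof.
move=> tP; have tP' := box_half tP; have eW := entire_W m1 tP'.
have AE z : At E K c t z = (mfun_of K t)%:C * (2^-1 * (E z * W 1 t z + E (- z) * W 1 t (- z))).
  by rewrite /At frakAE.
split.
  rewrite (_ : At E K c t = (fun z => (mfun_of K t)%:C * (2^-1 * (E z * W 1 t z + E (- z) * W 1 t (- z))))); last first.
    by apply/funext => z; exact: AE.
  apply: (@entireM _ (fun=> (mfun_of K t)%:C)); first exact: entire_cst.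
  apply: (@entireM _ (fun=> 2^-1)); first exact: entire_cst.
  apply: (entireD (F := fun z => E z * W 1 t z)); first exact: entireM.
  exact: (entireM (entire_opp eE) (entire_opp eW)).
move=> z; have cE w : conjc (E w) = E (- conjc w).
  by rewrite -(K1_sharp _ hK1) /sharp conjcK.
rewrite /sharp !AE !conjcM conjcR conjcD !conjcM !cE !conj_W// !conjcN conjcK !opprK.
by rewrite conjc2V [X in _ * (_ * X)]addrC.
Qed.

(** The exchange of the summands changes the sign of the difference, and conjugation of [i] restores
    it. *)
Lemma real_entire_Bt t : 0 <= t <= T -> real_entire (Bt E K c t).
Proof.
move=> tP; have tP' := box_half tP; have eW := entire_W m11 tP'.
have BE z : Bt E K c t z = ((mfun_of K t)^-1)%:C *
    ('i%C * (2^-1 * (E z * W (-1) t z - E (- z) * W (-1) t (- z)))).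
  by rewrite /Bt frakBE.
split.
  rewrite (_ : Bt E K c t = (fun z => ((mfun_of K t)^-1)%:C *
    ('i%C * (2^-1 * (E z * W (-1) t z - E (- z) * W (-1) t (- z)))))); last first.
    by apply/funext => z; exact: BE.
  apply: (@entireM _ (fun=> ((mfun_of K t)^-1)%:C)); first exact: entire_cst.
  apply: (@entireM _ (fun=> 'i%C)); first exact: entire_cst.
  apply: (@entireM _ (fun=> 2^-1)); first exact: entire_cst.
  apply: (entireB (F := fun z => E z * W (-1) t z)); first exact: entireM.
  exact: (entireM (entire_opp eE) (entire_opp eW)).
move=> z; have cE w : conjc (E w) = E (- conjc w).
  by rewrite -(K1_sharp _ hK1) /sharp conjcK.
rewrite /sharp !BE !conjcM conjcR conjcB !conjcM !cE !conj_W// !conjcN conjcK !opprK.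
by rewrite conjc2V conjci; ring.
Qed.

Lemma At_opp t z : 0 <= t <= T -> At E K c t (- z) = At E K c t z.
Proof.
by move=> tP; rewrite /At !frakAE ?box_half// opprK [X in _ * (_ * X)]addrC.
Qed.

Lemma Bt_opp t z : 0 <= t <= T -> Bt E K c t (- z) = - Bt E K c t z.
Proof. by move=> tP; rewrite /Bt !frakBE ?box_half// opprK; ring. Qed.

(** At [t = 0] every argument of [K] in the equation on [[-T, 0]] is nonpositive, so [rphi eps 0]
    vanishes there. *)
Lemma W0 eps z : eps * eps = 1 -> W eps 0 z = 1.
Proof.
move=> e2; rewrite /W /wfun eiz0 (_ : citg _ _ _ = 0) ?mulr0 ?subr0//.
rewrite -(citg0 (- T) 0); apply: citg_eq => x xP.
have tP : - T <= 0 <= T by move: T0; lra.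
have xT : `|x| <= T by exact: itv_norm xP.
rewrite (_ : rphi eps 0 x = 0) ?mul0r//.
have := rphiE T0 Kc inj e2 tP xT; rewrite /kop addr0 K_nonpos; last by case/andP: xP.
rewrite (_ : itg _ _ _ = 0) ?mulr0 ?addr0//.
transitivity (itg (- T) 0 (fun=> 0 : R)); last exact: itg0.
by apply: itg_eq => y yP; rewrite K_nonpos ?mul0r//; move: xP yP; lra.
Qed.

Lemma mfun0 : mfun_of K 0 = 1.
Proof. by rewrite (mfun_rmu T0 Kc K_nonpos noeig) ?lexx ?ltW// itg_pt expR0. Qed.

Lemma At0 z : At E K c 0 z = Afun E z.
Proof.
have tP : - T <= 0 <= T by move: T0; lra.
by rewrite /At mfun0 frakAE// !W0// !mulr1 mul1r /Afun (K1_sharp _ hK1).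
Qed.

Lemma Bt0 z : Bt E K c 0 z = Bfun E z.
Proof.
have tP : - T <= 0 <= T by move: T0; lra.
by rewrite /Bt mfun0 invr1 frakBE// !W0// !mulr1 mul1r /Bfun (K1_sharp _ hK1) mulrA.
Qed.

End fixed_box.

Theorem theorem5 (R : realType) (E : R[i] -> R[i]) (rho K : R -> R) (c : R)
    (tau : \bar R)
    (entire_E : entire E) (hK1 : K1 E rho) (hK2 : K2 E K c) (hK3 : K3 K)
    (hK4 : K4 K) (hK5 : K5 K tau) :
  [/\ (forall t, dom tau t -> mfun_of K t = detK K t 1 / detK K t (-1)),
      (forall t, dom tau t ->
         real_entire (At E K c t) /\ real_entire (Bt E K c t)),
      (forall z,
         [/\ {within dom tau, continuous ((fun t => At E K c t z) : R -> R[i]^o)},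
             {within dom tau, continuous ((fun t => Bt E K c t z) : R -> R[i]^o)},
             piecewise_C1 (dom tau) (fun t => At E K c t z) &
             piecewise_C1 (dom tau) (fun t => Bt E K c t z)]) &
      (forall t, dom tau t -> forall z,
         At E K c t (- z) = At E K c t z /\ Bt E K c t (- z) = - Bt E K c t z)] /\
  (forall z, solves_canonical_system (dom tau) (Hamiltonian K) z
     (fun t => col2 (At E K c t z) (Bt E K c t z))) /\
  (forall z, [/\ Afun E z = At E K c 0 z, Bfun E z = Bt E K c 0 z &
     E z = At E K c 0 z - 'i%C * Bt E K c 0 z]).
Proof.
have Kc : continuous K by case: hK2.
have K0 := K_nonpos hK2 hK3.
have I0 s : dom tau s -> 0 <= s by case.
(* The margin [t < T < tau] makes [[0, T]] a neighbourhood of [t] in the domain; any endpoint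
   [s <= T], negative ones included, satisfies [s < tau], so [hK5] covers [[-T, T]]. *)
have box t : dom tau t -> exists T, [/\ 0 < T, t < T, 0 <= t <= T & forall s, - T <= s <= T ->
    ~ Kop_eigenvalue K s 1 /\ ~ Kop_eigenvalue K s (-1)].
  move=> [t0 ttau]; have [T [tT Ttau]] : exists T, t < T /\ (T%:E < tau)%E.
    case: (tau) ttau => [r| |] //; last by move=> _; exists (t + 1); rewrite ltrDl ltry.
    by rewrite lte_fin => tr; exists ((t + r) / 2); rewrite lte_fin !midf_lt.
  exists T; split=> //; first exact: le_lt_trans tT.
    by rewrite t0 ltW.
  move=> s /andP[_ sT]; apply: hK5.2; apply: le_lt_trans Ttau; by rewrite lee_fin.
have dA t z : dom tau t -> exists T, t < T /\
    cdw 0 T (fun s => At E K c s z) t (z * ((gamma K t)%:C * Bt E K c t z)).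
  by move=> /box[T [T0 tT tP noeig]]; exists T; split=> //; exact: (At_dw entire_E hK1 hK2 hK3 T0 noeig).
have dB t z : dom tau t -> exists T, t < T /\
    cdw 0 T (fun s => Bt E K c s z) t (- (z * (((gamma K t)^-1)%:C * At E K c t z))).
  by move=> /box[T [T0 tT tP noeig]]; exists T; split=> //; exact: (Bt_dw entire_E hK1 hK2 hK3 T0 noeig).
(* By the equations the derivatives are products of functions differentiable in [t]; this gives the
   continuity required in [piecewise_C1]. *)
have dA' t z : dom tau t -> exists T l, t < T /\
    cdw 0 T (fun s => z * ((gamma K s)%:C * Bt E K c s z)) t l.
  move=> /box[T [T0 tT tP noeig]]; exists T.
  have dm := cdw_real (m_dw hK2 hK3 T0 noeig tP).
  have d2 := cdwM dm dm.
  eexists; split=> //; apply: cdwZ; apply: (cdwM _ (Bt_dw entire_E hK1 hK2 hK3 T0 noeig z tP)).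
  apply: (cdw_ext _ tP d2) => s _; by rewrite /gamma expr2 rmorphM.
have dB' t z : dom tau t -> exists T l, t < T /\
    cdw 0 T (fun s => - (z * (((gamma K s)^-1)%:C * At E K c s z))) t l.
  move=> /box[T [T0 tT tP noeig]]; exists T.
  have dm := cdw_real (mV_dw hK2 hK3 T0 noeig tP).
  have d2 := cdwM dm dm.
  have [k H] : exists k, cdw 0 T (fun s => ((gamma K s)^-1)%:C) t k.
    by eexists; apply: (cdw_ext _ tP d2) => s _; rewrite /gamma expr2 invfM rmorphM.
  have := cdwZ (-1) (cdwZ z (cdwM H (At_dw entire_E hK1 hK2 hK3 T0 noeig z tP))).
  move=> H2; eexists; split=> //; apply: (cdw_ext _ tP H2) => s _; by rewrite mulN1r.
split.
  split.
  - by move=> t /box[T [T0 tT tP noeig]]; exact: (mfun_detK T0 Kc K0 noeig tP).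
  - move=> t /box[T [T0 tT tP noeig]]; split.
      exact: (real_entire_At entire_E hK1 hK2 hK3 T0 noeig tP).
    exact: (real_entire_Bt entire_E hK1 hK2 hK3 T0 noeig tP).
  - move=> z; split.
    + apply/subspace_continuousP => t td; have [T [tT h]] := dA t z td.
      exact: cdw_continuous I0 tT h.
    + apply/subspace_continuousP => t td; have [T [tT h]] := dB t z td.
      exact: cdw_continuous I0 tT h.
    + apply: (@cdw_piecewise_C1 _ _ _ (fun t => z * ((gamma K t)%:C * Bt E K c t z))) => t.
        exact: dA.
      exact: dA'.
    + apply: (@cdw_piecewise_C1 _ _ _ (fun t => - (z * (((gamma K t)^-1)%:C * At E K c t z)))) => t.
        exact: dB.
      exact: dB'.
  - move=> t /box[T [T0 tT tP noeig]] z; split.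
      exact: (At_opp entire_E hK1 hK2 hK3 T0 noeig z tP).
    exact: (Bt_opp entire_E hK1 hK2 hK3 T0 noeig z tP).
have d0 : dom tau 0 by split=> //; case: hK5.
split.
  move=> z t td; have [T [T0 tT tP noeig]] := box t td.
  have hA := At_dw entire_E hK1 hK2 hK3 T0 noeig z tP.
  have hB := Bt_dw entire_E hK1 hK2 hK3 T0 noeig z tP.
  exists (col2 (z * ((gamma K t)%:C * Bt E K c t z)) (- (z * (((gamma K t)^-1)%:C * At E K c t z)))).
    exact: cdw_col2_derivative I0 tT hA hB.
  (* The entries of [J H(t) Y(t)] are [- gamma B] and [A / gamma]. *)
  apply/colP => i; rewrite !mxE !big_ord_recl big_ord0 !mxE !big_ord_recl !big_ord0 !mxE /=.
  case: i => -[|[|//]] ilt /=.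
    rewrite !(mulr1n, mulr0n, mul0r, mulr0, addr0, add0r, mulN1r) rmorphN.
    by rewrite mulNr mulrN.
  rewrite !(mulr1n, mulr0n, mul0r, mulr0, addr0, add0r, mul1r).
  by rewrite opprK.
move=> z; have [T [T0 _ _ noeig]] := box 0 d0.
have A0 := At0 entire_E hK1 hK2 hK3 T0 noeig z.
have B0 := Bt0 entire_E hK1 hK2 hK3 T0 noeig z.
rewrite A0 B0; split=> //; rewrite /Afun /Bfun.
have jj : 'i%C * 'i%C = -1 :> R[i] by rewrite -expr2 sqr_i.
rewrite (_ : 'i%C * ('i%C / 2 * _) = ('i%C * 'i%C) * (2^-1 * (E z - sharp E z))); last by ring.
by rewrite jj; field.
Qed.
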